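(* For every integer $n \geq 50$, $$3\left(\Delta\bar{p}(n+2)\right)^2-4\,\Delta\bar{p}(n+1)\,\Delta\bar{p}(n+3)+\Delta\bar{p}(n)\,\Delta\bar{p}(n+4)>0,$$ where $\bar{p}(n)$ is the number of overpartitions of $n$ and $\Delta \bar{p}(n)=\bar{p}(n+1)-\bar{p}(n)$.
   Context: A partition of a positive integer $n$ is a non-increasing sequence of positive integers with sum $n$. An overpartition of $n$ is a partition of $n$ in which the first occurrence of each distinct part may (or may not) be overlined; $\bar{p}(n)$ denotes the number of overpartitions of $n$. The first-order forward difference of a sequence $f(n)$ is $\Delta f(n)=f(n+1)-f(n)$. The inequality is called the Laguerre inequality of order $2$ for the sequence $\Delta\bar{p}(n)$. *)

(* Defs.v *)
From HB Require Import structures.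
From mathcomp Require Import all_boot all_order all_algebra.
Set Implicit Arguments.
Unset Strict Implicit.
Unset Printing Implicit Defensive.

(* A sequence of parts, each paired with a flag that says whether the part is
   overlined.  [index] gives the position of the first occurrence, so the last
   conjunct says that only first occurrences carry an overline. *)
Definition is_overpartition (n : nat) (s : seq (nat * bool)) : bool :=
  let parts := unzip1 s in
  [&& sorted geq parts, all (fun p => 0 < p) parts, sumn parts == n
    & [forall i : 'I_(size s),
         nth false (unzip2 s) i ==> (index (nth 0 parts i) parts == i)]].

Definition flagged_parts (n : nat) (s : n.-bseq ('I_n.+1 * bool)) :
    seq (nat * bool) :=
  [seq (nat_of_ord x.1, x.2) | x <- s].

(* An overpartition of n has at most n parts, each at most n, so counting within
   this finite type loses none: see [flagged_parts_inj] and
   [overpartition_flagged_parts]. *)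
Definition pbar (n : nat) : nat :=
  #|[set s : n.-bseq ('I_n.+1 * bool) | is_overpartition n (flagged_parts s)]|.

Lemma flagged_parts_inj n : injective (@flagged_parts n).
Proof.
move=> s t; rewrite /flagged_parts => /inj_map H; apply/val_inj/H.
by move=> [a b] [c d] /= [/val_inj -> ->].
Qed.

Lemma overpartition_flagged_parts n (s : seq (nat * bool)) :
  is_overpartition n s ->
  exists t : n.-bseq ('I_n.+1 * bool), flagged_parts t = s.
Proof.
case/and4P=> _ pos /eqP sum_s _.
have size_s : size s <= n.
  rewrite -sum_s; elim: s pos {sum_s} => //= x s IHs /andP[x_gt0 /IHs].
  by rewrite -add1n; apply: leq_add.
have parts_le x : x \in s -> x.1 <= n.
  rewrite -sum_s; elim: s {pos sum_s size_s} => //= y s IHs.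
  rewrite inE => /predU1P[-> | /IHs le_x]; first exact: leq_addr.
  exact: leq_trans le_x (leq_addl _ _).
have size_t : size [seq (inord x.1 : 'I_n.+1, x.2) | x <- s] <= n.
  by rewrite size_map.
exists (Bseq size_t); rewrite /flagged_parts /= -map_comp -[RHS]map_id.
by apply/eq_in_map => -[a b] /parts_le /= a_le; rewrite inordK.
Qed.

Import GRing.Theory.
Local Open Scope ring_scope.

Definition Delta (f : nat -> int) (n : nat) : int := f n.+1 - f n.

Definition dpbar : nat -> int := Delta (fun n => (pbar n)%:Z).

(* Main.v *)
(* Let [g n = pbar n - pbar (n - 1)], so that [sum_n g n q^n] is
   [(1 - q) prod_k (1 + q^k) / (1 - q^k) = exp (sum_k e_k q^k / k)] with
   [e_k = 2 (sum of the d | k with k/d odd) - 1 > 0].  On the circle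
   [q = r exp (i y)], with [r] at the saddle point of the coefficient of index
   [m], the modulus of this function relative to its value at [y = 0] is a weight
   [w(y)] and its phase relative to [exp (i m y)] is [- psi(y)].  For the
   coefficients of index near [m] the Laguerre expression becomes
     [4 (I0 I1 + I2 I3 + I4 I5)],
   where the integrals over [0, PI] are
     [I0 = int w cos psi],                   [I1 = int w cos psi (1 - cos y)^2],
     [I2 = int w cos psi (1 - cos y) cos y], [I3 = int w cos psi (1 - cos y) (2 + cos y)],
     [I4 = int w sin psi sin y (1 - cos y)], [I5 = int w sin psi sin y (1 + cos y)].
   Since [e_k > 0], [w] is bounded below by a Gaussian and [0 <= psi = O(y^3)];
   since [e_k >= 2 k - 1], [w] is bounded above by an explicit geometric sum.
   Hence each integral is dominated by the region where [psi < PI/2], which gives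
   positivity for [m >= 6000] without any modular transformation.  Only finitely
   many [e_k] matter for a given coefficient, so all sums in [k] are finite.
   The remaining indices are checked by computation, with the values of [pbar]
   given by Gauss's identity [sum_n pbar n q^n * sum_k (-1)^k q^(k^2) = 1]. *)

Require Import Defs.
From Stdlib Require Reals Lra Lia Psatz ZArith FMapPositive.
From Coquelicot Require Coquelicot.
From mathcomp Require Import ssreflect.

(** The coefficients 3, -4, 1 sum to 0, so the Laguerre expression is far smaller than its terms:
    separate estimates of the three products would need relative precision [x^6], where
    [x = - ln r]. The integral form performs this cancellation exactly. With [h = sqrt x] the weight
    has width [h^3], so [I0] has size [h^3], [I1] size [h^15], [I2] and [I3] size [h^9]; both cosine
    products have size [h^18]. As [psi] is [O(h)] on that width, [I4 I5] has the smaller order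
    [h^20]. Crude constants therefore suffice: [I0 I1] is bounded below, [I2] and [I3] are only
    shown to be nonnegative, and [I4 I5] is at least [- 7/10000 h^18]. No complex analysis enters:
    integrals and coefficients are identified because both satisfy [n c_n = sum_k k beta_k c_(n-k)],
    up to the scaling by [r^n], and vanish at negative indices. The threshold comes from
    [m x^2 <= 247/100]: for [m >= 6000] it gives [x <= 203/10000] and [h <= 57/400], just enough to
    keep [psi] below [PI/2] up to [8/5 h^3]. *)

Module Analysis.

Import Reals Lra Lia Psatz ZArith Coquelicot.Coquelicot.
Open Scope R_scope.

Definition cos_int (w psi a : R -> R) : R :=
  RInt (fun y => w y * cos (psi y) * a y) 0 PI.
Definition sin_int (w psi a : R -> R) : R :=
  RInt (fun y => w y * sin (psi y) * a y) 0 PI.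

(** * Fourier coefficients of exponentials of sine sums *)

Lemma derive_continuous (f : R -> R) y l : is_derive f y l -> continuous f y.
Proof.
intros H; apply (ex_derive_continuous (V := R_NormedModule) f y); now exists l.
Qed.

Lemma continuous_sum_f_R0 (f : nat -> R -> R) N y :
  (forall k, continuous (f k) y) ->
  continuous (fun y => sum_f_R0 (fun k => f k y) N) y.
Proof.
intros H; induction N as [|N IH]; cbn [sum_f_R0]; [apply H|].
now apply (continuous_plus (V := R_NormedModule)).
Qed.

Section Fourier.
Variables (K : nat) (e beta : nat -> R) (g : nat -> R) (r : R).

(** [- cos_loss y] and [sin_sum y] are the real and imaginary parts of
    [sum_k beta k (exp (i k y) - 1)], the logarithm of the normalized generating function. By parity
    in [y] the Fourier integrals are taken over half a period. *)
Definition cos_loss (y : R) := sum_f_R0 (fun k => beta k * (1 - cos (INR k * y))) K.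
Definition sin_sum (y : R) := sum_f_R0 (fun k => beta k * sin (INR k * y)) K.
Definition weight (y : R) := exp (- cos_loss y).
Definition fourier_coef (n : Z) : R := RInt
  (fun y => weight y * cos (sin_sum y - IZR n * y)) 0 PI.

Lemma is_derive_sum_f_R0 (f f' : nat -> R -> R) N y :
  (forall k, is_derive (f k) y (f' k y)) ->
  is_derive (fun y => sum_f_R0 (fun k => f k y) N) y
            (sum_f_R0 (fun k => f' k y) N).
Proof.
intros H; induction N as [|N IH]; simpl; [apply H|].
now apply: is_derive_plus.
Qed.

Lemma cos_loss_derive y :
  is_derive cos_loss y (sum_f_R0 (fun k => INR k * beta k * sin (INR k * y)) K).
Proof.
apply (is_derive_sum_f_R0 (fun k y => beta k * (1 - cos (INR k * y)))
  (fun k y => INR k * beta k * sin (INR k * y))).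
intros k; auto_derive; [easy|ring].
Qed.

Lemma sin_sum_derive y :
  is_derive sin_sum y (sum_f_R0 (fun k => INR k * beta k * cos (INR k * y)) K).
Proof.
apply (is_derive_sum_f_R0 (fun k y => beta k * sin (INR k * y))
  (fun k y => INR k * beta k * cos (INR k * y))).
intros k; auto_derive; [easy|ring].
Qed.

Lemma sin_sum_continuous y : continuous sin_sum y.
Proof. eapply derive_continuous, sin_sum_derive. Qed.

Lemma weight_continuous y : continuous weight y.
Proof.
apply (continuous_comp (fun y => - cos_loss y) exp).
  apply (continuous_opp (V := R_NormedModule) cos_loss);
    eapply derive_continuous, cos_loss_derive.
apply continuous_exp.
Qed.

Lemma integrand_continuous a y :
  continuous (fun y => weight y * cos (sin_sum y - a * y)) y.
Proof.
apply (continuous_mult weight); [apply weight_continuous|].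
apply (continuous_comp (fun y => sin_sum y - a * y) cos); [|apply continuous_cos].
apply (continuous_minus sin_sum); [apply sin_sum_continuous|].
apply (continuous_mult (fun _ => a)); [apply continuous_const|apply continuous_id].
Qed.

Lemma integrand_ex a b c : ex_RInt (fun y => weight y * cos (sin_sum y - a * y)) b c.
Proof. apply (ex_RInt_continuous (V := R_CompleteNormedModule)); intros;
  apply integrand_continuous. Qed.

Lemma fourier_coef_is n : is_RInt (fun y => weight y * cos (sin_sum y - IZR n * y)) 0 PI
  (fourier_coef n).
Proof. apply (RInt_correct (V := R_CompleteNormedModule)), integrand_ex. Qed.

Lemma is_RInt_sum_f_R0 (f : nat -> R -> R) (l : nat -> R) N a b :
  (forall k, is_RInt (f k) a b (l k)) ->
  is_RInt (fun y => sum_f_R0 (fun k => f k y) N) a b (sum_f_R0 l N).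
Proof.
intros H; induction N as [|N IH]; simpl; [apply H|].
now apply: is_RInt_plus.
Qed.

Lemma sin_eq_0_Z (n : Z) : sin (IZR n * PI) = 0.
Proof. apply sin_eq_0_1; now exists n. Qed.

Lemma sin_sum_PI : sin_sum PI = 0.
Proof.
unfold sin_sum; induction K as [|N IH]; cbn [sum_f_R0]; [|rewrite IH];
  rewrite INR_IZR_INZ sin_eq_0_Z; ring.
Qed.

Lemma sin_sum_0 : sin_sum 0 = 0.
Proof.
unfold sin_sum; induction K as [|N IH]; cbn [sum_f_R0]; [|rewrite IH];
  rewrite Rmult_0_r sin_0; ring.
Qed.

(* Integrate the derivative of [weight * sin (sin_sum - n y)], which vanishes at both ends. *)
Lemma fourier_coef_rec n :
  IZR n * fourier_coef n
  = sum_f_R0 (fun k => INR k * beta k * fourier_coef (n - Z.of_nat k)) K.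
Proof.
set (F := fun y => weight y * sin (sin_sum y - IZR n * y)).
set (F' := fun y =>
  sum_f_R0 (fun k => INR k * beta k *
      (weight y * cos (sin_sum y - IZR (n - Z.of_nat k) * y))) K
  - IZR n * (weight y * cos (sin_sum y - IZR n * y))).
assert (I1 : is_RInt F' 0 PI
  (sum_f_R0 (fun k => INR k * beta k * fourier_coef (n - Z.of_nat k)) K
   - IZR n * fourier_coef n)).
  apply: is_RInt_minus.
    apply (is_RInt_sum_f_R0 (fun k y => INR k * beta k *
      (weight y * cos (sin_sum y - IZR (n - Z.of_nat k) * y)))); intros k.
    apply: is_RInt_scal; apply fourier_coef_is.
  apply: is_RInt_scal; apply fourier_coef_is.
assert (D : forall y, is_derive F y (F' y)).
  intros y; unfold F.
  evar_last.
    apply: is_derive_mult.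
      apply: is_derive_comp; [apply is_derive_exp|apply: is_derive_opp; apply cos_loss_derive].
      apply: is_derive_comp; [apply is_derive_sin|].
      apply: is_derive_minus; [apply sin_sum_derive|].
      apply: is_derive_scal; apply is_derive_id.
    intros; apply Rmult_comm.
  unfold plus, mult, scal, opp, minus, one; simpl; unfold mult; simpl.
  unfold F', plus, opp; simpl; fold (weight y).
  transitivity (sum_f_R0 (fun k => INR k * beta k * cos (INR k * y)) K
      * (weight y * cos (sin_sum y - IZR n * y))
    - sum_f_R0 (fun k => INR k * beta k * sin (INR k * y)) K
      * (weight y * sin (sin_sum y - IZR n * y))
    - IZR n * (weight y * cos (sin_sum y - IZR n * y))); [ring|].
  f_equal.
  rewrite 2!(Rmult_comm (sum_f_R0 _ _)) 2!scal_sum -minus_sum.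
  apply sum_eq; intros k _.
  replace (sin_sum y - IZR (n - Z.of_nat k) * y)
    with (INR k * y + (sin_sum y - IZR n * y))
    by (rewrite minus_IZR -INR_IZR_INZ; ring).
  rewrite cos_plus; ring.
assert (C : forall y, continuous F' y).
  intros y; apply (continuous_minus (V := R_NormedModule) (fun y =>
     sum_f_R0 (fun k => INR k * beta k *
      (weight y * cos (sin_sum y - IZR (n - Z.of_nat k) * y))) K)).
    apply continuous_sum_f_R0; intros k.
    apply (continuous_mult (fun _ => INR k * beta k)); [apply continuous_const|].
    apply integrand_continuous.
  apply (continuous_mult (fun _ => IZR n)); [apply continuous_const|].
  apply integrand_continuous.
assert (I2 : is_RInt F' 0 PI (F PI - F 0)).
  apply: is_RInt_derive; intros y _; [apply D|apply C].
apply (is_RInt_unique (V := R_CompleteNormedModule)) in I1.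
apply (is_RInt_unique (V := R_CompleteNormedModule)) in I2.
rewrite I1 in I2; unfold F in I2; rewrite sin_sum_PI sin_sum_0 in I2.
replace (0 - IZR n * PI) with (- (IZR n * PI)) in I2 by ring.
rewrite sin_neg sin_eq_0_Z Rmult_0_r Rminus_0_r sin_0 in I2; lra.
Qed.

Lemma fourier_coef_bounded : exists M, 0 <= M /\ forall n, Rabs (fourier_coef n) <= M.
Proof.
exists (RInt weight 0 PI).
assert (E : ex_RInt weight 0 PI).
  apply (ex_RInt_continuous (V := R_CompleteNormedModule)); intros; apply weight_continuous.
assert (P := PI_RGT_0).
split.
  apply RInt_ge_0; [lra|exact E|intros; apply Rlt_le, exp_pos].
intros n; unfold fourier_coef.
eapply Rle_trans; [apply abs_RInt_le; [lra|apply integrand_ex]|].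
apply RInt_le; [lra| |exact E|].
  apply (ex_RInt_continuous (V := R_CompleteNormedModule)); intros y _.
  apply (continuous_comp (fun y => weight y * cos (sin_sum y - IZR n * y)) Rabs);
    [apply integrand_continuous|apply continuous_Rabs].
intros y _; rewrite Rabs_mult (Rabs_pos_eq (weight y)); [|apply Rlt_le, exp_pos].
rewrite -[X in _ <= X]Rmult_1_r; apply Rmult_le_compat_l; [apply Rlt_le, exp_pos|].
apply Rabs_le, COS_bound.
Qed.

(** The recurrence refers only to lower indices. Once [|n|] exceeds twice the sum of the
    [|k beta k|], dividing by [n] halves any uniform bound valid below, so iteration gives
    [M / 2 ^ j] for all [j]. *)
Lemma fourier_coef_very_neg :
  exists N : Z, (0 < N)%Z /\ forall n : Z, (n <= - N)%Z -> fourier_coef n = 0.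
Proof.
destruct fourier_coef_bounded as [M [M0 HM]].
set (C := sum_f_R0 (fun k => Rabs (INR k * beta k)) K).
assert (C0 : 0 <= C) by (apply cond_pos_sum; intros; apply Rabs_pos).
set (N := up (2 * C)).
assert (HN : 2 * C < IZR N) by apply archimed.
assert (N0 : (0 < N)%Z) by (apply lt_IZR; lra).
exists N; split; [easy|].
assert (H : forall j n, (n <= - N)%Z -> Rabs (fourier_coef n) <= M * (/ 2) ^ j).
  induction j as [|j IH]; intros n Hn; [rewrite pow_O Rmult_1_r; apply HM|].
  assert (B : Rabs (IZR n * fourier_coef n) <= M * (/ 2) ^ j * C).
    rewrite fourier_coef_rec.
    eapply Rle_trans; [apply Rsum_abs|].
    unfold C; rewrite scal_sum; apply sum_Rle; intros k _.
    rewrite Rabs_mult; apply Rmult_le_compat_l; [apply Rabs_pos|].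
    apply IH; lia.
  assert (Hn' : IZR n <= - IZR N) by (rewrite -opp_IZR; now apply IZR_le).
  assert (0 < (/2) ^ j) by (apply pow_lt; lra).
  rewrite Rabs_mult (Rabs_left (IZR n)) in B; [|lra].
  assert (0 <= Rabs (fourier_coef n)) by apply Rabs_pos.
  simpl; apply Rmult_le_reg_l with (IZR N); [lra|].
  assert (IZR N * Rabs (fourier_coef n) <= - IZR n * Rabs (fourier_coef n))
    by (apply Rmult_le_compat_r; lra).
  assert (M * (/ 2) ^ j * C <= M * (/2)^j * (IZR N / 2)).
    apply Rmult_le_compat_l; [apply Rmult_le_pos; lra|lra].
  nra.
intros n Hn.
apply Rabs_eq_0, Rle_antisym; [|apply Rabs_pos].
assert (L : is_lim_seq (fun j => M * (/ 2) ^ j) (M * 0)).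
  apply (is_lim_seq_scal_l _ M 0), is_lim_seq_geom; rewrite Rabs_pos_eq; lra.
assert (L' := is_lim_seq_le _ _ _ _ (fun j => H j n Hn) (is_lim_seq_const (Rabs (fourier_coef
  n))) L).
simpl in L'; lra.
Qed.

(** Replaces the analyticity argument: climbing from the region where everything vanishes, the term
    [k = 0] has coefficient 0 and the others refer to smaller indices, so [n c_n = 0] as long as
    [n < 0]. *)
Lemma fourier_coef_neg n : (n < 0)%Z -> fourier_coef n = 0.
Proof.
destruct fourier_coef_very_neg as [N [N0 HN]].
assert (H : forall i : nat, forall n : Z,
  (n < 0)%Z -> (n <= - N + Z.of_nat i)%Z -> fourier_coef n = 0).
  induction i as [|i IH]; intros m Hm Hi; [apply HN; lia|].
  assert (R := fourier_coef_rec m).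
  rewrite (sum_eq _ (fun _ => 0)) in R; last first.
    intros [|k] _; [simpl; ring|].
    rewrite IH; [ring|lia|lia].
  rewrite sum_eq_R0 in R; [|easy].
  apply Rmult_integral in R as [R|R]; [apply (eq_IZR m 0) in R; lia|easy].
intros Hn; apply (H (Z.to_nat N)); lia.
Qed.

Lemma sum_f_R0_trunc (f : nat -> R) n N :
  (n <= N)%nat -> (forall k, (n < k)%nat -> f k = 0) ->
  sum_f_R0 f N = sum_f_R0 f n.
Proof.
intros H Hf; induction H as [|N H IH]; [easy|].
rewrite tech5 IH Hf; [ring|lia].
Qed.

(** With the negative indices gone, both sides obey one recurrence and agree at 0. The sum stops at
    [K], hence agreement only up to index [K]. *)
Lemma fourier_coef_eq :
  (forall k, INR k * beta k = e k * r ^ k) ->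
  g 0%nat = 1 ->
  (forall n, INR n * g n = sum_f_R0 (fun k => e k * g (n - k)%nat) n) ->
  forall n, (n <= K)%nat -> fourier_coef (Z.of_nat n) = fourier_coef 0 * r ^ n * g n.
Proof.
intros Hb g0 Hg.
assert (e0 : e 0%nat = 0) by (generalize (Hb 0%nat); simpl; lra).
induction n as [[|n] IH] using (well_founded_induction Wf_nat.lt_wf); intros HnK.
  simpl; rewrite g0; ring.
assert (n0 : INR (S n) <> 0) by (apply not_0_INR; lia).
apply Rmult_eq_reg_l with (INR (S n)); [|easy].
rewrite {1}INR_IZR_INZ fourier_coef_rec.
rewrite (sum_f_R0_trunc _ (S n)); [|easy|]; last first.
  intros k Hk; rewrite fourier_coef_neg; [ring|lia].
replace (INR (S n) * (fourier_coef 0 * r ^ S n * g (S n)))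
  with (fourier_coef 0 * r ^ S n * (INR (S n) * g (S n))) by ring.
rewrite Hg scal_sum; apply sum_eq; intros [|k] Hk.
  rewrite e0; simpl; ring.
replace (Z.of_nat (S n) - Z.of_nat (S k))%Z with (Z.of_nat (S n - S k)) by lia.
rewrite IH; [|lia|lia].
rewrite Hb.
replace (r ^ S n) with (r ^ S k * r ^ (S n - S k)); [ring|].
rewrite -pow_add; f_equal; lia.
Qed.

Section Laguerre.
Variable m : Z.

Definition phase (y : R) := IZR m * y - sin_sum y.

Local Notation ci := (cos_int weight phase).
Local Notation si := (sin_int weight phase).

Lemma phase_continuous y : continuous phase y.
Proof.
apply (continuous_minus (V := R_NormedModule) (fun y => IZR m * y) sin_sum);
  [|apply sin_sum_continuous].
apply (continuous_mult (fun _ => IZR m)); [apply continuous_const|apply continuous_id].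
Qed.

Lemma ci_is a : (forall y, continuous a y) ->
  is_RInt (fun y => weight y * cos (phase y) * a y) 0 PI (ci a).
Proof.
intros Ha; apply (RInt_correct (V := R_CompleteNormedModule)).
apply (ex_RInt_continuous (V := R_CompleteNormedModule)); intros y _.
apply (continuous_mult (fun y => weight y * cos (phase y)) a); [|easy].
apply (continuous_mult weight); [apply weight_continuous|].
apply (continuous_comp phase cos); [apply phase_continuous|apply continuous_cos].
Qed.

Lemma si_is a : (forall y, continuous a y) ->
  is_RInt (fun y => weight y * sin (phase y) * a y) 0 PI (si a).
Proof.
intros Ha; apply (RInt_correct (V := R_CompleteNormedModule)).
apply (ex_RInt_continuous (V := R_CompleteNormedModule)); intros y _.
apply (continuous_mult (fun y => weight y * sin (phase y)) a); [|easy].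
apply (continuous_mult weight); [apply weight_continuous|].
apply (continuous_comp phase sin); [apply phase_continuous|apply continuous_sin].
Qed.

Lemma fourier_coef_shift (l : Z) a b :
  (forall y, continuous a y) -> (forall y, continuous b y) ->
  (forall y, cos (IZR l * y) = a y) -> (forall y, sin (IZR l * y) = b y) ->
  fourier_coef (m + l) = ci a - si b.
Proof.
intros Ha Hb Ea Eb; unfold fourier_coef.
rewrite (RInt_ext _ (fun y => weight y * cos (phase y) * a y - weight y * sin (phase y) * b y)).
  apply is_RInt_unique.
  apply: is_RInt_minus; [now apply ci_is|now apply si_is].
intros y _; rewrite -Ea -Eb plus_IZR.
replace (sin_sum y - (IZR m + IZR l) * y) with (- (phase y + IZR l * y)) by (unfold phase; ring).
rewrite cos_neg cos_plus; match goal with |- ?u = ?v => change (@eq R u v) end; ring.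
Qed.

Lemma ci_lin a b p q : (forall y, continuous a y) -> (forall y, continuous b y) ->
  ci (fun y => p * a y + q * b y) = p * ci a + q * ci b.
Proof.
intros Ha Hb; unfold cos_int at 1.
rewrite (RInt_ext _ (fun y => p * (weight y * cos (phase y) * a y)
  + q * (weight y * cos (phase y) * b y))).
  apply is_RInt_unique.
  apply: is_RInt_plus; apply: is_RInt_scal; now apply ci_is.
intros y _; match goal with |- ?u = ?v => change (@eq R u v) end; ring.
Qed.

Lemma si_lin a b p q : (forall y, continuous a y) -> (forall y, continuous b y) ->
  si (fun y => p * a y + q * b y) = p * si a + q * si b.
Proof.
intros Ha Hb; unfold sin_int at 1.
rewrite (RInt_ext _ (fun y => p * (weight y * sin (phase y) * a y)
  + q * (weight y * sin (phase y) * b y))).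
  apply is_RInt_unique.
  apply: is_RInt_plus; apply: is_RInt_scal; now apply si_is.
intros y _; match goal with |- ?u = ?v => change (@eq R u v) end; ring.
Qed.

Lemma ci_ext a b : (forall y, a y = b y) -> ci a = ci b.
Proof. intros E; apply RInt_ext; intros y _; now rewrite E. Qed.

Lemma si_ext a b : (forall y, a y = b y) -> si a = si b.
Proof. intros E; apply RInt_ext; intros y _; now rewrite E. Qed.

(** With [A], [B], [C] the cosine integrals of 1, [cos], [cos^2] and [S], [T] the sine integrals of
    [sin] and [sin cos], the left side is [4 (A^2 - A C - B^2 + C^2 + S^2 - T^2)]. The grouping on
    the right gives each product total order [y^4] at 0, which makes the cancellation visible. *)
Lemma laguerre_fourier :
  3 * fourier_coef m ^ 2 - 4 * fourier_coef (m - 1) * fourier_coef (m + 1)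
    + fourier_coef (m - 2) * fourier_coef (m + 2)
  = 4 * (ci (fun _ : R => 1) * ci (fun y : R => (1 - cos y) ^ 2)
       + ci (fun y : R => (1 - cos y) * cos y) * ci (fun y : R => (1 - cos y) * (2 + cos y))
       + si (fun y : R => sin y * (1 - cos y)) * si (fun y : R => sin y * (1 + cos y))).
Proof.
assert (C0 : forall y, continuous (fun _ : R => 1) y) by (intros; apply continuous_const).
assert (C00 : forall y, continuous (fun _ : R => 0) y) by (intros; apply continuous_const).
assert (C1 : forall y, continuous cos y) by apply continuous_cos.
assert (S1 : forall y, continuous sin y) by apply continuous_sin.
assert (C2 : forall y, continuous (fun y : R => cos y * cos y) y)
  by (intros; now apply (continuous_mult cos cos)).
assert (S2 : forall y, continuous (fun y : R => sin y * cos y) y)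
  by (intros; now apply (continuous_mult sin cos)).
assert (L : forall a b : R -> R, forall p q,
  (forall y, continuous a y) -> (forall y, continuous b y) ->
  forall y, continuous (fun y : R => p * a y + q * b y) y).
  intros a b p q Ha Hb y.
  apply (continuous_plus (V := R_NormedModule) (fun y : R => p * a y) (fun y : R => q * b y)).
    apply (continuous_mult (fun _ : R => p)); [apply continuous_const|easy].
  apply (continuous_mult (fun _ : R => q)); [apply continuous_const|easy].
assert (E0 := fourier_coef_shift 0 (fun _ : R => 1) (fun y : R => 0 * sin y
  + 0 * sin y) C0 (L _ _ _ _ S1 S1)).
assert (E1 := fourier_coef_shift 1 cos sin C1 S1).
assert (E1' := fourier_coef_shift (-1) cos (fun y : R => (-1) * sin y
  + 0 * sin y) C1 (L _ _ _ _ S1 S1)).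
assert (E2 := fourier_coef_shift 2 (fun y : R => 2 * (cos y * cos y) + (-1) * 1)
  (fun y : R => 2 * (sin y * cos y) + 0 * sin y) (L _ _ _ _ C2 C0) (L _ _ _ _ S2 S1)).
assert (E2' := fourier_coef_shift (-2) (fun y : R => 2 * (cos y * cos y) + (-1) * 1)
  (fun y : R => (-2) * (sin y * cos y) + 0 * sin y) (L _ _ _ _ C2 C0) (L _ _ _ _ S2 S1)).
rewrite Z.add_0_r si_lin // in E0; rewrite si_lin // in E1'.
rewrite (ci_lin _ _ _ _ C2 C0) (si_lin _ _ _ _ S2 S1) in E2.
rewrite (ci_lin _ _ _ _ C2 C0) (si_lin _ _ _ _ S2 S1) in E2'.
change (m - 1)%Z with (m + (-1))%Z; change (m - 2)%Z with (m + (-2))%Z.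
rewrite E0; [|intros; rewrite Rmult_0_l cos_0 //|intros; rewrite Rmult_0_l sin_0; ring].
rewrite E1; [|intros; now rewrite Rmult_1_l|intros; now rewrite Rmult_1_l].
rewrite E1'; [|intros; replace (-1 * y) with (- y) by ring; apply cos_neg
  |intros; replace (-1 * y) with (- y) by ring; rewrite sin_neg; ring].
rewrite E2; [|intros; rewrite cos_2a_cos; ring|intros; rewrite sin_2a; ring].
rewrite E2'; [|intros; replace (-2 * y) with (- (2 * y)) by ring; rewrite cos_neg cos_2a_cos; ring
  |intros; replace (-2 * y) with (- (2 * y)) by ring; rewrite sin_neg sin_2a; ring].
rewrite (ci_ext (fun y : R => (1 - cos y) ^ 2)
  (fun y : R => 1 * (1 * 1 + (-2) * cos y) + 1 * (cos y * cos y))); [|intros; ring].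
rewrite (ci_ext (fun y : R => (1 - cos y) * cos y)
  (fun y : R => 1 * cos y + (-1) * (cos y * cos y))); [|intros; ring].
rewrite (ci_ext (fun y : R => (1 - cos y) * (2 + cos y))
  (fun y : R => 1 * (2 * 1 + (-1) * cos y) + (-1) * (cos y * cos y))); [|intros; ring].
rewrite (si_ext (fun y : R => sin y * (1 - cos y))
  (fun y : R => 1 * sin y + (-1) * (sin y * cos y))); [|intros; ring].
rewrite (si_ext (fun y : R => sin y * (1 + cos y))
  (fun y : R => 1 * sin y + 1 * (sin y * cos y))); [|intros; ring].
rewrite (ci_lin _ _ _ _ (L _ _ _ _ C0 C1) C2) (ci_lin _ _ _ _ C0 C1).
rewrite (ci_lin _ _ _ _ (L _ _ _ _ C0 C1) C2) (ci_lin _ _ _ _ C0 C1).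
rewrite !(ci_lin _ _ _ _ C1 C2) !(si_lin _ _ _ _ S1 S2).
ring.
Qed.

End Laguerre.

End Fourier.

(** * Moments of the coefficient sequence *)

Lemma sum_pow1_le (q : R) K : 0 < q < 1 ->
  sum_f_R0 (fun d => INR d ^ 1 * q ^ d) K <= q / (1 - q) ^ 2.
Proof.
intros [q0 q1].
assert (E : sum_f_R0 (fun d => INR d ^ 1 * q ^ d) K
  = q / (1 - q) ^ 2 - q ^ S K * (INR K / (1 - q) + 1 / (1 - q) ^ 2)).
  induction K as [|K IH]; [simpl; field; lra|].
  rewrite tech5 IH S_INR; simpl; field; lra.
rewrite E; assert (0 < q ^ S K) by (apply pow_lt; lra).
assert (0 <= INR K) by apply pos_INR.
assert (0 < / (1 - q)) by (apply Rinv_0_lt_compat; lra).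
unfold Rdiv; rewrite -!pow_inv.
assert (0 <= q ^ S K * (INR K * / (1 - q) + 1 * (/ (1 - q)) ^ 2)); [|lra].
apply Rmult_le_pos; [lra|]; nra.
Qed.

Lemma sum_pow2_le (q : R) K : 0 < q < 1 ->
  sum_f_R0 (fun d => INR d ^ 2 * q ^ d) K <= q * (1 + q) / (1 - q) ^ 3.
Proof.
intros [q0 q1].
assert (E : sum_f_R0 (fun d => INR d ^ 2 * q ^ d) K
  = q * (1 + q) / (1 - q) ^ 3 - q ^ S K * (INR K ^ 2 / (1 - q)
     + 2 * INR K / (1 - q) ^ 2 + (1 + q) / (1 - q) ^ 3)).
  induction K as [|K IH]; [simpl; field; lra|].
  rewrite tech5 IH S_INR; simpl; field; lra.
rewrite E; assert (0 < q ^ S K) by (apply pow_lt; lra).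
assert (0 <= INR K) by apply pos_INR.
assert (Hi : 0 < / (1 - q)) by (apply Rinv_0_lt_compat; lra).
unfold Rdiv; rewrite -!pow_inv.
assert (H2 := pow_lt _ 2 Hi); assert (H3 := pow_lt _ 3 Hi).
assert (0 <= q ^ S K * (INR K ^ 2 * / (1 - q) + 2 * INR K * (/ (1 - q)) ^ 2
  + (1 + q) * (/ (1 - q)) ^ 3)); [|lra].
apply Rmult_le_pos; [lra|].
repeat apply Rplus_le_le_0_compat; repeat apply Rmult_le_pos; try apply pow_le; lra.
Qed.

Lemma sum_pow3_le (q : R) K : 0 < q < 1 ->
  sum_f_R0 (fun d => INR d ^ 3 * q ^ d) K <= q * (1 + 4 * q + q ^ 2) / (1 - q) ^ 4.
Proof.
intros [q0 q1].
assert (E : sum_f_R0 (fun d => INR d ^ 3 * q ^ d) K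
  = q * (1 + 4 * q + q ^ 2) / (1 - q) ^ 4 - q ^ S K * (INR K ^ 3 / (1 - q)
     + 3 * INR K ^ 2 / (1 - q) ^ 2 + 3 * INR K * (1 + q) / (1 - q) ^ 3
     + (1 + 4 * q + q ^ 2) / (1 - q) ^ 4)).
  induction K as [|K IH]; [simpl; field; lra|].
  rewrite tech5 IH S_INR; simpl; field; lra.
rewrite E; assert (0 < q ^ S K) by (apply pow_lt; lra).
assert (0 <= INR K) by apply pos_INR.
assert (Hi : 0 < / (1 - q)) by (apply Rinv_0_lt_compat; lra).
unfold Rdiv; rewrite -!pow_inv.
assert (H2 := pow_lt _ 2 Hi); assert (H3 := pow_lt _ 3 Hi); assert (H4 := pow_lt _ 4 Hi).
assert (0 <= q ^ S K * (INR K ^ 3 * / (1 - q) + 3 * INR K ^ 2 * (/ (1 - q)) ^ 2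
  + 3 * INR K * (1 + q) * (/ (1 - q)) ^ 3
  + (1 + 4 * q + q ^ 2) * (/ (1 - q)) ^ 4)); [|lra].
apply Rmult_le_pos; [lra|].
repeat apply Rplus_le_le_0_compat; repeat apply Rmult_le_pos; try apply pow_le; try lra; nra.
Qed.

Lemma nonneg_of_derive (f f' : R -> R) (b : R) :
  (forall t, is_derive f t (f' t)) -> 0 <= f 0 ->
  (forall t, 0 <= t <= b -> 0 <= f' t) -> forall t, 0 <= t <= b -> 0 <= f t.
Proof.
intros D f0 Hf' t Ht.
destruct (MVT_gen f 0 t f') as [c [Hc E]].
- intros; apply D.
- intros z _; apply continuity_pt_filterlim;
  eapply (ex_derive_continuous (V := R_NormedModule) f).
  now exists (f' z).
- rewrite Rmin_left in Hc; [|lra]; rewrite Rmax_right in Hc; [|lra].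
  assert (0 <= f' c) by (apply Hf'; lra). nra.
Qed.

Lemma exp_le x y : x <= y -> exp x <= exp y.
Proof. intros [H|E]; [now apply Rlt_le, exp_increasing|rewrite E; apply Rle_refl]. Qed.

Ltac by_derivative f' := match goal with |- forall t, 0 <= t <= ?b -> 0 <= @?f t =>
  apply (nonneg_of_derive f f' b);
    [intros; auto_derive; [easy|try (simpl; field)] | | ] end.

(** This is [2 cosh t - 2], equal to [(1 - q)^2 / q] for [q = exp (- t)]. Writing [A] for it, the
    generating functions of [d], [d^2], [d^3] are [1 / A], the square root of [(A + 4) / A^3], and
    [(A + 6) / A^2], so one Taylor bound serves all three. *)
Definition coshm (t : R) := exp t + exp (- t) - 2.

Lemma coshm_ge t : 0 <= t -> t ^ 2 + t ^ 4 / 12 + t ^ 6 / 360 <= coshm t.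
Proof.
intros t0; enough (H : forall t', 0 <= t' <= t ->
  0 <= exp t' + exp (- t') - 2 - (t' ^ 2 + t' ^ 4 / 12 + t' ^ 6 / 360))
  by (specialize (H t); unfold coshm; lra).
by_derivative (fun t => exp t - exp (- t) - (2 * t + t ^ 3 / 3 + t ^ 5 / 60)).
  rewrite Ropp_0 exp_0; simpl; lra.
by_derivative (fun t => exp t + exp (- t) - (2 + t ^ 2 + t ^ 4 / 12)).
  rewrite Ropp_0 exp_0; simpl; lra.
by_derivative (fun t => exp t - exp (- t) - (2 * t + t ^ 3 / 3)).
  rewrite Ropp_0 exp_0; simpl; lra.
by_derivative (fun t => exp t + exp (- t) - (2 + t ^ 2)).
  rewrite Ropp_0 exp_0; simpl; lra.
by_derivative (fun t => exp t - exp (- t) - 2 * t).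
  rewrite Ropp_0 exp_0; simpl; lra.
by_derivative (fun t => exp t + exp (- t) - 2).
  rewrite Ropp_0 exp_0; simpl; lra.
intros u Hu; rewrite exp_Ropp.
assert (P := exp_pos u).
replace (exp u + / exp u - 2) with ((exp u - 1) ^ 2 / exp u) by (field; lra).
apply Rmult_le_pos; [apply pow2_ge_0|now apply Rlt_le, Rinv_0_lt_compat].
Qed.

Lemma coshm_le t : 0 <= t <= 1 / 2 -> coshm t <= t ^ 2 + t ^ 4 / 6.
Proof.
intros Ht; enough (H : forall t', 0 <= t' <= 1 / 2 ->
  0 <= t' ^ 2 + t' ^ 4 / 6 - (exp t' + exp (- t') - 2))
  by (specialize (H t Ht); unfold coshm; lra).
by_derivative (fun t => 2 * t + 2 / 3 * t ^ 3 - (exp t - exp (- t))).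
  rewrite Ropp_0 exp_0; simpl; lra.
by_derivative (fun t => 2 + 2 * t ^ 2 - (exp t + exp (- t))).
  rewrite Ropp_0 exp_0; simpl; lra.
by_derivative (fun t => 4 * t - (exp t - exp (- t))).
  rewrite Ropp_0 exp_0; simpl; lra.
by_derivative (fun t => 4 - (exp t + exp (- t))).
  rewrite Ropp_0 exp_0; simpl; lra.
intros u Hu.
assert (exp (- u) <= 1) by (rewrite -exp_0; apply exp_le; lra).
assert (exp u <= exp 1) by (apply exp_le; lra).
assert (E := exp_le_3); lra.
Qed.

Lemma coth_ge x : 0 < x -> 2 / x <= (1 + exp (- x)) / (1 - exp (- x)).
Proof.
intros x0.
assert (H : forall t, 0 <= t <= x -> 0 <= t * (1 + exp (- t)) - 2 * (1 - exp (- t))).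
  by_derivative (fun t => 1 - (1 + t) * exp (- t)).
    rewrite Ropp_0 exp_0; simpl; lra.
  intros t Ht; assert (P := exp_pos (- t)).
  assert (I := exp_ineq1_le t).
  assert (E : exp t * exp (- t) = 1) by (rewrite -exp_plus Rplus_opp_r; apply exp_0).
  nra.
specialize (H x).
assert (exp (- x) < 1) by (rewrite -exp_0; apply exp_increasing; lra).
apply Rmult_le_reg_r with (x * (1 - exp (- x))); [nra|].
field_simplify; [nra|lra|lra].
Qed.

(** The full series is [PI^2 / 8 = 1.2337...]; the constant is [1 + 1/9 + 1/25 + 1/12 = 1.23444...]
    rounded up, with 1/12 for the tail. *)
Lemma sum_odd_inv_sq K :
  sum_f_R0 (fun j => if Nat.odd j then / INR j ^ 2 else 0) K <= 2469 / 2000.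
Proof.
set (f := fun j => if Nat.odd j then / INR j ^ 2 else 0).
(* Telescoping with [1/j^2 <= (1/(j-1) - 1/(j+1))/2] from [j = 7] on. *)
assert (H : forall i, sum_f_R0 f (2 * i + 6) <= (2469 / 2000) - / (4 * INR i + 12)).
  induction i as [|i IH].
    unfold f; simpl; lra.
  replace (2 * S i + 6)%nat with (S (S (2 * i + 6))) by lia.
  rewrite !tech5.
  unfold f at 2 3.
  replace (Nat.odd (S (2 * i + 6))) with true; last first.
    symmetry; apply Nat.odd_spec; exists (i + 3)%nat; lia.
  replace (Nat.odd (S (S (2 * i + 6)))) with false; last first.
    symmetry; rewrite -Nat.negb_even; apply Bool.negb_false_iff, Nat.even_spec.
    exists (i + 4)%nat; lia.
  replace (INR (S (2 * i + 6))) with (2 * INR i + 6 + 1)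
    by (rewrite S_INR plus_INR mult_INR; simpl; ring).
  rewrite (S_INR i).
  assert (P := pos_INR i).
  assert (/ (2 * INR i + 6 + 1) ^ 2 <= / (4 * INR i + 12) - / (4 * (INR i + 1) + 12)).
    replace (/ (4 * INR i + 12) - / (4 * (INR i + 1) + 12))
      with (/ (4 * ((INR i + 3) * (INR i + 4)))) by (field; lra).
    apply Rinv_le_contravar; nra.
  lra.
destruct (le_lt_dec 6 K) as [HK|HK].
  assert (exists i, (K <= 2 * i + 6)%nat) as [i Hi] by (exists K; lia).
  apply Rle_trans with (sum_f_R0 f (2 * i + 6)).
    clear -Hi; induction Hi as [|N Hi IH]; [lra|].
    rewrite tech5; unfold f at 3; destruct (Nat.odd (S N)); [|lra].
    assert (0 < / INR (S N) ^ 2) by (apply Rinv_0_lt_compat, pow_lt, lt_0_INR; lia).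
    lra.
  assert (0 < / (4 * INR i + 12)) by (apply Rinv_0_lt_compat; assert (P := pos_INR i); lra).
  specialize (H i); lra.
apply Rle_trans with (sum_f_R0 f 5); [|unfold f; simpl; lra].
do 6 (destruct K as [|K]; [unfold f; simpl; lra|]); lia.
Qed.

(** * Power sums compared with powers of [1 / t] *)

Section Kernel.
Variable t : R.
Hypothesis t0 : 0 < t.
Let q := exp (- t).

Lemma exp_opp_in01 : 0 < exp (- t) < 1.
Proof. split; [apply exp_pos|]. rewrite -exp_0; apply exp_increasing; lra. Qed.

Lemma coshm_exp : coshm t = (1 - q) ^ 2 / q.
Proof.
assert (P := exp_pos (- t)); unfold coshm, q.
replace (exp t) with (/ exp (- t)) by (rewrite exp_Ropp Rinv_inv //).
field; lra.
Qed.

Lemma kernel1_le : q / (1 - q) ^ 2 <= / t ^ 2.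
Proof.
assert (Q := exp_opp_in01); fold q in Q.
replace (q / (1 - q) ^ 2) with (/ coshm t) by (rewrite coshm_exp; field; lra).
apply Rinv_le_contravar; [now apply pow_lt|].
assert (H := coshm_ge t (Rlt_le _ _ t0)).
assert (0 < t ^ 4) by now apply pow_lt.
assert (0 < t ^ 6) by now apply pow_lt.
lra.
Qed.

(** Only the square of this kernel is rational in [A = coshm t]. The inequality
    [(A + 4) p^3 <= 4 A^3] with [p = t^2] is an equality in the orders [p^3] and [p^4], so the
    leading term of [A] would not be enough. *)
Lemma kernel2_le : q * (1 + q) / (1 - q) ^ 3 <= 2 / t ^ 3.
Proof.
assert (Q := exp_opp_in01); fold q in Q.
assert (t3 : 0 < t ^ 3) by now apply pow_lt.
assert (c0 : 0 < (1 - q) ^ 3) by (apply pow_lt; lra).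
apply Rsqr_incr_0_var; [|apply Rlt_le, Rdiv_lt_0_compat; lra].
set (A := coshm t).
assert (HA : t ^ 2 + t ^ 4 / 12 + t ^ 6 / 360 <= A) by (apply coshm_ge; lra).
replace (Rsqr (q * (1 + q) / (1 - q) ^ 3)) with ((A + 4) / A ^ 3); last first.
  unfold A; rewrite coshm_exp; unfold Rsqr; field; lra.
set (p := t ^ 2); assert (p0 : 0 < p) by now apply pow_lt.
replace (Rsqr (2 / t ^ 3)) with (4 / p ^ 3) by (unfold Rsqr, p; field; lra).
replace (t ^ 4) with (p ^ 2) in HA by (unfold p; ring).
replace (t ^ 6) with (p ^ 3) in HA by (unfold p; ring).
fold p in HA.
set (d := A - (p + p ^ 2 / 12 + p ^ 3 / 360)).
assert (d0 : 0 <= d) by (unfold d; lra).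
assert (p2 : 0 < p ^ 2) by now apply pow_lt.
assert (p3 : 0 < p ^ 3) by now apply pow_lt.
assert (A0 : 0 < A) by lra.
assert (A3 : 0 < A ^ 3) by now apply pow_lt.
apply Rmult_le_reg_r with (A ^ 3 * p ^ 3); [now apply Rmult_lt_0_compat|].
replace ((A + 4) / A ^ 3 * (A ^ 3 * p ^ 3)) with ((A + 4) * p ^ 3) by (field; lra).
replace (4 / p ^ 3 * (A ^ 3 * p ^ 3)) with (4 * A ^ 3) by (field; lra).
replace A with (d + p + p ^ 2 / 12 + p ^ 3 / 360) by (unfold d; ring).
assert (E : forall i j, 0 <= p ^ i * d ^ j)
  by (intros; apply Rmult_le_pos; apply pow_le; lra).
assert (E50 := E 5%nat 0%nat); assert (E60 := E 6%nat 0%nat); assert (E70 := E 7%nat 0%nat).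
assert (E80 := E 8%nat 0%nat); assert (E90 := E 9%nat 0%nat).
assert (E21 := E 2%nat 1%nat); assert (E31 := E 3%nat 1%nat); assert (E41 := E 4%nat 1%nat).
assert (E51 := E 5%nat 1%nat); assert (E61 := E 6%nat 1%nat).
assert (E12 := E 1%nat 2%nat); assert (E22 := E 2%nat 2%nat); assert (E32 := E 3%nat 2%nat).
assert (E03 := E 0%nat 3%nat).
nra.
Qed.

(** As [t] tends to 0 the kernel is [6 / t^4 + 1/120 + ...], so the limiting constant 6 would be
    false; 63/10 absorbs the excess. *)
Lemma kernel3_le : q * (1 + 4 * q + q ^ 2) / (1 - q) ^ 4 <= (63 / 10) / t ^ 4.
Proof.
assert (Q := exp_opp_in01); fold q in Q.
set (A := coshm t).
assert (HA : t ^ 2 + t ^ 4 / 12 + t ^ 6 / 360 <= A) by (apply coshm_ge; lra).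
replace (q * (1 + 4 * q + q ^ 2) / (1 - q) ^ 4) with ((A + 6) / A ^ 2); last first.
  unfold A; rewrite coshm_exp; field; lra.
set (p := t ^ 2); assert (p0 : 0 < p) by now apply pow_lt.
replace (t ^ 4) with (p ^ 2) in * by (unfold p; ring).
replace (t ^ 6) with (p ^ 3) in HA by (unfold p; ring).
fold p in HA.
set (d := A - (p + p ^ 2 / 12 + p ^ 3 / 360)).
assert (d0 : 0 <= d) by (unfold d; lra).
assert (p2 : 0 < p ^ 2) by now apply pow_lt.
assert (p3 : 0 < p ^ 3) by now apply pow_lt.
assert (A0 : 0 < A) by lra.
apply Rmult_le_reg_r with (A ^ 2 * p ^ 2); [apply Rmult_lt_0_compat; [now apply pow_lt|easy]|].
replace ((A + 6) / A ^ 2 * (A ^ 2 * p ^ 2)) with ((A + 6) * p ^ 2) by (field; lra).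
replace ((63 / 10) / p ^ 2 * (A ^ 2 * p ^ 2)) with (63 / 10 * A ^ 2) by (field; lra).
replace A with (d + p + p ^ 2 / 12 + p ^ 3 / 360) by (unfold d; ring).
(* The part of [63/10 A^2 - (A + 6) p^2] free of [d], divided by [p^2]. Only its [p^2] coefficient
   is negative, and a multiple of [(p^2 - 75)^2] compensates for it. *)
assert (H : 0 <= (3 / 10) + (1 / 20) * p - 11 / 2400 * p ^ 2 + 1 / 7200 * p ^ 3
  + (63 / 10) / 129600 * p ^ 4).
  assert (0 <= (p ^ 2 - 75) ^ 2) by apply pow2_ge_0. nra.
assert (H2 := Rmult_le_pos _ _ (Rlt_le _ _ p2) H).
assert (E : forall i j, 0 <= p ^ i * d ^ j)
  by (intros; apply Rmult_le_pos; apply pow_le; lra).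
assert (E11 := E 1%nat 1%nat); assert (E21 := E 2%nat 1%nat); assert (E31 := E 3%nat 1%nat).
assert (E02 := E 0%nat 2%nat).
nra.
Qed.

End Kernel.

Lemma sum_odd_kernel_le (G : nat -> R) (c : R) K :
  0 <= c ->
  (forall j, (1 <= j)%nat -> G j <= c * / INR j ^ 2) ->
  sum_f_R0 (fun j => if Nat.odd j then G j else 0) K <= c * (2469 / 2000).
Proof.
intros c0 H.
apply Rle_trans with (c * sum_f_R0 (fun j => if Nat.odd j then / INR j ^ 2 else 0) K);
  [|apply Rmult_le_compat_l, sum_odd_inv_sq; easy].
rewrite scal_sum; apply sum_Rle; intros j _.
destruct (Nat.odd j) eqn:O; [|lra].
rewrite Rmult_comm; apply H.
destruct j; [easy|lia].
Qed.

Section Moments.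
Variables (K : nat) (e : nat -> R) (x : R).
Hypothesis x0 : 0 < x.
Let r := exp (- x).
(** Since [k beta k = e k r^k], order 0 gives the saddle point equation, order 1 the quadratic decay
    of the weight, and order 2 the cubic growth of the phase. *)
Definition moment (p : nat) := sum_f_R0 (fun k => INR k ^ p * e k * r ^ k) K.
Hypothesis moment_le : forall p : nat, moment p
  <= 2 * sum_f_R0 (fun j => if Nat.odd j then
       INR j ^ p * sum_f_R0 (fun d => INR d ^ S p * (r ^ j) ^ d) K else 0) K.

Lemma pow_exp j : r ^ j = exp (- (INR j * x)).
Proof.
unfold r; induction j as [|j IH]; [simpl; rewrite Rmult_0_l Ropp_0 exp_0 //|].
rewrite S_INR -tech_pow_Rmult IH -exp_plus; f_equal; ring.
Qed.

(** For each [p] the inner sum is at most a constant over [(j x)^(p + 2)], and the factor [j^p]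
    leaves [1 / j^2]. Hence the same sum over odd [j] appears in all three moments. *)
Lemma moment0_le : moment 0 <= (247 / 100) / x ^ 2.
Proof.
eapply Rle_trans; [apply moment_le|].
assert (H : 0 < / x ^ 2) by (apply Rinv_0_lt_compat, pow_lt; lra).
apply Rle_trans with (2 * (/ x ^ 2 * (2469 / 2000))); [|unfold Rdiv; lra].
apply Rmult_le_compat_l; [lra|].
apply sum_odd_kernel_le; [lra|]; intros j Hj.
assert (j0 : 0 < INR j) by (apply lt_0_INR; lia).
assert (t0 : 0 < INR j * x) by now apply Rmult_lt_0_compat.
assert (Q := exp_opp_in01 _ t0).
rewrite pow_O Rmult_1_l pow_exp; eapply Rle_trans; [now apply sum_pow1_le|].
eapply Rle_trans; [now apply kernel1_le|].
right; field; lra.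
Qed.

Lemma moment1_le : moment 1 <= (247 / 50) / x ^ 3.
Proof.
eapply Rle_trans; [apply moment_le|].
assert (H : 0 < / x ^ 3) by (apply Rinv_0_lt_compat, pow_lt; lra).
apply Rle_trans with (2 * (2 * / x ^ 3 * (2469 / 2000))); [|unfold Rdiv; lra].
apply Rmult_le_compat_l; [lra|].
apply sum_odd_kernel_le; [lra|]; intros j Hj.
assert (j0 : 0 < INR j) by (apply lt_0_INR; lia).
assert (t0 : 0 < INR j * x) by now apply Rmult_lt_0_compat.
assert (Q := exp_opp_in01 _ t0).
rewrite pow_1 pow_exp.
apply Rle_trans with (INR j * (2 / (INR j * x) ^ 3)); [|right; field; lra].
apply Rmult_le_compat_l; [lra|].
eapply Rle_trans; [now apply sum_pow2_le|now apply kernel2_le].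
Qed.

Lemma moment2_le : moment 2 <= (78 / 5) / x ^ 4.
Proof.
eapply Rle_trans; [apply moment_le|].
assert (H : 0 < / x ^ 4) by (apply Rinv_0_lt_compat, pow_lt; lra).
apply Rle_trans with (2 * (63 / 10 * / x ^ 4 * (2469 / 2000))); [|unfold Rdiv; lra].
apply Rmult_le_compat_l; [lra|].
apply sum_odd_kernel_le; [lra|]; intros j Hj.
assert (j0 : 0 < INR j) by (apply lt_0_INR; lia).
assert (t0 : 0 < INR j * x) by now apply Rmult_lt_0_compat.
assert (Q := exp_opp_in01 _ t0).
rewrite pow_exp.
apply Rle_trans with (INR j ^ 2 * ((63 / 10) / (INR j * x) ^ 4)); [|right; field; lra].
apply Rmult_le_compat_l; [apply pow2_ge_0|].
eapply Rle_trans; [now apply sum_pow3_le|now apply kernel3_le].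
Qed.

End Moments.

(** * Elementary integral and exponential estimates *)

Lemma continuous_of_ex_derive (f : R -> R) : (forall y, ex_derive f y) -> forall y, continuous
  f y.
Proof. intros H y; now apply (ex_derive_continuous (V := R_NormedModule)). Qed.

Ltac cont := apply continuous_of_ex_derive; intros; auto_derive; easy.

Lemma RInt_le_cont f g a b : a <= b ->
  (forall y, continuous f y) -> (forall y, continuous g y) ->
  (forall y, a <= y <= b -> f y <= g y) -> RInt f a b <= RInt g a b.
Proof.
intros ab Cf Cg H; apply RInt_le; [easy| | |intros; apply H; lra];
  now apply (ex_RInt_continuous (V := R_CompleteNormedModule)).
Qed.

Lemma RInt_prim (F F' : R -> R) a b :
  (forall y, is_derive F y (F' y)) -> (forall y, continuous F' y) ->
  RInt F' a b = F b - F a.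
Proof.
intros D C; apply is_RInt_unique.
apply: is_RInt_derive; intros; [apply D|apply C].
Qed.

Lemma RInt_le_prim f (F F' : R -> R) a b : a <= b ->
  (forall y, continuous f y) ->
  (forall y, is_derive F y (F' y)) -> (forall y, continuous F' y) ->
  (forall y, a <= y <= b -> f y <= F' y) -> RInt f a b <= F b - F a.
Proof.
intros ab Cf D C H; rewrite -(RInt_prim F F'); [|easy|easy].
now apply RInt_le_cont.
Qed.

Lemma RInt_ge_prim f (F F' : R -> R) a b : a <= b ->
  (forall y, continuous f y) ->
  (forall y, is_derive F y (F' y)) -> (forall y, continuous F' y) ->
  (forall y, a <= y <= b -> F' y <= f y) -> F b - F a <= RInt f a b.
Proof.
intros ab Cf D C H; rewrite -(RInt_prim F F'); [|easy|easy].
now apply RInt_le_cont.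
Qed.

Lemma RInt_le_const f c a b : a <= b ->
  (forall y, continuous f y) ->
  (forall y, a <= y <= b -> f y <= c) -> RInt f a b <= c * (b - a).
Proof.
intros ab Cf H; replace (c * (b - a)) with (c * b - c * a) by ring.
apply (RInt_le_prim f (fun y => c * y) (fun _ => c)); try easy.
  intros; auto_derive; [easy|ring].
intros; apply continuous_const.
Qed.

Lemma RInt_split (f : R -> R) a b c : (forall y, continuous f y) ->
  RInt f a c = RInt f a b + RInt f b c.
Proof.
intros C; symmetry; apply: RInt_Chasles;
  now apply (ex_RInt_continuous (V := R_CompleteNormedModule)).
Qed.

Lemma RInt_scal_R (f : R -> R) k a b : (forall y, continuous f y) ->
  RInt (fun y => k * f y) a b = k * RInt f a b.
Proof.
intros C; apply: RInt_scal;
  now apply (ex_RInt_continuous (V := R_CompleteNormedModule)).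
Qed.

Lemma one_sub_cos_le u : 1 - cos u <= u ^ 2 / 2.
Proof.
assert (H : forall u, 0 <= u -> 1 - cos u <= u ^ 2 / 2).
  clear u; intros u Hu.
  enough (H : forall t, 0 <= t <= u -> 0 <= t ^ 2 / 2 - (1 - cos t)) by (specialize (H u); lra).
  by_derivative (fun t => t - sin t); [rewrite cos_0; lra|].
  by_derivative (fun t => 1 - cos t); [rewrite sin_0; lra|].
  intros t _; assert (C := COS_bound t); lra.
destruct (Rle_dec 0 u) as [P|P]; [now apply H|].
rewrite -cos_neg -Rsqr_pow2 Rsqr_neg Rsqr_pow2; apply H; lra.
Qed.

Lemma one_sub_cos_ge u : 0 <= u -> u ^ 2 / 2 - u ^ 4 / 24 <= 1 - cos u.
Proof.
intros Hu.
enough (H : forall t, 0 <= t <= u -> 0 <= 1 - cos t - (t ^ 2 / 2 - t ^ 4 / 24))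
  by (specialize (H u); lra).
by_derivative (fun t => sin t - (t - t ^ 3 / 6)); [rewrite cos_0; lra|].
by_derivative (fun t => cos t - (1 - t ^ 2 / 2)); [rewrite sin_0; lra|].
intros t _; assert (H := one_sub_cos_le t); lra.
Qed.

Lemma sub_sin_bounds u : 0 <= u -> 0 <= u - sin u <= u ^ 3 / 6.
Proof.
intros Hu; split.
  enough (H : forall t, 0 <= t <= u -> 0 <= t - sin t) by (apply H; lra).
  by_derivative (fun t => 1 - cos t); [rewrite sin_0; lra|].
  intros t _; assert (C := COS_bound t); lra.
enough (H : forall t, 0 <= t <= u -> 0 <= t ^ 3 / 6 - (t - sin t)) by (specialize (H u); lra).
by_derivative (fun t => t ^ 2 / 2 - (1 - cos t)); [rewrite sin_0; lra|].
intros t _; assert (H := one_sub_cos_le t); lra.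
Qed.

(* [cot (y/2) <= 2/y] *)
Lemma mul_sin_le y : 0 <= y <= PI -> y * sin y <= 2 * (1 - cos y).
Proof.
intros Hy.
enough (H : forall t, 0 <= t <= PI -> 0 <= 2 * (1 - cos t) - t * sin t)
  by (specialize (H y Hy); lra).
by_derivative (fun t => sin t - t * cos t); [rewrite cos_0; lra|].
by_derivative (fun t => t * sin t); [rewrite sin_0; lra|].
intros t Ht; apply Rmult_le_pos; [lra|apply sin_ge_0; lra].
Qed.

Lemma exp_taylor4 t : 0 <= t -> 1 + t + t ^ 2 / 2 + t ^ 3 / 6 + t ^ 4 / 24 <= exp t.
Proof.
intros Ht.
enough (H : forall u, 0 <= u <= t -> 0 <= exp u - (1 + u + u ^ 2 / 2 + u ^ 3 / 6 + u ^ 4 / 24))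
  by (specialize (H t); lra).
by_derivative (fun u => exp u - (1 + u + u ^ 2 / 2 + u ^ 3 / 6)); [rewrite exp_0; simpl; lra|].
by_derivative (fun u => exp u - (1 + u + u ^ 2 / 2)); [rewrite exp_0; simpl; lra|].
by_derivative (fun u => exp u - (1 + u)); [rewrite exp_0; simpl; lra|].
intros u _; assert (H := exp_ineq1_le u); lra.
Qed.

Lemma exp_pow t n : exp (INR n * t) = exp t ^ n.
Proof.
induction n as [|n IH]; [simpl; rewrite Rmult_0_l exp_0 //|].
rewrite S_INR -tech_pow_Rmult -IH -exp_plus; f_equal; ring.
Qed.

(** Cutting the exponent into [n] equal pieces keeps the quartic Taylor polynomial accurate, so
    numerical bounds on [exp] reduce to rational arithmetic. *)
Lemma exp_neg_le (t b : R) (n : nat) : 0 <= t ->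
  1 <= b * (1 + t + t ^ 2 / 2 + t ^ 3 / 6 + t ^ 4 / 24) ^ n -> exp (- (INR n * t)) <= b.
Proof.
intros t0 H; assert (E := exp_taylor4 t t0).
set (z := 1 + t + t ^ 2 / 2 + t ^ 3 / 6 + t ^ 4 / 24) in *.
assert (z0 : 0 < z ^ n).
  apply pow_lt; unfold z; assert (0 <= t ^ 2) by (apply pow_le; lra).
  assert (0 <= t ^ 3) by (apply pow_le; lra); assert (0 <= t ^ 4) by (apply pow_le; lra); lra.
assert (E' : z ^ n <= exp (INR n * t)).
  rewrite exp_pow; apply pow_incr; split; [|easy].
  unfold z; assert (0 <= t ^ 2) by (apply pow_le; lra).
  assert (0 <= t ^ 3) by (apply pow_le; lra); assert (0 <= t ^ 4) by (apply pow_le; lra); lra.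
rewrite exp_Ropp; apply Rle_trans with (/ z ^ n); [now apply Rinv_le_contravar|].
apply Rmult_le_reg_r with (z ^ n); [easy|]; rewrite Rinv_l; lra.
Qed.

Lemma mul_exp_neg_le z0 z b : 1 <= z0 <= z -> exp (- z0) * z0 <= b -> z * exp (- z) <= b.
Proof.
intros Hz H; eapply Rle_trans; [|exact H].
assert (I := exp_ineq1_le (z - z0)).
replace (- z) with (- z0 + - (z - z0)) by ring.
rewrite exp_plus (exp_Ropp (z - z0)).
assert (P := exp_pos (- z0)); assert (P' := exp_pos (z - z0)).
apply Rmult_le_reg_r with (exp (z - z0)); [easy|].
replace (z * (exp (- z0) * / exp (z - z0)) * exp (z - z0)) with (exp (- z0) * z) by (field; lra).
rewrite Rmult_assoc; apply Rmult_le_compat_l; [lra|]; nra.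
Qed.

(** Turns an exponential in [u = / h ^ 2] into a power of [h]: [z exp (- z)] decreases beyond 1, and
    it is applied to [z = c u / n], then raised to the power [n]. *)
Lemma exp_neg_le_pow (c u : R) (n : nat) z0 b : 0 < u -> (0 < n)%nat -> 1 <= z0 ->
  INR n * z0 <= c * u -> exp (- z0) * z0 <= b -> exp (- (c * u)) * (c * u / INR n) ^ n <= b ^ n.
Proof.
intros u0 n0 z1 Hu Hb.
assert (N0 : 0 < INR n) by now apply lt_0_INR.
set (z := c * u / INR n).
assert (Hz : z0 <= z).
  unfold z; apply Rmult_le_reg_r with (INR n); [easy|].
  replace (c * u / INR n * INR n) with (c * u) by (field; lra); lra.
replace (- (c * u)) with (INR n * - z) by (unfold z; field; lra).
rewrite exp_pow -Rpow_mult_distr.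
apply pow_incr; split; [|rewrite (Rmult_comm (exp (- z))); apply (mul_exp_neg_le z0); [lra|easy]].
apply Rmult_le_pos; [apply Rlt_le, exp_pos|lra].
Qed.

(** * Positivity of the quadratic form *)

(* The Taylor polynomial of degree 6 bounds [cos] from below and is positive on
   [3/2, 38/25], so [cos (PI/2) = 0] excludes [PI/2] from that interval. *)
Lemma PI2_ge : 38 / 25 <= PI / 2.
Proof.
destruct (Rle_lt_dec (38 / 25) (PI / 2)) as [L|L]; [easy|exfalso].
assert (Q := PI2_3_2).
assert (H : forall t, 0 <= t <= PI / 2 ->
  0 <= cos t - (1 - t ^ 2 / 2 + t ^ 4 / 24 - t ^ 6 / 720)).
  by_derivative (fun t => t - t ^ 3 / 6 + t ^ 5 / 120 - sin t); [rewrite cos_0; lra|].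
  by_derivative (fun t => 1 - t ^ 2 / 2 + t ^ 4 / 24 - cos t); [rewrite sin_0; lra|].
  by_derivative (fun t => sin t - (t - t ^ 3 / 6)); [rewrite cos_0; lra|].
  by_derivative (fun t => cos t - (1 - t ^ 2 / 2)); [rewrite sin_0; lra|].
  intros t _; assert (H := one_sub_cos_le t); lra.
specialize (H (PI / 2)); rewrite cos_PI2 in H.
set (t := PI / 2) in *.
assert (P : 0 <= 0 - (1 - t ^ 2 / 2 + t ^ 4 / 24 - t ^ 6 / 720)) by (apply H; lra).
assert (B : 9 / 4 <= t ^ 2 <= 1444 / 625) by nra.
replace (t ^ 4) with (t ^ 2 * t ^ 2) in P by ring.
replace (t ^ 6) with (t ^ 2 * t ^ 2 * t ^ 2) in P by ring.
set (s := t ^ 2) in *; nra.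
Qed.

Section Assembly.
Variables (w psi : R -> R) (h : R).
Hypothesis w_cont : forall y, continuous w y.
Hypothesis psi_cont : forall y, continuous psi y.
Hypothesis w_ge0 : forall y, 0 <= w y.
Hypothesis h_gt0 : 0 < h.
Hypothesis h_le : h ^ 2 <= 203 / 10000.
Hypothesis w_ge : forall y, 0 <= y -> exp (- (247 / 100 * y ^ 2 / h ^ 6)) <= w y.
Hypothesis psi_bound : forall y, 0 <= y -> 0 <= psi y <= 13 / 5 * y ^ 3 / h ^ 8.
Hypothesis w_le_near : forall y, 0 <= y <= (61 / 1000) ->
  w y <= exp (- ((999 / 500) / h ^ 2 * (y ^ 2 / (h ^ 4 + y ^ 2)) - y ^ 2 / (2 * h ^ 4))
    + (1 / 5000)).
Hypothesis w_le_far : forall y, 3 * h ^ 2 <= y <= PI -> w y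
  <= exp (- ((899 / 1000) / h ^ 2) + (1 / 10000)).

(* [h] is the square root of [x = - ln r], so that [w] has width [h^3].  The cut
   [y0] keeps [psi] below [PI/2]; the constants that follow are rounded so that the
   final comparison in [quadratic_form_pos] holds with a factor of about 3/2 to spare. *)
Let y0 := 8 / 5 * h ^ 3.
Let quartic y := w y * (1 - cos y) ^ 2.

Lemma h_lt : h <= 57 / 400.
Proof. nra. Qed.

Lemma h_pow_le n : h ^ S n <= 57 / 400 * h ^ n.
Proof.
rewrite -tech_pow_Rmult; apply Rmult_le_compat_r; [apply pow_le; lra|apply h_lt].
Qed.

Lemma h_pow_gt0 n : 0 < h ^ n. Proof. now apply pow_lt. Qed.

Lemma weighted_cont a : (forall y, continuous a y) -> forall y, continuous (fun y => w y * a y) y.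
Proof. intros Ha y; now apply (continuous_mult w a). Qed.

Lemma weighted_cos_cont a : (forall y, continuous a y) ->
  forall y, continuous (fun y => w y * cos (psi y) * a y) y.
Proof.
intros Ha y; apply (continuous_mult (fun y => w y * cos (psi y)) a); [|easy].
apply (continuous_mult w); [easy|].
apply (continuous_comp psi cos); [easy|apply continuous_cos].
Qed.

Lemma weighted_sin_cont a : (forall y, continuous a y) ->
  forall y, continuous (fun y => w y * sin (psi y) * a y) y.
Proof.
intros Ha y; apply (continuous_mult (fun y => w y * sin (psi y)) a); [|easy].
apply (continuous_mult w); [easy|].
apply (continuous_comp psi sin); [easy|apply continuous_sin].
Qed.

Lemma PI_gt3 : 3 < PI.
Proof. assert (H := PI2_3_2); lra. Qed.

Lemma y0_bounds : 0 < y0 <= 1 / 100.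
Proof.
unfold y0; assert (H := h_pow_gt0 3); assert (H1 := h_pow_le 2); split; [lra|].
assert (h ^ 3 <= 57 / 400 * (203 / 10000)) by lra; lra.
Qed.

(** At [y0] the bound is [13/5 (8/5)^3 h], below [10.65 * 57/400 < 38/25]; the factor 8/5 in [y0] is
    about as large as this permits. *)
Lemma psi_y0 y : 0 <= y <= y0 -> 0 <= psi y <= 38 / 25.
Proof.
intros Hy; destruct (psi_bound y) as [H1 H2]; [lra|].
split; [easy|]; eapply Rle_trans; [exact H2|].
assert (y ^ 3 <= y0 ^ 3) by (apply pow_incr; lra).
apply Rle_trans with (13 / 5 * y0 ^ 3 / h ^ 8).
  apply Rmult_le_compat_r; [apply Rlt_le, Rinv_0_lt_compat, h_pow_gt0|lra].
replace (13 / 5 * y0 ^ 3 / h ^ 8) with (13 / 5 * (512 / 125) * h) by (unfold y0; field; lra).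
assert (H3 := h_lt); lra.
Qed.

Lemma cos_psi_ge0 y : 0 <= y <= y0 -> 0 <= cos (psi y).
Proof.
intros Hy; assert (H := psi_y0 y Hy); assert (Q := PI2_ge); apply cos_ge_0; lra.
Qed.

Lemma sin_psi_ge0 y : 0 <= y <= y0 -> 0 <= sin (psi y).
Proof.
intros Hy; assert (H := psi_y0 y Hy); assert (P := PI_gt3); apply sin_ge_0; lra.
Qed.

Lemma one_sub_cos_y0 : (819 / 500) * h ^ 12 <= (1 - cos y0) ^ 2 /\ (1279 / 1000) * h ^ 6
  <= 1 - cos y0 <= 32 / 25 * h ^ 6.
Proof.
assert (Y := y0_bounds).
assert (G := one_sub_cos_ge y0 ltac:(lra)); assert (L := one_sub_cos_le y0).
assert (E2 : y0 ^ 2 = 64 / 25 * h ^ 6) by (unfold y0; field).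
assert (E4 : y0 ^ 4 = 4096 / 625 * h ^ 6 * h ^ 6) by (unfold y0; field).
assert (H6 := h_pow_gt0 6).
assert (h ^ 6 <= 1 / 100000).
  replace (h ^ 6) with ((h ^ 2) ^ 3) by ring.
  apply Rle_trans with ((203 / 10000) ^ 3); [|lra].
  apply pow_incr; split; [apply Rlt_le, h_pow_gt0|lra].
assert (B : (127999 / 100000) * h ^ 6 <= 1 - cos y0 <= 32 / 25 * h ^ 6) by nra.
split; [|lra].
replace (h ^ 12) with (h ^ 6 * h ^ 6) by ring; nra.
Qed.

(** * Mass of the quartic integrand beyond [y0] *)

Lemma one_sub_cos_sq_cont : forall y, continuous (fun y => (1 - cos y) ^ 2) y.
Proof. cont. Qed.

Lemma quartic_cont y : continuous quartic y.
Proof. apply weighted_cont, one_sub_cos_sq_cont. Qed.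

Lemma quartic_le y W : w y <= W -> quartic y <= W * (y ^ 4 / 4).
Proof.
intros HW; unfold quartic.
assert (H := w_ge0 y); assert (C := COS_bound y); assert (L := one_sub_cos_le y).
assert (Hc : (1 - cos y) ^ 2 <= (y ^ 2 / 2) ^ 2) by (apply pow_incr; lra).
replace (y ^ 4 / 4) with ((y ^ 2 / 2) ^ 2) by field.
apply Rmult_le_compat; [easy|apply pow2_ge_0|easy|easy].
Qed.

(* In the units [s = y^2/h^6] and [u = h^2]. *)
Lemma near_exponent y : 1 / h ^ 2 * (y ^ 2 / (h ^ 4 + y ^ 2))
  = (y ^ 2 / h ^ 6) / (1 + y ^ 2 / h ^ 6 * h ^ 2).
Proof.
assert (0 <= y ^ 2) by apply pow2_ge_0; assert (H4 := h_pow_gt0 4).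
field; repeat split; try lra.
Qed.

Lemma h_sq_bounds : 0 < h ^ 2 <= 203 / 10000.
Proof. split; [apply h_pow_gt0|easy]. Qed.

(** Here [s u <= 64/25 * 203/10000 < 13/250], so the denominator [1 + s u] lowers the rate 999/500
    to no less than 1.895, and the correction [s u / 2] takes at most 0.0102 more. *)
Lemma w_le_center y : 0 <= y <= y0 -> w y <= 1001 / 1000 * exp (- ((47 / 25) / h ^ 6 * y ^ 2)).
Proof.
intros Hy; assert (Y := y0_bounds).
eapply Rle_trans; [apply w_le_near; lra|].
apply Rle_trans with (exp (1 / 5000) * exp (- ((47 / 25) / h ^ 6 * y ^ 2))).
  rewrite -exp_plus; apply exp_le.
  replace ((999 / 500) / h ^ 2 * (y ^ 2 / (h ^ 4 + y ^ 2)))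
    with (999 / 500 * (1 / h ^ 2 * (y ^ 2 / (h ^ 4 + y ^ 2)))); last first.
    assert (0 <= y ^ 2) by apply pow2_ge_0; assert (H4 := h_pow_gt0 4); field; lra.
  rewrite near_exponent.
  replace (y ^ 2 / (2 * h ^ 4)) with (y ^ 2 / h ^ 6 * h ^ 2 / 2) by (field; lra).
  replace ((47 / 25) / h ^ 6 * y ^ 2) with (47 / 25 * (y ^ 2 / h ^ 6)) by (field; lra).
  assert (S : 0 <= y ^ 2 / h ^ 6 <= 64 / 25).
    split; [apply Rmult_le_pos; [apply pow2_ge_0|apply Rlt_le, Rinv_0_lt_compat, h_pow_gt0]|].
    apply Rmult_le_reg_r with (h ^ 6); [apply h_pow_gt0|].
    replace (y ^ 2 / h ^ 6 * h ^ 6) with (y ^ 2) by (field; lra).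
    replace (64 / 25 * h ^ 6) with (y0 ^ 2) by (unfold y0; field).
    apply pow_incr; lra.
  assert (U := h_sq_bounds).
  set (s := y ^ 2 / h ^ 6) in *; set (u := h ^ 2) in *.
  assert (SU : 0 <= s * u <= 13 / 250) by nra.
  assert (1895 / 1000 * s <= 999 / 500 * (s / (1 + s * u))).
    apply Rmult_le_reg_r with (1 + s * u); [lra|].
    replace (999 / 500 * (s / (1 + s * u)) * (1 + s * u)) with (999 / 500 * s) by (field; lra).
    nra.
  assert (s * u <= s * (203 / 10000)) by (apply Rmult_le_compat_l; lra).
  lra.
apply Rmult_le_compat_r; [apply Rlt_le, exp_pos|].
assert (H := exp_ineq1_le (- (1 / 5000))); rewrite exp_Ropp in H.
assert (P := exp_pos (1 / 5000)).
apply Rmult_le_reg_r with (/ exp (1 / 5000)); [now apply Rinv_0_lt_compat|].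
rewrite Rinv_r; lra.
Qed.

(** Up to [h^2 / 2] one has [s u <= 1/4], so the rate still exceeds 3/2; 483/100 is a lower bound
    for the exponent at [y0], where [s = 64/25]. *)
Lemma w_le_mid y : y0 <= y <= h ^ 2 / 2 ->
  w y <= exp (- ((483 / 100) + (3 / 2) * (y ^ 2 / h ^ 6 - (64 / 25)))).
Proof.
intros Hy; assert (Y := y0_bounds); assert (U := h_sq_bounds).
eapply Rle_trans; [apply w_le_near; lra|].
apply exp_le.
replace ((999 / 500) / h ^ 2 * (y ^ 2 / (h ^ 4 + y ^ 2)))
  with (999 / 500 * (1 / h ^ 2 * (y ^ 2 / (h ^ 4 + y ^ 2)))); last first.
  assert (0 <= y ^ 2) by apply pow2_ge_0; assert (H4 := h_pow_gt0 4); field; lra.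
rewrite near_exponent.
replace (y ^ 2 / (2 * h ^ 4)) with (y ^ 2 / h ^ 6 * h ^ 2 / 2) by (field; lra).
assert (S : (64 / 25) <= y ^ 2 / h ^ 6).
  apply Rmult_le_reg_r with (h ^ 6); [apply h_pow_gt0|].
  replace (y ^ 2 / h ^ 6 * h ^ 6) with (y ^ 2) by (field; lra).
  replace (64 / 25 * h ^ 6) with (y0 ^ 2) by (unfold y0; field).
  apply pow_incr; lra.
assert (V : y ^ 2 / h ^ 6 * h ^ 2 <= 1 / 4).
  apply Rmult_le_reg_r with (h ^ 4); [apply h_pow_gt0|].
  replace (y ^ 2 / h ^ 6 * h ^ 2 * h ^ 4) with (y ^ 2) by (field; lra).
  replace (1 / 4 * h ^ 4) with ((h ^ 2 / 2) ^ 2) by field.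
  apply pow_incr; lra.
set (s := y ^ 2 / h ^ 6) in *; set (u := h ^ 2) in *.
set (v := s * u) in *.
assert (SV : v <= s * (203 / 10000)) by (unfold v; apply Rmult_le_compat_l; lra).
assert (v0 : 0 < v) by (unfold v; apply Rmult_lt_0_compat; lra).
enough ((483 / 100) + (3 / 2) * (s - (64 / 25)) + v / 2 + (1 / 5000)
  <= 999 / 500 * (s / (1 + v))) by lra.
apply Rmult_le_reg_r with (1 + v); [lra|].
replace (999 / 500 * (s / (1 + v)) * (1 + v)) with (999 / 500 * s) by (field; lra).
enough (((4951 / 5000) + v / 2) * (1 + v) <= s * ((249 / 500) - (3 / 2) * v)) by lra.
(* The two lower bounds on [s], namely 64/25 and [v / (203/10000)], cross near [v = 13/250]; each
   side uses the stronger one. *)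
destruct (Rle_lt_dec v (13 / 250)) as [L|L].
  apply Rle_trans with (64 / 25 * ((249 / 500) - (3 / 2) * v)); [nra|].
  apply Rmult_le_compat_r; lra.
apply Rle_trans with (v / (203 / 10000) * ((249 / 500) - (3 / 2) * v)); [nra|].
apply Rmult_le_compat_r; lra.
Qed.

Lemma tail_y0_half : RInt quartic y0 (h ^ 2 / 2) <= 9 / 2000 * h ^ 15.
Proof.
assert (Y := y0_bounds); assert (U := h_sq_bounds).
set (E y := exp (- ((483 / 100) + (3 / 2) * (y ^ 2 / h ^ 6 - (64 / 25))))).
(* [y^4 E] has no elementary primitive, but [(y^4 - h^6 y^2) E] has. For [y >= y0] the latter is at
   least [39/64 y^4 E], and 821/500 exceeds 64/39. *)
set (F y := - ((821 / 500) / 12 * h ^ 6 * y ^ 3 * E y)).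
set (F' y := (821 / 500) / 4 * (y ^ 4 - h ^ 6 * y ^ 2) * E y).
assert (y0l : y0 <= h ^ 2 / 2).
  unfold y0; replace (h ^ 3) with (h * h ^ 2) by ring.
  assert (H := h_lt); nra.
assert (I : RInt quartic y0 (h ^ 2 / 2) <= F (h ^ 2 / 2) - F y0).
  apply (RInt_le_prim quartic F F'); [easy|apply quartic_cont| | |].
  - intros y; unfold F, F', E; auto_derive; [easy|].
    repeat match goal with |- context [exp ?a] => change (exp a) with (E y) end.
    field; lra.
  - unfold F', E; cont.
  - intros y Hy; eapply Rle_trans; [apply quartic_le, w_le_mid, Hy|].
    fold (E y); unfold F'.
    assert (P : 0 < E y) by apply exp_pos.
    assert (S : (64 / 25) * h ^ 6 <= y ^ 2).
      replace (64 / 25 * h ^ 6) with (y0 ^ 2) by (unfold y0; field).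
      apply pow_incr; lra.
    rewrite Rmult_comm; apply Rmult_le_compat_r; [lra|].
    replace (y ^ 4) with (y ^ 2 * y ^ 2) by ring.
    assert (H6 := h_pow_gt0 6); nra.
eapply Rle_trans; [exact I|].
assert (Fp : 0 <= - F (h ^ 2 / 2)).
  unfold F; rewrite Ropp_involutive; repeat apply Rmult_le_pos; try (apply pow_le; lra); try lra.
  apply Rlt_le, exp_pos.
assert (Ey : E y0 <= 1 / 125).
  unfold E; replace ((483 / 100) + (3 / 2) * (y0 ^ 2 / h ^ 6 - (64 / 25)))
    with (INR 16 * (483 / 1600))
    by (unfold y0; simpl; field; lra).
  apply exp_neg_le; lra.
assert (Fy : - F y0 <= (821 / 500) / 12 * (512 / 125) * (1 / 125) * h ^ 15).
  unfold F; rewrite Ropp_involutive.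
  replace ((821 / 500) / 12 * h ^ 6 * y0 ^ 3)
    with ((821 / 500) / 12 * (512 / 125) * h ^ 15) by (unfold y0; field).
  assert (H := h_pow_gt0 15); nra.
assert (H := h_pow_gt0 15); lra.
Qed.

Lemma inv_h_sq_ge : (2463 / 50) <= / h ^ 2.
Proof.
assert (U := h_sq_bounds).
apply Rmult_le_reg_r with (h ^ 2); [lra|]; rewrite Rinv_l; lra.
Qed.

(** The rate is [999/500 * 1/5], with 1/5 the value of [y^2 / (h^4 + y^2)] at [y = h^2 / 2]. Three
    factors [z exp (- z)] yield [h^6]; 164/25 is a third of the exponent at the largest [h], rounded
    down. *)
Lemma exp_inv_h_sq_le6 : exp (- (999 / 2500 * / h ^ 2)) <= 9 / 25000 * h ^ 6.
Proof.
assert (U := inv_h_sq_ge).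
assert (U0 : 0 < / h ^ 2) by lra.
assert (U1 : INR 3 * (164 / 25) <= 999 / 2500 * / h ^ 2) by (replace (INR 3) with 3
  by (simpl; ring); lra).
assert (H := exp_neg_le_pow (999 / 2500) (/ h ^ 2) 3 (164 / 25) (47 / 5000) U0 ltac:(lia)
  ltac:(lra) U1).
assert (B : exp (- (164 / 25)) * (164 / 25) <= 47 / 5000).
  assert (exp (- (164 / 25)) <= 143 / 100000); [|lra].
  replace (164 / 25) with (INR 16 * (41 / 100)) by (simpl; field); apply exp_neg_le; lra.
specialize (H B).
set (X := exp (- (999 / 2500 * / h ^ 2))) in *.
replace (999 / 2500 * / h ^ 2 / INR 3) with (333 / 2500 * / h ^ 2) in H by (simpl; field; lra).
apply Rmult_le_reg_r with (/ h ^ 6); [apply Rinv_0_lt_compat, h_pow_gt0|].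
replace (9 / 25000 * h ^ 6 * / h ^ 6) with (9 / 25000) by (field; lra).
replace ((333 / 2500 * / h ^ 2) ^ 3) with ((333 / 2500) ^ 3 * / h ^ 6) in H by (field; lra).
set (Z := X * / h ^ 6).
replace (X * ((333 / 2500) ^ 3 * / h ^ 6)) with ((333 / 2500) ^ 3 * Z) in H by (unfold Z; ring).
lra.
Qed.

Lemma w_le_between y A B : h ^ 2 / 2 <= y <= 3 * h ^ 2 ->
  A <= y ^ 2 / (h ^ 4 + y ^ 2) -> y ^ 2 <= B * h ^ 4 ->
  w y <= exp (- (999 / 500 * A * / h ^ 2) + B / 2 + (1 / 5000)).
Proof.
intros Hy HA HB; assert (U := h_sq_bounds).
eapply Rle_trans; [apply w_le_near; lra|].
apply exp_le.
assert (y ^ 2 / (2 * h ^ 4) <= B / 2).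
  apply Rmult_le_reg_r with (2 * h ^ 4); [assert (H := h_pow_gt0 4); lra|].
  replace (y ^ 2 / (2 * h ^ 4) * (2 * h ^ 4)) with (y ^ 2) by (field; lra); lra.
assert (A * / h ^ 2 <= y ^ 2 / (h ^ 4 + y ^ 2) * / h ^ 2).
  apply Rmult_le_compat_r; [apply Rlt_le, Rinv_0_lt_compat, h_pow_gt0|easy].
unfold Rdiv in *; lra.
Qed.

Lemma ratio_ge y a : 0 < a -> a * h ^ 2 <= y -> a ^ 2 / (1 + a ^ 2) <= y ^ 2 / (h ^ 4 + y ^ 2).
Proof.
intros a0 Ha.
assert (H2 := h_pow_gt0 2).
assert (0 < a * h ^ 2) by now apply Rmult_lt_0_compat.
assert (Hr : (a * h ^ 2) ^ 2 <= y ^ 2) by (apply pow_incr; lra).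
assert (H4 := h_pow_gt0 4); assert (0 < a ^ 2) by now apply pow_lt.
assert (0 <= y ^ 2) by apply pow2_ge_0.
apply Rmult_le_reg_r with ((1 + a ^ 2) * (h ^ 4 + y ^ 2)); [apply Rmult_lt_0_compat; lra|].
replace (a ^ 2 / (1 + a ^ 2) * ((1 + a ^ 2) * (h ^ 4 + y ^ 2))) with (a ^ 2 * (h ^ 4 + y ^ 2))
  by (field; lra).
replace (y ^ 2 / (h ^ 4 + y ^ 2) * ((1 + a ^ 2) * (h ^ 4 + y ^ 2))) with (y ^ 2 * (1 + a ^ 2))
  by (field; lra).
replace ((a * h ^ 2) ^ 2) with (a ^ 2 * h ^ 4) in Hr by ring.
lra.
Qed.

Lemma tail_half_one : RInt quartic (h ^ 2 / 2) (h ^ 2) <= 1 / 50000 * h ^ 15.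
Proof.
assert (U := h_sq_bounds).
apply Rle_trans with (exp (- (999 / 2500 * / h ^ 2)
  + (2501 / 5000)) * (h ^ 8 / 4) * (h ^ 2 - h ^ 2 / 2)).
  apply RInt_le_const; [lra|apply quartic_cont|].
  intros y Hy; eapply Rle_trans; [apply quartic_le|].
    apply (w_le_between y (1 / 5) 1); [lra| |].
      eapply Rle_trans; [|apply (ratio_ge y (1 / 2))]; lra.
    replace (1 * h ^ 4) with ((h ^ 2) ^ 2) by ring; apply pow_incr; lra.
  apply Rmult_le_compat.
  - apply Rlt_le, exp_pos.
  - assert (0 <= y ^ 4) by (apply pow_le; lra); lra.
  - apply exp_le; lra.
  - assert (y ^ 4 <= (h ^ 2) ^ 4) by (apply pow_incr; lra).
    replace (h ^ 8) with ((h ^ 2) ^ 4) by ring; lra.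
rewrite exp_plus.
assert (exp (2501 / 5000) <= 3) by (eapply Rle_trans; [apply (exp_le _ 1); lra|apply exp_le_3]).
assert (X := exp_inv_h_sq_le6); assert (P := exp_pos (2501 / 5000)).
assert (P' := exp_pos (- (999 / 2500 * / h ^ 2))).
assert (H6 := h_pow_gt0 6); assert (H10 := h_pow_gt0 10); assert (H15 := h_pow_gt0 15).
apply Rle_trans with (9 / 25000 * h ^ 6 * 3 * (h ^ 10 / 8)).
  replace (exp (- (999 / 2500 * / h ^ 2)) * exp (2501 / 5000) * (h ^ 8 / 4) * (h ^ 2 - h ^ 2 / 2))
    with (exp (- (999 / 2500 * / h ^ 2)) * exp (2501 / 5000) * (h ^ 10 / 8)) by field.
  apply Rmult_le_compat_r; [lra|]; apply Rmult_le_compat; lra.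
replace (9 / 25000 * h ^ 6 * 3 * (h ^ 10 / 8)) with ((27 / 25000) / 8 * h ^ 16) by field.
assert (Hh := h_pow_le 15); lra.
Qed.

Lemma tail_one_three : RInt quartic (h ^ 2) (3 * h ^ 2) <= 1 / 100000 * h ^ 15.
Proof.
assert (U := h_sq_bounds); assert (U' := inv_h_sq_ge).
(* From [y = h^2] on the ratio is at least 1/2. Of the rate 999/1000, the part 999/2500 is kept for
   the power of [h]; the rest contributes more than 29, which outweighs [9/2 + 16]. *)
apply Rle_trans with (exp (- (999 / 2500 * / h ^ 2)
  + - 16) * (81 * h ^ 8 / 4) * (3 * h ^ 2 - h ^ 2)).
  apply RInt_le_const; [lra|apply quartic_cont|].
  intros y Hy; eapply Rle_trans; [apply quartic_le|].
    apply (w_le_between y (1 / 2) 9); [lra| |].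
      eapply Rle_trans; [|apply (ratio_ge y 1)]; lra.
    replace (9 * h ^ 4) with ((3 * h ^ 2) ^ 2) by ring; apply pow_incr; lra.
  apply Rmult_le_compat.
  - apply Rlt_le, exp_pos.
  - assert (0 <= y ^ 4) by (apply pow_le; lra); lra.
  - apply exp_le; lra.
  - assert (y ^ 4 <= (3 * h ^ 2) ^ 4) by (apply pow_incr; lra).
    replace (81 * h ^ 8) with ((3 * h ^ 2) ^ 4) by ring; lra.
rewrite exp_plus.
assert (exp (- 16) <= 1 / 1000).
  replace (-16) with (- (INR 16 * 1)) by (simpl; ring); apply exp_neg_le; lra.
assert (X := exp_inv_h_sq_le6); assert (P := exp_pos (- 16)).
assert (P' := exp_pos (- (999 / 2500 * / h ^ 2))).
assert (H6 := h_pow_gt0 6); assert (H10 := h_pow_gt0 10); assert (H15 := h_pow_gt0 15).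
apply Rle_trans with (9 / 25000 * h ^ 6 * (1 / 1000) * (81 / 2 * h ^ 10)).
  replace (exp (- (999 / 2500 * / h ^ 2)) * exp (- 16) * (81 * h ^ 8 / 4) * (3 * h ^ 2 - h ^ 2))
    with (exp (- (999 / 2500 * / h ^ 2)) * exp (- 16) * (81 / 2 * h ^ 10)) by field.
  apply Rmult_le_compat_r; [lra|]; apply Rmult_le_compat; lra.
replace (9 / 25000 * h ^ 6 * (1 / 1000) * (81 / 2 * h ^ 10))
  with (9 / 25000000 * 81 / 2 * h ^ 16) by field.
assert (Hh := h_pow_le 15); lra.
Qed.

(** On the far interval the integrand is only bounded by a constant over a length of up to 4, so a
    power beyond [h^15] must come from the exponential alone: eight factors [z exp (- z)]. *)
Lemma exp_inv_h_sq_le16 : exp (- (899 / 1000 * / h ^ 2)) <= 11 / 5000000 * h ^ 16.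
Proof.
assert (U := inv_h_sq_ge).
assert (U0 : 0 < / h ^ 2) by lra.
assert (U1 : INR 8 * (553 / 100) <= 899 / 1000 * / h ^ 2) by (replace (INR 8) with 8
  by (simpl; ring); lra).
assert (H := exp_neg_le_pow (899 / 1000) (/ h ^ 2) 8 (553 / 100) (11 / 500) U0 ltac:(lia)
  ltac:(lra) U1).
assert (B : exp (- (553 / 100)) * (553 / 100) <= 11 / 500).
  assert (exp (- (553 / 100)) <= 397 / 100000); [|lra].
  replace (553 / 100) with (INR 32 * (553 / 3200)) by (simpl; field); apply exp_neg_le; lra.
specialize (H B).
set (X := exp (- (899 / 1000 * / h ^ 2))) in *.
replace (899 / 1000 * / h ^ 2 / INR 8) with (899 / 8000 * / h ^ 2) in H by (simpl; field; lra).
apply Rmult_le_reg_r with (/ h ^ 16); [apply Rinv_0_lt_compat, h_pow_gt0|].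
replace (11 / 5000000 * h ^ 16 * / h ^ 16) with (11 / 5000000) by (field; lra).
replace ((899 / 8000 * / h ^ 2) ^ 8) with ((899 / 8000) ^ 8 * / h ^ 16) in H by (field; lra).
set (Z := X * / h ^ 16).
replace (X * ((899 / 8000) ^ 8 * / h ^ 16)) with ((899 / 8000) ^ 8 * Z) in H by (unfold Z; ring).
lra.
Qed.

Lemma tail_three_pi : RInt quartic (3 * h ^ 2) PI <= 1 / 100000 * h ^ 15.
Proof.
assert (U := h_sq_bounds); assert (P3 := PI_gt3); assert (P4 := PI_4).
apply Rle_trans with (exp (- (899 / 1000 * / h ^ 2)) * (1001 / 1000) * 4 * (PI - 3 * h ^ 2)).
  apply RInt_le_const; [lra|apply quartic_cont|].
  intros y Hy; unfold quartic.
  apply Rmult_le_compat; [apply w_ge0|apply pow2_ge_0| |].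
    eapply Rle_trans; [now apply w_le_far|].
    rewrite exp_plus; unfold Rdiv; apply Rmult_le_compat_l; [apply Rlt_le, exp_pos|].
    assert (Hi := exp_ineq1_le (- (1 / 10000))); rewrite exp_Ropp in Hi.
    assert (P := exp_pos (1 / 10000)).
    apply Rmult_le_reg_r with (/ exp (1 / 10000)); [now apply Rinv_0_lt_compat|].
    unfold Rdiv in *; rewrite Rinv_r; lra.
  assert (C := COS_bound y); replace 4 with (2 ^ 2) by ring; apply pow_incr; lra.
assert (X := exp_inv_h_sq_le16); assert (P' := exp_pos (- (899 / 1000 * / h ^ 2))).
assert (H16 := h_pow_gt0 16); assert (H15 := h_pow_gt0 15); assert (Hh := h_pow_le 15).
apply Rle_trans with (11 / 5000000 * h ^ 16 * (1001 / 1000) * 4 * 4); [|lra].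
apply Rmult_le_compat; [| |  |]; lra.
Qed.

(** The yardstick for all tails: each of the six integrals is compared beyond [y0] with a multiple
    of this mass. *)
Definition tail_mass : R := RInt quartic y0 PI.

Lemma tail_mass_le : tail_mass <= 227 / 50000 * h ^ 15.
Proof.
unfold tail_mass.
rewrite (RInt_split quartic _ (h ^ 2 / 2)); [|apply quartic_cont].
rewrite (RInt_split quartic (h ^ 2 / 2) (h ^ 2)); [|apply quartic_cont].
rewrite (RInt_split quartic (h ^ 2) (3 * h ^ 2)); [|apply quartic_cont].
assert (A := tail_y0_half); assert (B := tail_half_one); assert (C := tail_one_three);
  assert (D := tail_three_pi).
unfold plus; simpl; simpl in *; lra.
Qed.

Lemma quartic_ge0 y : 0 <= quartic y.
Proof. apply Rmult_le_pos; [apply w_ge0|apply pow2_ge_0]. Qed.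

Lemma tail_mass_ge0 : 0 <= tail_mass.
Proof.
assert (Y := y0_bounds); assert (P := PI_gt3).
apply RInt_ge_0; [lra| |intros; apply quartic_ge0].
apply (ex_RInt_continuous (V := R_CompleteNormedModule)); intros; apply quartic_cont.
Qed.

(** * Contributions of the interval up to [y0] *)

Definition center_mass : R := RInt (fun y => w y * cos (psi y) * (1 - cos y) ^ 2) 0 y0.

Lemma gauss5_derive b y : b <> 0 ->
  is_derive (fun y => - ((y ^ 4 / b + 2 * y ^ 2 / b ^ 2 + 2 / b ^ 3) / 2 * exp (- (b * y ^ 2)))) y
            (y ^ 5 * exp (- (b * y ^ 2))).
Proof.
intros b0; auto_derive; [easy|].
repeat match goal with |- context [exp ?a] =>
  lazymatch a with - (b * y ^ 2) => fail | _ => change (exp a) with (exp (- (b * y ^ 2))) end end.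
field; easy.
Qed.

Lemma gauss3_derive b y : b <> 0 ->
  is_derive (fun y => - ((y ^ 2 / b + 1 / b ^ 2) / 2 * exp (- (b * y ^ 2)))) y
            (y ^ 3 * exp (- (b * y ^ 2))).
Proof.
intros b0; auto_derive; [easy|].
repeat match goal with |- context [exp ?a] =>
  lazymatch a with - (b * y ^ 2) => fail | _ => change (exp a) with (exp (- (b * y ^ 2))) end end.
field; easy.
Qed.

Lemma cos_psi_ge y c : 0 <= y <= c * h ^ 3 -> 1 - (13 / 5 * c ^ 3 * h) ^ 2 / 2 <= cos (psi y).
Proof.
intros Hy; destruct (psi_bound y) as [H1 H2]; [lra|].
assert (L := one_sub_cos_le (psi y)).
assert (psi y <= 13 / 5 * c ^ 3 * h).
  eapply Rle_trans; [exact H2|].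
  apply Rmult_le_reg_r with (h ^ 8); [apply h_pow_gt0|].
  replace (13 / 5 * y ^ 3 / h ^ 8 * h ^ 8) with (13 / 5 * y ^ 3) by (field; lra).
  replace (13 / 5 * c ^ 3 * h * h ^ 8) with (13 / 5 * (c * h ^ 3) ^ 3) by ring.
  apply Rmult_le_compat_l; [lra|apply pow_incr; lra].
assert (psi y ^ 2 <= (13 / 5 * c ^ 3 * h) ^ 2) by (apply pow_incr; lra).
lra.
Qed.

(** The bound [1 - psi^2 / 2] on the cosine degrades near [y0], so only [[0, 6/5 h^3]] is used,
    where it leaves 159/200; the remainder is nonnegative. *)
Lemma center_mass_ge : (3 / 400) * h ^ 15 <= center_mass.
Proof.
assert (Y := y0_bounds); assert (Hh := h_lt); assert (H3 := h_pow_gt0 3).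
set (y1 := 6 / 5 * h ^ 3).
assert (Cf : forall y, continuous (fun y => w y * cos (psi y) * (1 - cos y) ^ 2) y)
  by apply weighted_cos_cont, one_sub_cos_sq_cont.
unfold center_mass; rewrite (RInt_split _ 0 y1); [|exact Cf].
assert (A : 0 <= RInt (fun y => w y * cos (psi y) * (1 - cos y) ^ 2) y1 y0).
  apply RInt_ge_0; [unfold y1, y0; lra| |].
    apply (ex_RInt_continuous (V := R_CompleteNormedModule)); intros; apply Cf.
  intros y Hy; apply Rmult_le_pos; [|apply pow2_ge_0].
  apply Rmult_le_pos; [apply w_ge0|apply cos_psi_ge0; unfold y1 in Hy; lra].
set (b := (247 / 100) / h ^ 6).
assert (b0 : 0 < b) by (apply Rdiv_lt_0_compat; [lra|apply h_pow_gt0]).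
(* Chosen so that [k y <= k y1 = 99/500], just below [159/200 * 2499/10000]. The factor [k y] turns
   [y^4] into [y^5], which has an elementary primitive against a Gaussian. *)
set (k := (33 / 200) / h ^ 3).
assert (k0 : 0 < k) by (apply Rdiv_lt_0_compat; lra).
set (F y := k * - ((y ^ 4 / b + 2 * y ^ 2 / b ^ 2 + 2 / b ^ 3) / 2 * exp (- (b * y ^ 2)))).
assert (B : F y1 - F 0 <= RInt (fun y => w y * cos (psi y) * (1 - cos y) ^ 2) 0 y1).
  apply (RInt_ge_prim _ F (fun y => k * (y ^ 5 * exp (- (b * y ^ 2)))));
    [unfold y1; lra|exact Cf| | |].
  - intros y; unfold F; apply: is_derive_scal; apply gauss5_derive; lra.
  - cont.
  - intros y Hy.
    assert (C1 : (159 / 200) <= cos (psi y)).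
      eapply Rle_trans; [|apply (cos_psi_ge y (6 / 5)); exact Hy].
      assert ((13 / 5 * (6 / 5) ^ 3 * h) ^ 2 <= (6403 / 10000) ^ 2) by (apply pow_incr; lra).
      lra.
    assert (C2 : (2499 / 10000) * y ^ 4 <= (1 - cos y) ^ 2).
      assert (yl : y <= 1 / 100) by (unfold y1, y0 in *; lra).
      assert (G := one_sub_cos_ge y ltac:(lra)).
      replace (2499 / 10000 * y ^ 4) with (2499 / 10000 * (y ^ 2) ^ 2) by ring.
      replace (y ^ 4) with (y ^ 2 * y ^ 2) in G by ring.
      assert (Q : 0 <= y ^ 2 <= 1 / 10000) by nra.
      assert (G2 : (9999 / 20000) * y ^ 2 <= 1 - cos y) by nra.
      assert ((9999 / 20000 * y ^ 2) ^ 2 <= (1 - cos y) ^ 2) by (apply pow_incr; lra).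
      assert (0 <= (y ^ 2) ^ 2) by apply pow2_ge_0.
      nra.
    assert (C3 : exp (- (b * y ^ 2)) <= w y).
      replace (b * y ^ 2) with (247 / 100 * y ^ 2 / h ^ 6) by (unfold b; field; lra).
      apply w_ge; lra.
    assert (E0 := exp_pos (- (b * y ^ 2))).
    assert (y4 : 0 <= y ^ 4) by (apply pow_le; lra).
    apply Rle_trans with (exp (- (b * y ^ 2)) * (159 / 200) * (2499 / 10000 * y ^ 4)); last first.
      apply Rmult_le_compat; [|lra| |easy].
        apply Rmult_le_pos; lra.
      apply Rmult_le_compat; lra.
    replace (k * (y ^ 5 * exp (- (b * y ^ 2))))
      with ((k * y) * (y ^ 4 * exp (- (b * y ^ 2)))) by ring.
    apply Rle_trans with (99 / 500 * (y ^ 4 * exp (- (b * y ^ 2)))); last first.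
      assert (0 <= y ^ 4 * exp (- (b * y ^ 2))) by (apply Rmult_le_pos; lra).
      lra.
    apply Rmult_le_compat_r; [apply Rmult_le_pos; lra|].
    replace (99 / 500) with (k * y1) by (unfold k, y1; field; lra).
    apply Rmult_le_compat_l; lra.
apply Rle_trans with (F y1 - F 0); [|unfold plus; simpl; simpl in *; lra].
assert (Z : exp (- (b * y1 ^ 2)) <= 143 / 5000).
  replace (b * y1 ^ 2) with (INR 8 * (2223 / 5000)) by (unfold b, y1; simpl; field; lra).
  apply exp_neg_le; lra.
assert (EF : F y1 - F 0 = (33 / 200) / (247 / 100) ^ 3 * h ^ 15
   * (1 - exp (- (b * y1 ^ 2)) * (1 + (2223 / 625) + (2223 / 625) ^ 2 / 2))).
  unfold F; replace (b * 0 ^ 2) with 0 by ring; rewrite Ropp_0 exp_0.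
  set (e := exp _); unfold k, b, y1; field; lra.
rewrite EF; assert (H15 := h_pow_gt0 15).
apply Rle_trans with ((33 / 200) / (247 / 100) ^ 3 * h ^ 15 * (1 - (143 / 5000) * (1
  + (2223 / 625) + (2223 / 625) ^ 2 / 2))); [lra|].
apply Rmult_le_compat_l; [apply Rmult_le_pos; lra|lra].
Qed.

Lemma center_cos_ge : (417 / 1000) * h ^ 3 <= RInt (fun y => w y * cos (psi y) * 1) 0 y0.
Proof.
assert (Y := y0_bounds); assert (Hh := h_lt); assert (H3 := h_pow_gt0 3).
set (y1 := 3 / 5 * h ^ 3).
assert (Cf : forall y, continuous (fun y => w y * cos (psi y) * 1) y)
  by (apply weighted_cos_cont; intros; apply continuous_const).
rewrite (RInt_split _ 0 y1); [|exact Cf].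
assert (A : 0 <= RInt (fun y => w y * cos (psi y) * 1) y1 y0).
  apply RInt_ge_0; [unfold y1, y0; lra| |].
    apply (ex_RInt_continuous (V := R_CompleteNormedModule)); intros; apply Cf.
  intros y Hy; apply Rmult_le_pos; [|lra].
  apply Rmult_le_pos; [apply w_ge0|apply cos_psi_ge0; unfold y1 in Hy; lra].
set (F y := 99 / 100 * (y - (247 / 100) / 3 * y ^ 3 / h ^ 6)).
assert (B : F y1 - F 0 <= RInt (fun y => w y * cos (psi y) * 1) 0 y1).
  apply (RInt_ge_prim _ F (fun y => (99 / 100) * (1 - (247 / 100) * y ^ 2 / h ^ 6)));
    [unfold y1; lra|exact Cf| | |].
  - intros y; unfold F; auto_derive; [easy|simpl; field; lra].
  - cont.
  - intros y Hy.
    assert (C1 : (99 / 100) <= cos (psi y)).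
      eapply Rle_trans; [|apply (cos_psi_ge y (3 / 5)); exact Hy].
      assert ((13 / 5 * (3 / 5) ^ 3 * h) ^ 2 <= (1 / 10) ^ 2) by (apply pow_incr; lra).
      lra.
    assert (C3 := w_ge y ltac:(lra)).
    assert (I := exp_ineq1_le (- (247 / 100 * y ^ 2 / h ^ 6))).
    assert (0 <= 247 / 100 * y ^ 2 / h ^ 6 <= 1).
      split.
        apply Rmult_le_pos; [assert (0 <= y ^ 2) by apply pow2_ge_0; lra|].
        apply Rlt_le, Rinv_0_lt_compat, h_pow_gt0.
      apply Rmult_le_reg_r with (h ^ 6); [apply h_pow_gt0|].
      replace (247 / 100 * y ^ 2 / h ^ 6 * h ^ 6) with (247 / 100 * y ^ 2) by (field; lra).
      assert (y ^ 2 <= (3 / 5 * h ^ 3) ^ 2) by (apply pow_incr; unfold y1 in Hy; lra).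
      replace ((3 / 5 * h ^ 3) ^ 2) with (9 / 25 * h ^ 6) in * by field.
      assert (H6 := h_pow_gt0 6); lra.
    rewrite Rmult_1_r Rmult_comm; apply Rmult_le_compat; lra.
apply Rle_trans with (F y1 - F 0); [|unfold plus; simpl; simpl in *; lra].
replace (F y1 - F 0) with (99 / 100 * ((3 / 5) - (247 / 100) / 3 * (27 / 125)) * h ^ 3)
  by (unfold F, y1; field; lra).
lra.
Qed.

Lemma center_sin_le : RInt (fun y => w y * sin (psi y) * (sin y * (1 + cos y))) 0 y0
  <= 109 / 1000 * h ^ 6.
Proof.
assert (Y := y0_bounds); assert (Hh := h_lt); assert (H3 := h_pow_gt0 3).
set (b := (47 / 25) / h ^ 6).
assert (b0 : 0 < b) by (apply Rdiv_lt_0_compat; [lra|apply h_pow_gt0]).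
(* The integrand is at most a multiple of [y^4] times a Gaussian; [2 y h^3 <= y^2 + h^6] trades it
   for the odd powers [y^3] and [y^5]. The factor 13013/5000 is [1001/1000 * 13/5]. *)
set (k3 := (13013 / 5000) / h ^ 5); set (k5 := (13013 / 5000) / h ^ 11).
assert (k30 : 0 < k3) by (apply Rdiv_lt_0_compat; [lra|apply h_pow_gt0]).
assert (k50 : 0 < k5) by (apply Rdiv_lt_0_compat; [lra|apply h_pow_gt0]).
set (F y := k3 * - ((y ^ 2 / b + 1 / b ^ 2) / 2 * exp (- (b * y ^ 2)))
  + k5 * - ((y ^ 4 / b + 2 * y ^ 2 / b ^ 2 + 2 / b ^ 3) / 2 * exp (- (b * y ^ 2)))).
assert (B : RInt (fun y => w y * sin (psi y) * (sin y * (1 + cos y))) 0 y0 <= F y0 - F 0).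
  apply (RInt_le_prim _ F (fun y => k3 * (y ^ 3 * exp (- (b * y ^ 2)))
     + k5 * (y ^ 5 * exp (- (b * y ^ 2))))); [lra| | | |].
  - apply weighted_sin_cont; cont.
  - intros y; unfold F; apply: is_derive_plus; apply: is_derive_scal;
      [apply gauss3_derive|apply gauss5_derive]; lra.
  - cont.
  - intros y Hy.
    destruct (psi_bound y) as [Q1 Q2]; [lra|].
    assert (S := sin_psi_ge0 y Hy).
    assert (S' := proj1 (sub_sin_bounds _ Q1)).
    assert (Sy := proj1 (sub_sin_bounds y ltac:(lra))).
    assert (Sy0 : 0 <= sin y) by (apply sin_ge_0; assert (P := PI_gt3); lra).
    assert (C := COS_bound y).
    assert (W := w_le_center y Hy).
    assert (E0 := exp_pos (- (b * y ^ 2))).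
    apply Rle_trans with (1001 / 1000 * exp (- (b * y ^ 2)) * (13 / 5 * y ^ 3 / h ^ 8) * (y * 2)).
      apply Rmult_le_compat.
      - apply Rmult_le_pos; [apply w_ge0|easy].
      - apply Rmult_le_pos; lra.
      - apply Rmult_le_compat; [apply w_ge0|easy|easy|lra].
      - apply Rmult_le_compat; lra.
    replace (1001 / 1000 * exp (- (b * y ^ 2)) * (13 / 5 * y ^ 3 / h ^ 8) * (y * 2))
      with (exp (- (b * y ^ 2)) * (13013 / 5000 * y ^ 3 / h ^ 11 * (2 * y * h ^ 3)))
        by (field; lra).
    replace (k3 * (y ^ 3 * exp (- (b * y ^ 2))) + k5 * (y ^ 5 * exp (- (b * y ^ 2))))
      with (exp (- (b * y ^ 2)) * (13013 / 5000 * y ^ 3 / h ^ 11 * (y ^ 2 + h ^ 6)))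
      by (unfold k3, k5; field; lra).
    apply Rmult_le_compat_l; [lra|]; apply Rmult_le_compat_l.
      apply Rmult_le_pos; [assert (0 <= y ^ 3) by (apply pow_le; lra); lra|].
      apply Rlt_le, Rinv_0_lt_compat, h_pow_gt0.
    replace (h ^ 6) with (h ^ 3 * h ^ 3) by ring.
    assert (0 <= (y - h ^ 3) ^ 2) by apply pow2_ge_0. nra.
eapply Rle_trans; [exact B|].
assert (N : F y0 <= 0).
  assert (E0 := exp_pos (- (b * y0 ^ 2))).
  assert (ib : 0 < / b) by now apply Rinv_0_lt_compat.
  assert (h5 := Rinv_0_lt_compat _ (h_pow_gt0 5));
    assert (h11 := Rinv_0_lt_compat _ (h_pow_gt0 11)).
  unfold F.
  assert (A3 : 0 <= k3 * ((y0 ^ 2 / b + 1 / b ^ 2) / 2 * exp (- (b * y0 ^ 2)))).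
    unfold Rdiv; rewrite -!pow_inv; repeat first [apply Rmult_le_pos|apply Rplus_le_le_0_compat];
      try apply pow_le; lra.
  assert (A5 : 0 <= k5 * ((y0 ^ 4 / b + 2 * y0 ^ 2 / b ^ 2
    + 2 / b ^ 3) / 2 * exp (- (b * y0 ^ 2)))).
    unfold Rdiv; rewrite -!pow_inv; repeat first [apply Rmult_le_pos|apply Rplus_le_le_0_compat];
      try apply pow_le; lra.
  lra.
assert (EF : - F 0 = 13013 / 5000 * ((1 / 2) / (47 / 25) ^ 2 + 1 / (47 / 25) ^ 3) * h ^ 7).
  unfold F; replace (b * 0 ^ 2) with 0 by ring; rewrite Ropp_0 exp_0.
  unfold k3, k5, b; field; lra.
assert (H7 := h_pow_le 6); assert (H6 := h_pow_gt0 6); lra.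
Qed.

Lemma tail_trig (g a : R -> R) k : 0 <= k ->
  (forall y, continuous (fun y => w y * g y * a y) y) -> (forall y, -1 <= g y <= 1) ->
  (forall y, y0 <= y <= PI -> - (k * (1 - cos y) ^ 2) <= a y <= k * (1 - cos y) ^ 2) ->
  - (k * tail_mass) <= RInt (fun y => w y * g y * a y) y0 PI <= k * tail_mass.
Proof.
intros k0 Cf Hg Ha.
assert (Y := y0_bounds); assert (P := PI_gt3).
assert (B : forall y, y0 <= y <= PI -> - (k * quartic y) <= w y * g y * a y <= k * quartic y).
  intros y Hy; specialize (Hg y); specialize (Ha y Hy); assert (W := w_ge0 y).
  unfold quartic; replace (k * (w y * (1 - cos y) ^ 2))
    with (w y * (k * (1 - cos y) ^ 2)) by ring.
  set (m := k * (1 - cos y) ^ 2) in *.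
  assert (- m <= g y * a y <= m) by nra.
  rewrite Rmult_assoc; split; [|apply Rmult_le_compat_l; lra].
  replace (- (w y * m)) with (w y * - m) by ring; apply Rmult_le_compat_l; lra.
assert (Ck : forall c y, continuous (fun y => c * quartic y) y).
  intros c y; apply (continuous_mult (fun _ => c) quartic);
    [apply continuous_const|apply quartic_cont].
unfold tail_mass; split.
  replace (- (k * RInt quartic y0 PI)) with (- k * RInt quartic y0 PI) by ring.
  rewrite -(RInt_scal_R quartic (- k)); [|apply quartic_cont].
  apply RInt_le_cont; [lra|apply Ck|easy|]; intros y Hy; specialize (B y Hy); lra.
rewrite -(RInt_scal_R quartic k); [|apply quartic_cont].
apply RInt_le_cont; [lra|easy|apply Ck|]; intros y Hy; specialize (B y Hy); lra.
Qed.

(** * The six integrals: center against tail *)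

Local Notation CI := (cos_int w psi).
Local Notation SI := (sin_int w psi).

Lemma cos_le_y0 y : y0 <= y <= PI -> cos y <= cos y0.
Proof. intros Hy; assert (Y := y0_bounds); apply cos_decr_1; lra. Qed.

Lemma cos_ge_y0 y : 0 <= y <= y0 -> cos y0 <= cos y.
Proof.
intros Hy; assert (Y := y0_bounds); assert (P := PI_gt3); apply cos_decr_1; lra.
Qed.

Lemma cos_y0_ge : (999 / 1000) <= cos y0 < 1.
Proof.
assert (Y := y0_bounds); assert (H := one_sub_cos_y0); assert (L := one_sub_cos_le y0).
assert (H6 := h_pow_gt0 6); nra.
Qed.

(** If the comparison of [a] with [k (1 - cos y)^2] reverses at [y0], the center counts at least
    [k center_mass] and the tail at most [k tail_mass], so signs are decided by
    [tail_mass <= center_mass]. *)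
Lemma cos_int_ge a k : 0 <= k -> (forall y, continuous a y) ->
  (forall y, 0 <= y <= y0 -> k * (1 - cos y) ^ 2 <= a y) ->
  (forall y, y0 <= y <= PI -> - (k * (1 - cos y) ^ 2) <= a y <= k * (1 - cos y) ^ 2) ->
  k * (center_mass - tail_mass) <= CI a.
Proof.
intros k0 Ca Hn Hf.
assert (Y := y0_bounds).
assert (C := weighted_cos_cont _ Ca).
unfold cos_int; rewrite (RInt_split _ 0 y0); [|easy].
assert (A := tail_trig (fun y => cos (psi y)) a k k0 C (fun y => COS_bound _) Hf).
assert (C2 := weighted_cos_cont _ one_sub_cos_sq_cont).
assert (B : k * center_mass <= RInt (fun y => w y * cos (psi y) * a y) 0 y0).
  unfold center_mass; rewrite -RInt_scal_R; [|easy].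
  apply RInt_le_cont; [lra| |easy|].
    intros y; apply (continuous_mult (fun _ => k)); [apply continuous_const|apply C2].
  intros y Hy.
  replace (k * (w y * cos (psi y) * (1 - cos y) ^ 2))
    with (w y * cos (psi y) * (k * (1 - cos y) ^ 2)) by ring.
  apply Rmult_le_compat_l; [|now apply Hn].
  apply Rmult_le_pos; [apply w_ge0|now apply cos_psi_ge0].
unfold plus; simpl; simpl in *; lra.
Qed.

Lemma cos_int_quartic_ge : (37 / 12500) * h ^ 15 <= CI (fun y => (1 - cos y) ^ 2).
Proof.
assert (A := cos_int_ge (fun y => (1 - cos y) ^ 2) 1 ltac:(lra) one_sub_cos_sq_cont).
assert (B := center_mass_ge); assert (D := tail_mass_le).
eapply Rle_trans; [|apply A; intros y _; assert (0 <= (1 - cos y) ^ 2) by apply pow2_ge_0; lra].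
lra.
Qed.

Lemma center_sub_tail_ge0 : 0 <= center_mass - tail_mass.
Proof. assert (B := center_mass_ge); assert (D := tail_mass_le); assert (H := h_pow_gt0 15);
  lra. Qed.

Lemma cos_int_cos_ge0 : 0 <= CI (fun y => (1 - cos y) * cos y).
Proof.
assert (C := cos_y0_ge).
(* Makes both integrands meet at [y0]; monotonicity of [cos] gives the order on either side.
   [k >= 1] covers negative [cos y], as [- k (1 - cos y) <= cos y - 1]. *)
set (k := cos y0 / (1 - cos y0)).
assert (k1 : 1 <= k).
  unfold k; apply Rmult_le_reg_r with (1 - cos y0); [lra|].
  unfold Rdiv; rewrite Rmult_assoc Rinv_l; lra.
assert (Ek : k * (1 - cos y0) = cos y0) by (unfold k; field; lra).
apply Rle_trans with (k * (center_mass - tail_mass)).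
  apply Rmult_le_pos; [lra|apply center_sub_tail_ge0].
apply cos_int_ge; [lra|cont| |].
  intros y Hy; assert (H := cos_ge_y0 y Hy); assert (B := COS_bound y).
  replace (k * (1 - cos y) ^ 2) with ((1 - cos y) * (k * (1 - cos y))) by ring.
  apply Rmult_le_compat_l; [lra|]; nra.
intros y Hy; assert (H := cos_le_y0 y Hy); assert (B := COS_bound y).
replace (k * (1 - cos y) ^ 2) with ((1 - cos y) * (k * (1 - cos y))) by ring.
replace (- ((1 - cos y) * (k * (1 - cos y)))) with ((1 - cos y) * - (k * (1 - cos y))) by ring.
split; (apply Rmult_le_compat_l; [lra|]); nra.
Qed.

Lemma cos_int_two_add_cos_ge0 : 0 <= CI (fun y => (1 - cos y) * (2 + cos y)).
Proof.
assert (C := cos_y0_ge).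
set (k := (2 + cos y0) / (1 - cos y0)).
assert (k0 : 0 <= k) by (apply Rlt_le, Rdiv_lt_0_compat; lra).
assert (Ek : k * (1 - cos y0) = 2 + cos y0) by (unfold k; field; lra).
apply Rle_trans with (k * (center_mass - tail_mass)).
  apply Rmult_le_pos; [lra|apply center_sub_tail_ge0].
apply cos_int_ge; [lra|cont| |].
  intros y Hy; assert (H := cos_ge_y0 y Hy); assert (B := COS_bound y).
  replace (k * (1 - cos y) ^ 2) with ((1 - cos y) * (k * (1 - cos y))) by ring.
  apply Rmult_le_compat_l; [lra|]; nra.
intros y Hy; assert (H := cos_le_y0 y Hy); assert (B := COS_bound y).
replace (k * (1 - cos y) ^ 2) with ((1 - cos y) * (k * (1 - cos y))) by ring.
replace (- ((1 - cos y) * (k * (1 - cos y)))) with ((1 - cos y) * - (k * (1 - cos y))) by ring.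
split; (apply Rmult_le_compat_l; [lra|]); nra.
Qed.

Lemma cos_int_const_ge : (207 / 500) * h ^ 3 <= CI (fun _ => 1).
Proof.
assert (Y := y0_bounds); assert (C := cos_y0_ge).
assert (Ca : forall y : R, continuous (fun _ : R => 1) y) by (intros; apply continuous_const).
assert (Cw := weighted_cos_cont _ Ca).
unfold cos_int; rewrite (RInt_split _ 0 y0); [|easy].
set (k := / (1 - cos y0) ^ 2).
assert (S0 : 0 < (1 - cos y0) ^ 2) by (apply pow_lt; lra).
assert (k0 : 0 < k) by now apply Rinv_0_lt_compat.
assert (A := tail_trig (fun y => cos (psi y)) (fun _ => 1) k (Rlt_le _ _ k0) Cw
  (fun y => COS_bound _)).
assert (H : forall y, y0 <= y <= PI ->
  - (k * (1 - cos y) ^ 2) <= 1 <= k * (1 - cos y) ^ 2).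
  intros y Hy; assert (H := cos_le_y0 y Hy).
  assert ((1 - cos y0) ^ 2 <= (1 - cos y) ^ 2) by (apply pow_incr; lra).
  assert (k * (1 - cos y0) ^ 2 = 1) by (unfold k; field; lra).
  assert (k * (1 - cos y0) ^ 2 <= k * (1 - cos y) ^ 2) by (apply Rmult_le_compat_l; lra).
  lra.
specialize (A H).
assert (B := center_cos_ge); assert (T := tail_mass_le); assert (T0 := tail_mass_ge0).
assert (K : k * tail_mass <= 3 / 1000 * h ^ 3).
  assert (G := proj1 one_sub_cos_y0).
  apply Rmult_le_reg_r with ((1 - cos y0) ^ 2); [easy|].
  replace (k * tail_mass * (1 - cos y0) ^ 2) with tail_mass by (unfold k; field; lra).
  apply Rle_trans with (3 / 1000 * h ^ 3 * (819 / 500 * h ^ 12)).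
    replace (3 / 1000 * h ^ 3 * (819 / 500 * h ^ 12))
      with (3 / 1000 * (819 / 500) * h ^ 15) by ring.
    assert (H15 := h_pow_gt0 15); lra.
  apply Rmult_le_compat_l; [assert (H3 := h_pow_gt0 3); lra|easy].
unfold plus; simpl; simpl in *; lra.
Qed.

(** The product is negative only if exactly one tail outweighs its center part. The worst case is
    [P4 + T4 < 0], costing [71/12500 * 1179/10000 < 7/10000]. *)
Lemma center_tail_product_ge (X P4 P5 T4 T5 : R) :
  0 < X -> 0 <= P4 <= 32 / 25 * X * P5 -> P5 <= 109 / 1000 * X ->
  - (71 / 12500 * (X * X)) <= T4 -> T4 <= 71 / 12500 * (X * X) ->
  - (89 / 10000 * X) <= T5 -> T5 <= 89 / 10000 * X ->
  - (7 / 10000 * (X * X * X)) <= (P4 + T4) * (P5 + T5).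
Proof.
intros H6 [P40 P45] PP T4l T4u T5l T5u.
assert (P50 : 0 <= P5) by nra.
assert (X2 : 0 < X * X) by now apply Rmult_lt_0_compat.
assert (X3 : 0 < X * X * X) by now apply Rmult_lt_0_compat.
destruct (Rle_lt_dec 0 (P4 + T4)) as [L4|L4]; destruct (Rle_lt_dec 0 (P5 + T5)) as [L5|L5].
- apply Rle_trans with 0; [lra|now apply Rmult_le_pos].
- (* here [P5] is itself below the tail, hence so is [P4] *)
  assert (P4 <= 32 / 25 * X * (89 / 10000 * X))
    by (eapply Rle_trans; [exact P45|apply Rmult_le_compat_l; lra]).
  assert ((P4 + T4) * - (P5 + T5) <= (18 / 1000 * (X * X)) * (89 / 10000 * X))
    by (apply Rmult_le_compat; lra).
  lra.
- assert (- (P4 + T4) * (P5 + T5) <= (71 / 12500 * (X * X)) * (1179 / 10000 * X))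
    by (apply Rmult_le_compat; lra).
  lra.
- assert (0 <= - (P4 + T4) * - (P5 + T5)) by (apply Rmult_le_pos; lra).
  lra.
Qed.

Lemma sin_int_product_ge : - (7 / 10000 * h ^ 18)
  <= SI (fun y => sin y * (1 - cos y)) * SI (fun y => sin y * (1 + cos y)).
Proof.
assert (Y := y0_bounds); assert (C := cos_y0_ge); assert (Pi := PI_gt3).
assert (C4 : forall y, continuous (fun y => w y * sin (psi y) * (sin y * (1 - cos y))) y)
  by (apply weighted_sin_cont; cont).
assert (C5 : forall y, continuous (fun y => w y * sin (psi y) * (sin y * (1 + cos y))) y)
  by (apply weighted_sin_cont; cont).
unfold sin_int; rewrite (RInt_split _ 0 y0 PI C4) (RInt_split _ 0 y0 PI C5).
assert (T := tail_mass_le); assert (T0 := tail_mass_ge0); assert (PP := center_sin_le).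
(* Beyond [y0] a factor [sin y] is at most [2 / y0] times [1 - cos y], which turns the sine
   integrands into multiples of [(1 - cos y)^2]. For [I5] the second factor comes from
   [1 + cos y <= 2] and [1 - cos y >= 1 - cos y0]. *)
assert (Hsin : forall y, y0 <= y <= PI -> 0 <= sin y <= 2 / y0 * (1 - cos y)).
  intros y Hy; assert (M := mul_sin_le y ltac:(lra)).
  assert (S := sin_ge_0 y ltac:(lra) ltac:(lra)).
  split; [easy|].
  apply Rmult_le_reg_r with y0; [lra|].
  replace (2 / y0 * (1 - cos y) * y0) with (2 * (1 - cos y)) by (field; lra).
  nra.
assert (k0 : 0 < 2 / y0) by (apply Rdiv_lt_0_compat; lra).
assert (A4 := tail_trig (fun y => sin (psi y)) (fun y => sin y * (1 - cos y)) (2 / y0)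
  (Rlt_le _ _ k0) C4 (fun y => SIN_bound _)).
assert (H4 : forall y, y0 <= y <= PI -> - (2 / y0 * (1 - cos y) ^ 2)
  <= sin y * (1 - cos y) <= 2 / y0 * (1 - cos y) ^ 2).
  intros y Hy; specialize (Hsin y Hy); assert (B := COS_bound y).
  assert (0 <= 2 / y0 * (1 - cos y) ^ 2)
    by (apply Rmult_le_pos; [lra|apply pow2_ge_0]).
  replace (2 / y0 * (1 - cos y) ^ 2) with (2 / y0 * (1 - cos y) * (1 - cos y)) in * by ring.
  nra.
specialize (A4 H4).
set (k5 := 2 / y0 * (2 / (1 - cos y0))).
assert (k50 : 0 < k5) by (apply Rmult_lt_0_compat; [easy|apply Rdiv_lt_0_compat; lra]).
assert (A5 := tail_trig (fun y => sin (psi y)) (fun y => sin y * (1 + cos y)) k5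
  (Rlt_le _ _ k50) C5 (fun y => SIN_bound _)).
assert (H5 : forall y, y0 <= y <= PI -> - (k5 * (1 - cos y) ^ 2)
  <= sin y * (1 + cos y) <= k5 * (1 - cos y) ^ 2).
  intros y Hy; specialize (Hsin y Hy); assert (B := COS_bound y).
  assert (D := cos_le_y0 y Hy).
  assert (0 <= k5 * (1 - cos y) ^ 2)
    by (apply Rmult_le_pos; [lra|apply pow2_ge_0]).
  assert (0 <= sin y * (1 + cos y)) by (apply Rmult_le_pos; lra).
  assert (sin y * (1 + cos y) <= 2 / y0 * (1 - cos y) * 2) by (apply Rmult_le_compat; lra).
  assert (1 <= (1 - cos y) / (1 - cos y0)).
    apply Rmult_le_reg_r with (1 - cos y0); [lra|].
    unfold Rdiv; rewrite Rmult_assoc Rinv_l; lra.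
  assert (2 / y0 * (1 - cos y) * 2 * 1 <= 2 / y0 * (1 - cos y) * 2 * ((1 - cos y) / (1 - cos
    y0))).
    apply Rmult_le_compat_l; [|easy].
    repeat apply Rmult_le_pos; lra.
  replace (2 / y0 * (1 - cos y) * 2 * ((1 - cos y) / (1 - cos y0)))
    with (k5 * (1 - cos y) ^ 2) in *
    by (unfold k5; field; lra).
  lra.
specialize (A5 H5).
assert (B4 : 2 / y0 * tail_mass <= 71 / 12500 * h ^ 12).
  apply Rmult_le_reg_r with y0; [lra|].
  replace (2 / y0 * tail_mass * y0) with (2 * tail_mass) by (field; lra).
  replace (71 / 12500 * h ^ 12 * y0) with (71 / 12500 * (8 / 5) * h ^ 15) by (unfold y0; ring).
  assert (H15 := h_pow_gt0 15); lra.
assert (B5 : k5 * tail_mass <= 89 / 10000 * h ^ 6).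
  assert (G := proj2 one_sub_cos_y0).
  apply Rmult_le_reg_r with (1 - cos y0); [lra|].
  replace (k5 * tail_mass * (1 - cos y0)) with (2 * (2 / y0 * tail_mass))
    by (unfold k5; field; lra).
  apply Rle_trans with (89 / 10000 * h ^ 6 * (1279 / 1000 * h ^ 6)).
    replace (89 / 10000 * h ^ 6 * (1279 / 1000 * h ^ 6))
      with (89 / 10000 * (1279 / 1000) * h ^ 12) by ring.
    assert (H12 := h_pow_gt0 12); lra.
  apply Rmult_le_compat_l; [assert (H6 := h_pow_gt0 6); lra|lra].
set (P5 := RInt (fun y => w y * sin (psi y) * (sin y * (1 + cos y))) 0 y0) in *.
set (P4 := RInt (fun y => w y * sin (psi y) * (sin y * (1 - cos y))) 0 y0) in *.
assert (P40 : 0 <= P4).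
  apply RInt_ge_0; [lra| |].
    apply (ex_RInt_continuous (V := R_CompleteNormedModule)); intros; apply C4.
  intros y Hy; assert (B := COS_bound y).
  apply Rmult_le_pos; apply Rmult_le_pos; [apply w_ge0|apply sin_psi_ge0; lra|apply sin_ge_0;
    lra|lra].
assert (P45 : P4 <= 32 / 25 * h ^ 6 * P5).
  unfold P5; rewrite -RInt_scal_R; [|easy].
  apply RInt_le_cont; [lra|easy| |].
    intros y; apply (continuous_mult (fun _ => (32 / 25) * h ^ 6));
      [apply continuous_const|apply C5].
  intros y Hy; assert (B := COS_bound y).
  assert (G := proj2 one_sub_cos_y0).
  assert (D := cos_ge_y0 y Hy).
  replace (32 / 25 * h ^ 6 * (w y * sin (psi y) * (sin y * (1 + cos y))))
    with (w y * sin (psi y) * (sin y * (32 / 25 * h ^ 6 * (1 + cos y)))) by ring.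
  apply Rmult_le_compat_l.
    apply Rmult_le_pos; [apply w_ge0|apply sin_psi_ge0; lra].
  apply Rmult_le_compat_l; [apply sin_ge_0; lra|].
  assert (H6 := h_pow_gt0 6); nra.
replace (h ^ 18) with (h ^ 6 * h ^ 6 * h ^ 6) by ring.
replace (h ^ 12) with (h ^ 6 * h ^ 6) in B4 by ring.
assert (H6 := h_pow_gt0 6).
apply (center_tail_product_ge (h ^ 6) P4 P5); try easy.
- eapply Rle_trans; [|apply A4]; lra.
- eapply Rle_trans; [apply A4|]; lra.
- eapply Rle_trans; [|apply A5]; lra.
- eapply Rle_trans; [apply A5|]; lra.
Qed.

Lemma quadratic_form_pos : 0 < CI (fun _ => 1) * CI (fun y => (1 - cos y) ^ 2)
  + CI (fun y => (1 - cos y) * cos y) * CI (fun y => (1 - cos y) * (2 + cos y))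
  + SI (fun y => sin y * (1 - cos y)) * SI (fun y => sin y * (1 + cos y)).
Proof.
assert (A := sin_int_product_ge); assert (B0 := cos_int_const_ge);
  assert (B1 := cos_int_quartic_ge).
assert (B23 := Rmult_le_pos _ _ cos_int_cos_ge0 cos_int_two_add_cos_ge0).
assert (H3 := h_pow_gt0 3); assert (H15 := h_pow_gt0 15); assert (H18 := h_pow_gt0 18).
(* The product of the constants is about 0.00123, against 0.0007 for the sine product. *)
assert (207 / 500 * h ^ 3 * (37 / 12500 * h ^ 15)
  <= CI (fun _ => 1) * CI (fun y => (1 - cos y) ^ 2))
  by (apply Rmult_le_compat; lra).
replace (207 / 500 * h ^ 3 * (37 / 12500 * h ^ 15))
  with (207 / 500 * (37 / 12500) * h ^ 18) in * by ring.
lra.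
Qed.

End Assembly.

(** * Pointwise bounds on the weight *)

(** Real part of the finite geometric sum of [r exp (i y)], multiplied by [|1 - r exp (i y)|^2]; the
    induction uses the three-term recurrence of [cos (k y)]. *)
Lemma cos_sum_closed (r y : R) K :
  (1 - 2 * r * cos y + r ^ 2) * sum_f_R0 (fun k => r ^ k * cos (INR k * y)) K
  = 1 - r * cos y - r ^ S K * cos (INR (S K) * y) + r ^ S (S K) * cos (INR K * y).
Proof.
induction K as [|K IH].
  simpl; rewrite Rmult_0_l cos_0 !Rmult_1_l; ring.
rewrite tech5 Rmult_plus_distr_l IH.
assert (E : cos (INR (S (S K)) * y) = 2 * cos y * cos (INR (S K) * y) - cos (INR K * y)).
  replace (INR (S (S K)) * y) with (INR (S K) * y + y) by (rewrite !S_INR; ring).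
  replace (INR K * y) with (INR (S K) * y - y) by (rewrite !S_INR; ring).
  rewrite cos_plus cos_minus; ring.
rewrite E -!tech_pow_Rmult; ring.
Qed.

Section Damping.
Variables (x : R) (K : nat).
Hypothesis x0 : 0 < x.
Let r := exp (- x).
Definition geometric_loss (y : R) := sum_f_R0 (fun k => r ^ k * (1 - cos (INR k * y))) K.

Lemma r_bounds : 0 < r < 1.
Proof. now apply exp_opp_in01. Qed.

(** The infinite sum is [/ (1 - r)] minus the real part of [/ (1 - r exp (i y))], which equals
    [(1 + r) / (2 (1 - r))] times the displayed ratio; [coth_ge] bounds that factor below by [/ x].
    The assumption on [r ^ K] limits the truncation error to 3/100000 + 3/50000. *)
Lemma geometric_loss_ge y : r ^ K <= 3 / 100000 * (1 - r) ^ 2 ->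
  / x * (2 * (1 - cos y) / (coshm x + 2 * (1 - cos y))) - (1 / 10000) <= geometric_loss y.
Proof.
intros Hr; assert (R0 := r_bounds).
set (v := 1 - cos y).
assert (v0 : 0 <= v) by (assert (B := COS_bound y); unfold v; lra).
set (D := 1 - 2 * r * cos y + r ^ 2).
assert (ED : D = (1 - r) ^ 2 + 2 * r * v) by (unfold D, v; ring).
assert (d2 : 0 < (1 - r) ^ 2) by (apply pow_lt; lra).
assert (D0 : (1 - r) ^ 2 <= D) by (assert (0 <= r * v) by (apply Rmult_le_pos; lra); lra).
assert (EH : geometric_loss y = (1 - r ^ S K) / (1 - r)
  - (1 - r * cos y - r ^ S K * cos (INR (S K) * y) + r ^ S (S K) * cos (INR K * y)) / D).
  rewrite -cos_sum_closed -/D.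
  replace (D * sum_f_R0 (fun k => r ^ k * cos (INR k * y)) K / D)
    with (sum_f_R0 (fun k => r ^ k * cos (INR k * y)) K) by (field; lra).
  rewrite -(tech3 r K ltac:(lra)) -minus_sum; apply sum_eq; intros; ring.
assert (EM : 1 / (1 - r) - (1 - r * cos y) / D
  = ((1 + r) / (1 - r)) * (/ 2) * (2 * v / (coshm x + 2 * v))).
  rewrite coshm_exp; fold r.
  replace (cos y) with (1 - v) by (unfold v; ring); rewrite ED.
  assert (0 <= r * v) by (apply Rmult_le_pos; lra).
  field; repeat split; lra.
assert (C := coth_ge x x0); fold r in C.
set (W := 2 * v / (coshm x + 2 * v)) in *.
assert (W0 : 0 <= W).
  assert (A0 : 0 < coshm x).
    rewrite coshm_exp; apply Rdiv_lt_0_compat; fold r; lra.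
  apply Rmult_le_pos; [lra|apply Rlt_le, Rinv_0_lt_compat; lra].
assert (M : / x * W <= 1 / (1 - r) - (1 - r * cos y) / D).
  rewrite EM; apply Rmult_le_compat_r; [easy|]; unfold Rdiv in *; lra.
assert (K0 : 0 < r ^ K) by (apply pow_lt; lra).
assert (S1 : r ^ S K <= r ^ K) by (rewrite -tech_pow_Rmult; nra).
assert (S10 : 0 < r ^ S K) by (apply pow_lt; lra).
assert (S20 : 0 < r ^ S (S K)) by (apply pow_lt; lra).
assert (S2 : r ^ S (S K) <= r ^ K) by (rewrite -(tech_pow_Rmult r (S K)); nra).
assert (B1 := COS_bound (INR (S K) * y)); assert (B2 := COS_bound (INR K * y)).
assert (E1 : r ^ S K / (1 - r) <= 3 / 100000).
  apply Rmult_le_reg_r with (1 - r); [lra|].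
  replace (r ^ S K / (1 - r) * (1 - r)) with (r ^ S K) by (field; lra).
  nra.
assert (E2 : (- (r ^ S K * cos (INR (S K) * y)) + r ^ S (S K) * cos (INR K * y)) / D
  <= 3 / 50000).
  apply Rmult_le_reg_r with D; [lra|].
  set (t := - (r ^ S K * cos (INR (S K) * y)) + r ^ S (S K) * cos (INR K * y)).
  replace (t / D * D) with t by (field; lra).
  assert (t <= 2 * r ^ K) by (unfold t; nra).
  lra.
rewrite EH.
replace ((1 - r ^ S K) / (1 - r)
  - (1 - r * cos y - r ^ S K * cos (INR (S K) * y) + r ^ S (S K) * cos (INR K * y)) / D)
  with ((1 / (1 - r) - (1 - r * cos y) / D) - r ^ S K / (1 - r)
    - (- (r ^ S K * cos (INR (S K) * y)) + r ^ S (S K) * cos (INR K * y)) / D) by (field; lra).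
lra.
Qed.

(** 61/1000 is just above [3 * 203/10000], so the range reaches [y = 3 x], the start of the far
    region. *)
Lemma kernel_ratio_ge y : x <= (203 / 10000) -> 0 <= y <= (61 / 1000) ->
  (999 / 1000) * (y ^ 2 / (x ^ 2 + y ^ 2)) <= 2 * (1 - cos y) / (coshm x + 2 * (1 - cos y)).
Proof.
intros x1 Hy.
assert (G := one_sub_cos_ge y ltac:(lra)).
assert (A := coshm_le x ltac:(lra)).
assert (A' := coshm_ge x ltac:(lra)).
assert (X2 : 0 < x ^ 2) by now apply pow_lt.
assert (X4 : 0 < x ^ 4) by now apply pow_lt.
assert (X6 : 0 < x ^ 6) by now apply pow_lt.
set (S := 2 * (1 - cos y)) in *; set (p := y ^ 2).
assert (p0 : 0 <= p <= 1 / 250) by (unfold p; nra).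
assert (S0 : (2499 / 2500) * p <= S).
  replace (y ^ 4) with (p * p) in G by (unfold p; ring); fold p in G; unfold S; nra.
assert (C1 : coshm x <= 10001 / 10000 * x ^ 2).
  replace (x ^ 4) with (x ^ 2 * x ^ 2) in A by ring.
  assert (x ^ 2 <= 1 / 2000) by nra. nra.
apply Rmult_le_reg_r with ((x ^ 2 + p) * (coshm x + S)); [apply Rmult_lt_0_compat; lra|].
replace (999 / 1000 * (p / (x ^ 2 + p)) * ((x ^ 2 + p) * (coshm x + S)))
  with (999 / 1000 * p * (coshm x + S)) by (field; lra).
replace (S / (coshm x + S) * ((x ^ 2 + p) * (coshm x + S))) with (S * (x ^ 2 + p))
  by (field; lra).
assert (999 / 1000 * p * coshm x <= 999 / 1000 * p * (10001 / 10000 * x ^ 2))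
  by (apply Rmult_le_compat_l; lra).
assert (2499 / 2500 * p * (x ^ 2 + (1 / 1000) * p) <= S * (x ^ 2 + (1 / 1000) * p))
  by (apply Rmult_le_compat_r; lra).
nra.
Qed.

End Damping.

Section Pointwise.
Variables (K : nat) (e : nat -> R) (x : R) (m : nat).
Hypothesis x0 : 0 < x.
Hypothesis x_le : x <= 203 / 10000.
Let r := exp (- x).
Hypothesis e0 : e 0%nat = 0.
Hypothesis e_ge : forall k, (1 <= k)%nat -> 2 * INR k - 1 <= e k.
Hypothesis moment_le : forall p : nat, moment K e x p
  <= 2 * sum_f_R0 (fun j => if Nat.odd j then
       INR j ^ p * sum_f_R0 (fun d => INR d ^ S p * (r ^ j) ^ d) K else 0) K.
Hypothesis saddle : moment K e x 0 = INR m.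
Hypothesis r_small : r ^ K <= 3 / 100000 * (1 - r) ^ 2.

Definition beta (k : nat) := e k * r ^ k / INR k.

Lemma beta_mul k : INR k * beta k = e k * r ^ k.
Proof.
unfold beta; destruct k as [|k]; [rewrite e0; simpl; unfold Rdiv; ring|].
field; apply not_0_INR; lia.
Qed.

Lemma r_pow_pos k : 0 < r ^ k.
Proof. apply pow_lt, exp_pos. Qed.

Lemma beta_ge k : r ^ k * (2 - / INR k) <= beta k /\ r ^ k <= beta k \/ k = 0%nat.
Proof.
destruct k as [|k]; [now right|left].
assert (H := e_ge (S k) ltac:(lia)).
assert (P := r_pow_pos (S k)).
assert (k1 : 1 <= INR (S k)) by (rewrite S_INR; assert (Q := pos_INR k); lra).
assert (Eb : beta (S k) = r ^ S k * (e (S k) / INR (S k))) by (unfold beta; field; lra).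
assert (L : 2 - / INR (S k) <= e (S k) / INR (S k)).
  apply Rmult_le_reg_r with (INR (S k)); [lra|].
  replace (e (S k) / INR (S k) * INR (S k)) with (e (S k)) by (field; lra).
  replace ((2 - / INR (S k)) * INR (S k)) with (2 * INR (S k) - 1) by (field; lra).
  easy.
assert (/ INR (S k) <= 1) by (rewrite -Rinv_1; apply Rinv_le_contravar; lra).
rewrite Eb; split; [apply Rmult_le_compat_l; lra|].
rewrite -{1}(Rmult_1_r (r ^ S k)); apply Rmult_le_compat_l; lra.
Qed.

Lemma beta_ge0 k : 0 <= beta k.
Proof.
destruct (beta_ge k) as [[_ H]|H]; [assert (P := r_pow_pos k); lra|].
rewrite H; unfold beta; rewrite e0; simpl; unfold Rdiv; lra.
Qed.

Lemma cos_loss_le y : cos_loss K beta y <= 247 / 100 * y ^ 2 / x ^ 3.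
Proof.
apply Rle_trans with (y ^ 2 / 2 * moment K e x 1).
  unfold cos_loss, moment; rewrite scal_sum; apply sum_Rle; intros k _.
  replace (INR k ^ 1 * e k * exp (- x) ^ k * (y ^ 2 / 2))
    with (INR k * (e k * r ^ k) * (y ^ 2 / 2)) by (unfold r; ring).
  rewrite -beta_mul.
  replace (INR k * (INR k * beta k) * (y ^ 2 / 2)) with (beta k * ((INR k * y) ^ 2 / 2)) by field.
  apply Rmult_le_compat_l; [apply beta_ge0|apply one_sub_cos_le].
assert (M := moment1_le K e x x0 moment_le).
replace (247 / 100 * y ^ 2 / x ^ 3) with (y ^ 2 / 2 * ((247 / 50) / x ^ 3)) by (field; lra).
apply Rmult_le_compat_l; [assert (0 <= y ^ 2) by apply pow2_ge_0; lra|lra].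
Qed.

(** By the saddle point equation [m y] is the sum of the [beta k (k y)]; the linear term of the
    phase disappears and terms [u - sin u] remain, lying between 0 and [u^3 / 6]. *)
Lemma phase_bounds y : 0 <= y -> 0 <= phase K beta (Z.of_nat m) y <= 13 / 5 * y ^ 3 / x ^ 4.
Proof.
intros Hy.
assert (E : phase K beta (Z.of_nat m) y
  = sum_f_R0 (fun k => beta k * (INR k * y - sin (INR k * y))) K).
  unfold phase, sin_sum; rewrite -INR_IZR_INZ -saddle; unfold moment.
  rewrite Rmult_comm scal_sum -minus_sum; apply sum_eq; intros k _.
  replace (INR k ^ 0 * e k * exp (- x) ^ k) with (e k * r ^ k) by (unfold r; ring).
  rewrite -beta_mul; ring.
assert (Hk : forall k, 0 <= INR k * y) by (intros; apply Rmult_le_pos; [apply pos_INR|easy]).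
rewrite E; split.
  apply cond_pos_sum; intros k; apply Rmult_le_pos; [apply beta_ge0|].
  apply sub_sin_bounds, Hk.
apply Rle_trans with (y ^ 3 / 6 * moment K e x 2).
  unfold moment; rewrite scal_sum; apply sum_Rle; intros k _.
  replace (INR k ^ 2 * e k * exp (- x) ^ k * (y ^ 3 / 6))
    with (INR k ^ 2 * (e k * r ^ k) * (y ^ 3 / 6)) by (unfold r; ring).
  rewrite -beta_mul.
  replace (INR k ^ 2 * (INR k * beta k) * (y ^ 3 / 6))
    with (beta k * ((INR k * y) ^ 3 / 6)) by field.
  apply Rmult_le_compat_l; [apply beta_ge0|apply sub_sin_bounds, Hk].
assert (M := moment2_le K e x x0 moment_le).
replace (13 / 5 * y ^ 3 / x ^ 4) with (y ^ 3 / 6 * ((78 / 5) / x ^ 4)) by (field; lra).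
apply Rmult_le_compat_l; [assert (0 <= y ^ 3) by now apply pow_le|]; lra.
Qed.

(** Weaker than the next bound by a factor of 2 in the main term, but free of the correction
    [y^2 / (2 x^2)], which would swamp that term far from 0. *)
Lemma geometric_loss_le_cos_loss y : geometric_loss x K y <= cos_loss K beta y.
Proof.
apply sum_Rle; intros k _; fold r.
assert (B := COS_bound (INR k * y)).
destruct (beta_ge k) as [[_ H]|H]; [apply Rmult_le_compat_r; lra|].
rewrite H; simpl; rewrite Rmult_0_l cos_0; lra.
Qed.

(** The defect [/ k] in [beta k >= r^k (2 - / k)] costs at most [r^k k y^2 / 2], because
    [1 - cos (k y) <= (k y)^2 / 2]; these costs add up to at most [y^2 / (2 x^2)]. *)
Lemma geometric_loss2_le_cos_loss y : 2 * geometric_loss x K y - y ^ 2 / (2 * x ^ 2)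
  <= cos_loss K beta y.
Proof.
assert (R0 := r_bounds x x0); fold r in R0.
assert (SS : sum_f_R0 (fun d => INR d ^ 1 * r ^ d) K <= / x ^ 2).
  eapply Rle_trans; [now apply sum_pow1_le|now apply kernel1_le].
enough (2 * geometric_loss x K y <= cos_loss K beta y
  + y ^ 2 / 2 * sum_f_R0 (fun d => INR d ^ 1 * r ^ d) K).
  assert (y ^ 2 / 2 * sum_f_R0 (fun d => INR d ^ 1 * r ^ d) K <= y ^ 2 / 2 * / x ^ 2).
    apply Rmult_le_compat_l; [assert (0 <= y ^ 2) by apply pow2_ge_0; lra|easy].
  replace (y ^ 2 / (2 * x ^ 2)) with (y ^ 2 / 2 * / x ^ 2) by (field; lra); lra.
unfold geometric_loss, cos_loss; fold r; rewrite !scal_sum -plus_sum; apply sum_Rle; intros k _.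
assert (B := COS_bound (INR k * y)); assert (P := r_pow_pos k).
assert (L := one_sub_cos_le (INR k * y)).
destruct (beta_ge k) as [[H _]|H]; last first.
  rewrite H; simpl; rewrite Rmult_0_l cos_0; lra.
destruct k as [|k]; [simpl; rewrite Rmult_0_l cos_0; lra|].
assert (k1 : 1 <= INR (S k)) by (rewrite S_INR; assert (Q := pos_INR k); lra).
set (n := INR (S k)) in *; set (c := 1 - cos (n * y)) in *.
assert (c0 : 0 <= c) by (unfold c; lra).
assert (A : r ^ S k * (2 - / n) * c <= beta (S k) * c) by (apply Rmult_le_compat_r; lra).
assert (A2 : r ^ S k * (/ n * c) <= r ^ S k * (n * y ^ 2 / 2)).
  apply Rmult_le_compat_l; [lra|].
  apply Rle_trans with (/ n * ((n * y) ^ 2 / 2)).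
    apply Rmult_le_compat_l; [apply Rlt_le, Rinv_0_lt_compat|]; lra.
  right; field; lra.
replace (n ^ 1 * r ^ S k * (y ^ 2 / 2)) with (r ^ S k * (n * y ^ 2 / 2)) by (simpl; field).
lra.
Qed.

Lemma weight_le_near y : 0 <= y <= (61 / 1000) ->
  weight K beta y <= exp (- ((999 / 500) / x * (y ^ 2 / (x ^ 2
    + y ^ 2)) - y ^ 2 / (2 * x ^ 2)) + (1 / 5000)).
Proof.
intros Hy; apply exp_le.
assert (A := geometric_loss2_le_cos_loss y); assert (B := geometric_loss_ge x K x0 y r_small).
assert (C := kernel_ratio_ge x x0 y x_le Hy).
set (W := 2 * (1 - cos y) / (coshm x + 2 * (1 - cos y))) in *.
assert (ix : 0 < / x) by now apply Rinv_0_lt_compat.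
assert (D : / x * (999 / 1000 * (y ^ 2 / (x ^ 2 + y ^ 2))) <= / x * W)
  by (apply Rmult_le_compat_l; lra).
replace ((999 / 500) / x * (y ^ 2 / (x ^ 2 + y ^ 2)))
  with (2 * (/ x * (999 / 1000 * (y ^ 2 / (x ^ 2 + y ^ 2)))))
  by (set (q := y ^ 2 / _); field; lra).
lra.
Qed.

(** The ratio increases with [1 - cos y], so it suffices to evaluate it at [3 x], where
    [y^2 / (x^2 + y^2)] is 9/10. *)
Lemma weight_le_far y : 3 * x <= y <= PI -> weight K beta y
  <= exp (- ((899 / 1000) / x) + (1 / 10000)).
Proof.
intros Hy; apply exp_le.
assert (A := geometric_loss_le_cos_loss y); assert (B := geometric_loss_ge x K x0 y r_small).
assert (C := kernel_ratio_ge x x0 (3 * x) x_le ltac:(lra)).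
assert (ix : 0 < / x) by now apply Rinv_0_lt_compat.
assert (M : cos y <= cos (3 * x)) by (apply cos_decr_1; lra).
assert (BC := COS_bound (3 * x)); assert (BC' := COS_bound y).
assert (A' := coshm_ge x ltac:(lra)).
assert (X2 : 0 < x ^ 2) by now apply pow_lt.
assert (X4 : 0 < x ^ 4) by now apply pow_lt.
assert (X6 : 0 < x ^ 6) by now apply pow_lt.
assert (N : 2 * (1 - cos (3 * x)) / (coshm x + 2 * (1 - cos (3 * x)))
  <= 2 * (1 - cos y) / (coshm x + 2 * (1 - cos y))).
  set (s := 2 * (1 - cos (3 * x))) in *; set (t := 2 * (1 - cos y)) in *.
  assert (st : 0 <= s <= t) by (unfold s, t; lra).
  apply Rmult_le_reg_r with ((coshm x + s) * (coshm x + t)); [apply Rmult_lt_0_compat; lra|].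
  replace (s / (coshm x + s) * ((coshm x + s) * (coshm x + t))) with (s * (coshm x + t))
    by (field; lra).
  replace (t / (coshm x + t) * ((coshm x + s) * (coshm x + t))) with (t * (coshm x + s))
    by (field; lra).
  nra.
replace ((3 * x) ^ 2 / (x ^ 2 + (3 * x) ^ 2)) with (9 / 10) in C by (field; lra).
set (W := 2 * (1 - cos y) / (coshm x + 2 * (1 - cos y))) in *.
assert (D : / x * (899 / 1000) <= / x * W) by (apply Rmult_le_compat_l; lra).
unfold Rdiv in *; lra.
Qed.

Lemma laguerre_coef_pos :
  let c := fourier_coef K beta in let m := Z.of_nat m in
  0 < 3 * c m ^ 2 - 4 * c (m - 1)%Z * c (m + 1)%Z + c (m - 2)%Z * c (m + 2)%Z.
Proof.
cbv zeta; rewrite laguerre_fourier.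
apply Rmult_lt_0_compat; [lra|].
set (h := sqrt x).
assert (h0 : 0 < h) by now apply sqrt_lt_R0.
assert (h2 : h ^ 2 = x) by (unfold h; rewrite -Rsqr_pow2 Rsqr_sqrt; lra).
assert (h4 : h ^ 4 = x ^ 2) by (rewrite -h2; ring).
assert (h6 : h ^ 6 = x ^ 3) by (rewrite -h2; ring).
assert (h8 : h ^ 8 = x ^ 4) by (rewrite -h2; ring).
apply (quadratic_form_pos (weight K beta) (phase K beta (Z.of_nat m)) h).
- intros; apply weight_continuous.
- intros; apply phase_continuous.
- intros; apply Rlt_le, exp_pos.
- easy.
- rewrite h2; lra.
- intros y _; rewrite h6; apply exp_le; assert (H := cos_loss_le y); lra.
- intros y Hy; rewrite h8; now apply phase_bounds.
- intros y Hy; rewrite h2 h4; assert (H := weight_le_near y); now apply H.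
- intros y Hy; rewrite h2 in Hy *; assert (H := weight_le_far y); now apply H.
Qed.

End Pointwise.

(** * The inequality for large indices *)

Section Saddle.
Variables (e g : nat -> R).
Hypothesis e0 : e 0%nat = 0.
Hypothesis e_ge : forall k, (1 <= k)%nat -> 2 * INR k - 1 <= e k.
Hypothesis moment_le : forall K x p, moment K e x p
  <= 2 * sum_f_R0 (fun j => if Nat.odd j then
       INR j ^ p * sum_f_R0 (fun d => INR d ^ S p * (exp (- x) ^ j) ^ d) K else 0) K.
Hypothesis g0 : g 0%nat = 1.
Hypothesis g_rec : forall n, INR n * g n = sum_f_R0 (fun k => e k * g (n - k)%nat) n.

(** By Bernoulli's inequality [q^k >= 1/2] for [k <= 2 m], and [e k >= 1] for [k >= 1], so the terms
    up to [2 m] already reach [m]. This keeps the saddle point at distance at least [1 / (4 m)] from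
    1. *)
Lemma saddle_sum_ge (m K : nat) : (1 <= m)%nat -> (2 * m <= K)%nat ->
  INR m <= sum_f_R0 (fun k => e k * (1 - / (4 * INR m)) ^ k) K.
Proof.
intros m1 HK.
assert (M1 : 1 <= INR m) by (apply (le_INR 1); lia).
set (q := 1 - / (4 * INR m)).
assert (iq : 0 < / (4 * INR m) <= 1).
  split; [apply Rinv_0_lt_compat; lra|].
  rewrite -Rinv_1; apply Rinv_le_contravar; lra.
assert (q0 : 0 <= q < 1) by (unfold q; lra).
assert (P : forall k, 1 - INR k * / (4 * INR m) <= q ^ k).
  induction k as [|k IH]; [simpl; lra|].
  rewrite S_INR -tech_pow_Rmult.
  assert (K0 := pos_INR k).
  assert (q * (1 - INR k * / (4 * INR m)) <= q * q ^ k) by (apply Rmult_le_compat_l; lra).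
  unfold q in *; set (t := / (4 * INR m)) in *.
  assert (0 <= INR k * t * t) by (repeat apply Rmult_le_pos; lra).
  nra.
assert (T : forall k, (0 <= e k * q ^ k)).
  intros [|k]; [rewrite e0; lra|].
  apply Rmult_le_pos; [|apply pow_le; lra].
  assert (H := e_ge (S k) ltac:(lia)).
  assert (1 <= INR (S k)) by (apply (le_INR 1); lia); lra.
assert (H : forall n, (n <= 2 * m)%nat -> INR n / 2 <= sum_f_R0 (fun k => e k * q ^ k) n).
  induction n as [|n IH]; intros Hn; [simpl; rewrite e0; lra|].
  rewrite tech5 S_INR.
  assert (1 / 2 <= e (S n) * q ^ S n); [|specialize (IH ltac:(lia)); lra].
  assert (E := e_ge (S n) ltac:(lia)).
  assert (1 <= INR (S n) <= 2 * INR m).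
    split; [apply (le_INR 1); lia|].
    change 2 with (INR 2); rewrite -mult_INR; apply le_INR; lia.
  assert (Q := P (S n)).
  assert (INR (S n) * / (4 * INR m) <= 2 * INR m * / (4 * INR m))
    by (apply Rmult_le_compat_r; lra).
  replace (2 * INR m * / (4 * INR m)) with (1 / 2) in * by (field; lra).
  replace (1 / 2) with (1 * (1 / 2)) by ring; apply Rmult_le_compat; lra.
apply Rle_trans with (sum_f_R0 (fun k => e k * q ^ k) (2 * m)).
  specialize (H (2 * m)%nat (Nat.le_refl _)); replace (INR (2 * m)) with (2 * INR m) in H
    by (rewrite mult_INR; simpl; ring); lra.
clear -HK T; induction HK as [|N HK IH]; [lra|].
rewrite tech5; specialize (T (S N)); lra.
Qed.

Lemma saddle_exists (m K : nat) : (1 <= m)%nat -> (2 * m <= K)%nat ->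
  exists x, 0 < x /\ moment K e x 0 = INR m /\ exp (- x) <= 1 - / (4 * INR m).
Proof.
intros m1 HK.
assert (M1 : 1 <= INR m) by (apply (le_INR 1); lia).
set (f r := sum_f_R0 (fun k => e k * r ^ k) K - INR m).
assert (Cf : continuity f).
  intros r; apply continuity_pt_filterlim.
  apply (continuous_minus (V := R_NormedModule) (fun r => sum_f_R0 (fun k => e k * r ^ k) K));
    [|apply continuous_const].
  apply (continuous_sum_f_R0 (fun k r => e k * r ^ k)); intros k.
  apply continuous_of_ex_derive; intros; auto_derive; easy.
set (q := 1 - / (4 * INR m)).
assert (iq : 0 < / (4 * INR m) <= 1 / 4).
  split; [apply Rinv_0_lt_compat; lra|].
  apply Rle_trans with (/ 4); [apply Rinv_le_contravar|]; lra.
assert (f0 : f 0 = - INR m).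
  unfold f; rewrite (sum_eq _ (fun _ => 0)) ?sum_eq_R0; [ring|easy|].
  intros [|k] _; [rewrite e0; ring|simpl; ring].
assert (fq : 0 <= f q) by (assert (H := saddle_sum_ge m K m1 HK); unfold f, q; lra).
destruct (IVT_cor f 0 q Cf) as [r [Hr Er]]; [unfold q; lra|rewrite f0; nra|].
assert (r0 : 0 < r).
  destruct (Rle_lt_or_eq_dec 0 r) as [L|L]; [lra|easy|].
  rewrite -L f0 in Er; lra.
exists (- ln r); rewrite Ropp_involutive exp_ln //.
repeat split.
- rewrite -ln_1; enough (ln r < ln 1) by (rewrite ln_1 in H *; lra).
  apply ln_increasing; [easy|unfold q in Hr; lra].
- unfold moment; rewrite Ropp_involutive exp_ln //; unfold f in Er.
  apply Rminus_diag_uniq; rewrite -Er; f_equal; apply sum_eq; intros; simpl; ring.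
- apply Hr.
Qed.

(** The cut at [m^3] gives [K x >= m^2 / 4]; then [exp t >= t^2 / 2] suffices, because
    [m^3 d^2 >= m / 16 >= 375]. *)
Lemma pow_truncation_small (m K : nat) x : 6000 <= INR m -> INR m ^ 3 <= INR K ->
  exp (- x) <= 1 - / (4 * INR m) -> exp (- x) ^ K <= 3 / 100000 * (1 - exp (- x)) ^ 2.
Proof.
intros Hm HK Hx.
set (r := exp (- x)) in *; set (d := 1 - r).
assert (iq : 0 < / (4 * INR m)) by (apply Rinv_0_lt_compat; lra).
assert (Hd : / (4 * INR m) <= d) by (unfold d; lra).
assert (xd : d <= x) by (assert (H := exp_ineq1_le (- x)); fold r in H; unfold d; lra).
assert (m3 : 0 < INR m ^ 3) by (apply pow_lt; lra).
assert (Er : r ^ K = / exp (INR K * x)).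
  unfold r; rewrite -exp_pow -exp_Ropp; f_equal; ring.
set (t := INR m ^ 3 * d).
assert (t0 : 0 < t) by (apply Rmult_lt_0_compat; lra).
assert (tK : t <= INR K * x) by (apply Rmult_le_compat; lra).
assert (E : t ^ 2 / 2 <= exp (INR K * x)).
  apply Rle_trans with (exp t); [|now apply exp_le].
  assert (H := exp_taylor4 t ltac:(lra)).
  assert (0 <= t ^ 3) by (apply pow_le; lra); assert (0 <= t ^ 4) by (apply pow_le; lra); lra.
assert (t2 : 0 < t ^ 2) by now apply pow_lt.
rewrite Er; apply Rle_trans with (/ (t ^ 2 / 2)); [apply Rinv_le_contravar; lra|].
apply Rmult_le_reg_r with (t ^ 2 / 2); [lra|]; rewrite Rinv_l; [|lra].
fold d.
assert (B : INR m / 16 <= INR m ^ 3 * d ^ 2).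
  replace (INR m / 16) with (INR m ^ 3 * (/ (4 * INR m)) ^ 2) by (field; lra).
  apply Rmult_le_compat_l; [lra|apply pow_incr; lra].
replace (3 / 100000 * d ^ 2 * (t ^ 2 / 2)) with (3 / 200000 * (INR m ^ 3 * d ^ 2) ^ 2)
  by (unfold t; field).
assert (375 ^ 2 <= (INR m ^ 3 * d ^ 2) ^ 2) by (apply pow_incr; lra).
lra.
Qed.

Theorem laguerre_large (m : nat) : (6000 <= INR m)%R ->
  0 < 3 * g m ^ 2 - 4 * g (m - 1)%nat * g (m + 1)%nat + g (m - 2)%nat * g (m + 2)%nat.
Proof.
intros Hm.
assert (m2 : (3 <= m)%nat) by (apply INR_le; simpl; lra).
set (K := (m ^ 3)%nat).
assert (HK : (m + 2 <= K)%nat) by (unfold K; simpl; nia).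
assert (HK2 : (2 * m <= K)%nat) by (unfold K; simpl; nia).
destruct (saddle_exists m K ltac:(lia) HK2) as [x [x0 [Hs Hx]]].
assert (R0 := exp_opp_in01 x x0).
(* From [m x^2 <= 247/100]: 203/10000 is the square root of 247/600000, rounded up. *)
assert (x1 : x <= 203 / 10000).
  assert (M := moment0_le K e x x0 (moment_le K x)); rewrite Hs in M.
  destruct (Rle_lt_dec x (203 / 10000)) as [L|L]; [easy|].
  assert ((203 / 10000) ^ 2 <= x ^ 2) by (apply pow_incr; lra).
  assert (X2 : 0 < x ^ 2) by (apply pow_lt; lra).
  assert (247 / 100 / x ^ 2 * x ^ 2 = 247 / 100) by (field; lra).
  assert (6000 * x ^ 2 <= 247 / 100 / x ^ 2 * x ^ 2) by (apply Rmult_le_compat_r; lra).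
  lra.
assert (Hr : exp (- x) ^ K <= 3 / 100000 * (1 - exp (- x)) ^ 2).
  apply (pow_truncation_small m); [easy|unfold K; rewrite pow_INR; lra|easy].
assert (L := laguerre_coef_pos K e x m x0 x1 e0 e_ge (moment_le K x) Hs Hr); cbv zeta in L.
set (c := fourier_coef K (beta e x)) in *.
assert (Hc : forall n, (n <= K)%nat -> c (Z.of_nat n) = c 0%Z * exp (- x) ^ n * g n).
  apply (fourier_coef_eq K e (beta e x) g); [|easy|easy].
  intros k; now apply beta_mul.
replace (Z.of_nat m - 1)%Z with (Z.of_nat (m - 1)) in L by lia.
replace (Z.of_nat m - 2)%Z with (Z.of_nat (m - 2)) in L by lia.
replace (Z.of_nat m + 1)%Z with (Z.of_nat (m + 1)) in L by lia.
replace (Z.of_nat m + 2)%Z with (Z.of_nat (m + 2)) in L by lia.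
rewrite !Hc in L; try lia.
set (r := exp (- x)) in *.
assert (E1 : r ^ (m - 1) * r ^ (m + 1) = r ^ m * r ^ m) by (rewrite -!pow_add; f_equal; lia).
assert (E2 : r ^ (m - 2) * r ^ (m + 2) = r ^ m * r ^ m) by (rewrite -!pow_add; f_equal; lia).
set (Lg := 3 * g m ^ 2 - 4 * g (m - 1)%nat * g (m + 1)%nat + g (m - 2)%nat * g (m + 2)%nat).
replace (3 * (c 0%Z * r ^ m * g m) ^ 2 -
  4 * (c 0%Z * r ^ (m - 1) * g (m - 1)%nat) * (c 0%Z * r ^ (m + 1) * g (m + 1)%nat) +
  c 0%Z * r ^ (m - 2) * g (m - 2)%nat * (c 0%Z * r ^ (m + 2) * g (m + 2)%nat))
  with ((c 0%Z * r ^ m) ^ 2 * Lg) in L; last first.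
  unfold Lg.
  transitivity (3 * (c 0%Z * r ^ m * g m) ^ 2
    - 4 * c 0%Z ^ 2 * (r ^ (m - 1) * r ^ (m + 1)) * (g (m - 1)%nat * g (m + 1)%nat)
    + c 0%Z ^ 2 * (r ^ (m - 2) * r ^ (m + 2)) * (g (m - 2)%nat * g (m + 2)%nat)); [|ring].
  rewrite E1 E2; ring.
(* [L] now says that a square times [Lg] is positive, which excludes [Lg <= 0]. *)
destruct (Rlt_le_dec 0 Lg) as [P|P]; [easy|].
assert (0 <= (c 0%Z * r ^ m) ^ 2) by apply pow2_ge_0.
nra.
Qed.

End Saddle.

End Analysis.

Import ZArith FMapPositive.
From mathcomp Require Import all_boot all_order all_algebra.
From mathcomp Require Import zify ring ssrZ.
Set Implicit Arguments.
Unset Strict Implicit.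
Unset Printing Implicit Defensive.

(** * Counting overpartitions *)

(** In a non-increasing sequence equal parts are adjacent, so an overlined part is a first
    occurrence exactly when it is strictly smaller than its predecessor: a condition on neighbours
    only. *)
Definition over_rel (x y : nat * bool) := (y.1 < x.1) || ((y.1 == x.1) && ~~ y.2).

(** The virtual predecessor [(m, false)] makes these the continuations after a part [m]: parts are
    at most [m], and one equal to [m] is not overlined. Removing the first part stays within the
    family. *)
Definition overpart (m n : nat) (s : seq (nat * bool)) :=
  [&& path over_rel (m, false) s, all (fun p => 0 < p) (unzip1 s) & sumn (unzip1 s) == n].

Lemma nth_unzip1 s i : nth 0 (unzip1 s) i = (nth (0, false) s i).1.
Proof. by elim: s i => [|x s IH] [|i] //=; rewrite ?nth_nil. Qed.

Lemma nth_unzip2 (s : seq (nat * bool)) i :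
  nth false (unzip2 s) i = (nth (0, false) s i).2.
Proof. by elim: s i => [|x s IH] [|i] //=; rewrite ?nth_nil. Qed.

Lemma sorted_over_rel s :
  sorted over_rel s = sorted geq (unzip1 s)
  && [forall i : 'I_(size s), nth false (unzip2 s) i
       ==> (index (nth 0 (unzip1 s) i) (unzip1 s) == i)].
Proof.
have sz : size (unzip1 s) = size s by rewrite size_map.
apply/(sortedP (0, false))/andP => [H | [/(sortedP 0) H1 /forallP H2] i lt_i].
- have Hgeq : sorted geq (unzip1 s).
    apply/(sortedP 0) => i; rewrite sz => /H; rewrite !nth_unzip1 /over_rel /geq /=.
    by case/orP => [/ltnW //|/andP[/eqP -> _]].
  split=> //; apply/forallP => -[i lt_i] /=; apply/implyP; rewrite nth_unzip2 => flag_i.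
  have le_idx : index (nth 0 (unzip1 s) i) (unzip1 s) <= i by rewrite index_nth ?sz.
  rewrite eqn_leq le_idx leqNgt; apply/negP => lt_idx.
  case: i lt_i flag_i le_idx lt_idx => // i lt_i flag_i _; rewrite ltnS => le_idx.
  set j := index _ _ in le_idx.
  have in_s : nth 0 (unzip1 s) i.+1 \in unzip1 s by rewrite mem_nth ?sz.
  have Ej : nth 0 (unzip1 s) j = nth 0 (unzip1 s) i.+1 by rewrite nth_index.
  have geq_trans : transitive geq by move=> a b c /= ab bc; apply: leq_trans bc ab.
  have mono a b : a <= b -> b < size s -> nth 0 (unzip1 s) b <= nth 0 (unzip1 s) a.
    move=> ab lt_b.
    have := sorted_leq_nth geq_trans leqnn 0 Hgeq.
    by apply; rewrite ?inE ?sz //; apply: leq_ltn_trans ab lt_b.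
  have := H i lt_i; rewrite /over_rel flag_i andbF orbF -!nth_unzip1 -Ej ltnNge.
  by rewrite (mono _ _ le_idx) // (leq_trans _ lt_i).
- have := H1 i; rewrite sz => /(_ lt_i); rewrite /geq /= !nth_unzip1 => le_i.
  rewrite /over_rel; case: ltngtP le_i => // eq_i _ /=.
  have := H2 (Ordinal lt_i) => /=; rewrite nth_unzip2; case: (nth _ s i.+1).2 => //=.
  have : index (nth 0 (unzip1 s) i) (unzip1 s) <= i by rewrite index_nth // sz ltnW.
  by rewrite !nth_unzip1 eq_i => le_idx /eqP E; rewrite E ltnn in le_idx.
Qed.

Lemma is_overpartitionE M n s : n < M -> is_overpartition n s = overpart M n s.
Proof.
move=> lt_nM; rewrite /is_overpartition /overpart.
rewrite [RHS]andbCA.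
have -> : path over_rel (M, false) s && (sumn (unzip1 s) == n)
        = sorted over_rel s && (sumn (unzip1 s) == n).
  case: s => [|x s] //=; case: eqP => [sum_s|]; rewrite ?andbF ?andbT //.
  by rewrite /over_rel /= (leq_ltn_trans _ lt_nM) // -sum_s leq_addr.
rewrite sorted_over_rel.
by case: (sorted _ _); case: (all _ _); case: (_ == _); rewrite ?andbT ?andbF.
Qed.

Definition flagged_upto n := [seq (k, b) | k <- iota 1 n, b <- [:: false; true]].

Lemma mem_flagged_upto n x : (x \in flagged_upto n) = (0 < x.1 <= n).
Proof.
apply/allpairsPdep/idP => [[k [b [k_in _ ->]]]|x_in].
  by move: k_in; rewrite mem_iota add1n ltnS.
exists x.1, x.2; split; last by case: x {x_in}.
  by rewrite mem_iota add1n ltnS.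
by case: x.2; rewrite !inE.
Qed.

Lemma flagged_upto_uniq n : uniq (flagged_upto n).
Proof.
apply: allpairs_uniq; rewrite ?iota_uniq //.
by move=> [a b] [c d] _ _ [-> ->].
Qed.

Fixpoint over_enum (f m n : nat) : seq (seq (nat * bool)) :=
  if n == 0 then [:: [::]] else
  if f is f'.+1 then
    [seq x :: s | x <- [seq x <- flagged_upto n | over_rel (m, false) x],
                  s <- over_enum f' x.1 (n - x.1)]
  else [::].

Lemma path_over_rel (x : nat * bool) s : path over_rel x s = path over_rel (x.1, false) s.
Proof. by case: s. Qed.

Lemma mem_over_enum f m n s : n <= f -> (s \in over_enum f m n) = overpart m n s.
Proof.
elim: f m n s => [|f IH] m n s.
  rewrite leqn0 => /eqP ->; rewrite /overpart /= inE.
  case: s => [|x s] //=; rewrite addn_eq0; case: x.1 => [|k]; rewrite ?andbF //=.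
move=> le_nf /=; case: eqP => [->|/eqP n0].
  rewrite /overpart /= inE.
  by case: s => [|x s] //=; rewrite addn_eq0; case: x.1 => [|k]; rewrite ?andbF //=.
apply/allpairsPdep/idP => [[x [t [x_in t_in ->]]]|].
  move: x_in; rewrite mem_filter mem_flagged_upto => /andP[Rx kn].
  have lt0 : n - x.1 <= f.
    by case/andP: kn => k0 _; rewrite leq_subLR (leq_trans le_nf) // -add1n leq_add2r.
  move: t_in; rewrite IH //.
  rewrite /overpart -path_over_rel => /and3P[pt pos /eqP sum_t] /=.
  by case/andP: kn => k0 kn; rewrite Rx pt k0 pos sum_t subnKC /=.
case: s => [|x t]; first by rewrite /overpart /= eq_sym (negbTE n0).
case/and3P => /= /andP[Rx pt] /andP[x0 pos] /eqP sum_s.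
exists x, t; split=> //.
  by rewrite mem_filter Rx mem_flagged_upto x0 -sum_s leq_addr.
rewrite IH; last first.
  by rewrite leq_subLR (leq_trans le_nf) // -add1n leq_add2r.
by rewrite /overpart -path_over_rel pt pos -sum_s addKn /=.
Qed.

Lemma over_enum_uniq f m n : uniq (over_enum f m n).
Proof.
elim: f m n => [|f IH] m n /=; case: eqP => // _.
apply: allpairs_uniq_dep => //.
- exact/filter_uniq/flagged_upto_uniq.
- by move=> [x s] [y t] _ _ /= [-> ->].
Qed.

Definition overcount m n := size (over_enum n m n).

Lemma overcountE f m n : n <= f -> size (over_enum f m n) = overcount m n.
Proof.
move=> le_nf; apply/perm_size/uniq_perm; rewrite ?over_enum_uniq //.
by move=> s; rewrite !mem_over_enum.
Qed.

Lemma pbar_overcount M n : n < M -> pbar n = overcount M n.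
Proof.
move=> lt_nM; rewrite /pbar cardE -(size_map (@flagged_parts n)).
apply/perm_size/uniq_perm; rewrite ?over_enum_uniq ?map_inj_uniq ?enum_uniq //.
  exact: flagged_parts_inj.
move=> s; rewrite mem_over_enum // -(is_overpartitionE _ lt_nM).
apply/mapP/idP => [[t]|Hs]; first by rewrite mem_enum inE => Ht ->.
have [t Et] := overpartition_flagged_parts Hs.
by exists t; rewrite // mem_enum inE Et.
Qed.

Lemma overcount0 m : overcount m 0 = 1. Proof. by []. Qed.

Lemma overcount_sum m n : 0 < n ->
  overcount m n = \sum_(1 <= k < n.+1) ((k <= m) + (k < m)) * overcount k (n - k).
Proof.
case: n => // n _.
have -> : overcount m n.+1 = \sum_(x <- flagged_upto n.+1 | over_rel (m, false) x)
    overcount x.1 (n.+1 - x.1).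
  rewrite /overcount -(big_filter _ (over_rel (m, false))) -[LHS]/(size [seq x :: s
    | x <- [seq x <- flagged_upto n.+1 | over_rel (m, false) x],
      s <- over_enum n x.1 (n.+1 - x.1)]).
  rewrite size_allpairs_dep sumnE big_map big_seq [RHS]big_seq; apply: eq_bigr => x.
  rewrite mem_filter mem_flagged_upto => /and3P[_ x0 _]; rewrite overcountE //.
  by rewrite leq_subLR -add1n leq_add2r.
rewrite big_mkcond big_allpairs_dep /=.
rewrite /index_iota subSS subn0; apply: eq_bigr => k _.
rewrite !big_cons big_nil /= /over_rel /= andbT andbF orbF.
by case: ltngtP => km /=; rewrite ?addn0 ?mul0n ?mul1n ?mul2n ?addnn.
Qed.

(** The multiplicities in [overcount_sum] for [m.+1] and [m] differ by 1 exactly at [k = m] and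
    [k = m.+1]. *)
Lemma overcount_rec m n :
  overcount m.+1 n = overcount m n
    + (if (0 < m <= n) then overcount m (n - m) else 0)
    + (if m < n then overcount m.+1 (n - m.+1) else 0).
Proof.
case: n => [|n]; first by rewrite !overcount0; case: m.
rewrite (@overcount_sum m.+1 n.+1) // (@overcount_sum m n.+1) //.
have pick a : \sum_(1 <= k < n.+2) (k == a) * overcount k (n.+1 - k)
    = if 0 < a <= n.+1 then overcount a (n.+1 - a) else 0.
  have [a_in|a_out] := boolP (0 < a <= n.+1).
    rewrite (bigD1_seq a) ?iota_uniq ?mem_index_iota //= eqxx mul1n.
    rewrite big1 ?addn0 // => k /negbTE ->; exact: mul0n.
  rewrite big_seq big1 // => k; rewrite mem_index_iota.
  by case: eqP => [->|_ _]; rewrite ?mul0n // ltnS (negbTE a_out).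
have -> : (if m < n.+1 then overcount m.+1 (n.+1 - m.+1) else 0)
  = if 0 < m.+1 <= n.+1 then overcount m.+1 (n.+1 - m.+1) else 0 by [].
rewrite -!pick -!big_split /=; apply: eq_bigr => k _.
rewrite -!mulnDl; congr (_ * _); lia.
Qed.

Import GRing.Theory.
Local Open Scope ring_scope.

(** * Generating functions modulo a power of X *)

Section Gauss.
Variables (R : comNzRingType) (x : R).

Definition up_prod (a b : nat) (s : R) : R := \prod_(a <= k < b) (1 - s * x ^+ k).

Lemma up_prod_recr a b s : (a <= b)%N ->
  up_prod a b.+1 s = up_prod a b s * (1 - s * x ^+ b).
Proof. by move=> ab; rewrite /up_prod big_nat_recr. Qed.

Lemma up_prod_recl a b s : (a < b)%N ->
  up_prod a b s = (1 - s * x ^+ a) * up_prod a.+1 b s.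
Proof. by move=> ab; rewrite /up_prod big_ltn. Qed.

Definition theta4 (n : nat) : R := 1 + 2 * \sum_(1 <= k < n.+1) (-1) ^+ k * x ^+ (k ^ 2).

(* A finite form of Gauss's identity for [theta4]; the induction step telescopes. *)
Lemma gauss_finite n : up_prod 1 n.+1 (-1) * theta4 n
  = up_prod 1 n.+1 1 + 2 * \sum_(1 <= s < n.+1)
      (-1) ^+ s * (x ^+ (s * n.+1) * up_prod 1 s (-1) * up_prod s.+1 n.+1 1).
Proof.
elim: n => [|n IH].
  by rewrite /theta4 !big_geq // mulr0 !addr0 mulr1 /up_prod !big_geq.
(* Passing from [n] to [n.+1] multiplies each summand by [1 + x ^+ n.+1] up to [u s + u s.+1]. Of
   the boundary terms, [u 1] turns the factor [1 - x ^+ n.+1] of the product into [1 + x ^+ n.+1],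
   and [u n.+1] joins the last summand to form the new term of [theta4]. *)
pose u s := x ^+ (s * n.+1) * up_prod 1 s (-1) * up_prod s n.+1 1.
have tele : \sum_(1 <= s < n.+1) (-1) ^+ s * (u s + u s.+1)
    = - u 1%N + (-1) ^+ n * u n.+1.
  rewrite (eq_bigr (fun s => (- ((-1) ^+ s.+1 * u s.+1)) - (- ((-1) ^+ s * u s)))); last first.
    by move=> s _; rewrite exprS; ring.
  rewrite telescope_sumr // exprS expr1; ring.
have step s : (1 <= s < n.+1)%N ->
    (1 + x ^+ n.+1) * (x ^+ (s * n.+1) * up_prod 1 s (-1) * up_prod s.+1 n.+1 1)
    = x ^+ (s * n.+2) * up_prod 1 s (-1) * up_prod s.+1 n.+2 1 + (u s + u s.+1).
  case/andP=> s1 sn; rewrite /u (@up_prod_recr s.+1 n.+1) // (@up_prod_recr 1 s) //.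
  rewrite (@up_prod_recl s n.+1) //.
  rewrite (mulnS s n.+1) (mulSn s n.+1) !exprD; ring.
rewrite (@up_prod_recr 1 n.+1) // (@up_prod_recr 1 n.+1 1) //.
have -> : theta4 n.+1 = theta4 n + 2 * ((-1) ^+ n.+1 * x ^+ (n.+1 ^ 2)).
  by rewrite /theta4 big_nat_recr //=; ring.
rewrite [in RHS]big_nat_recr //=.
have -> : \sum_(1 <= s < n.+1) (-1) ^+ s * (x ^+ (s * n.+2) * up_prod 1 s (-1) * up_prod s.+1
  n.+2 1)
  = (1 + x ^+ n.+1) * (\sum_(1 <= s < n.+1)
      (-1) ^+ s * (x ^+ (s * n.+1) * up_prod 1 s (-1) * up_prod s.+1 n.+1 1))
    - (- u 1%N + (-1) ^+ n * u n.+1).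
  rewrite -tele big_distrr /= -sumrB big_nat [RHS]big_nat; apply: eq_bigr => s sn.
  have -> : x ^+ (s * n.+2) * up_prod 1 s (-1) * up_prod s.+1 n.+2 1
    = (1 + x ^+ n.+1) * (x ^+ (s * n.+1) * up_prod 1 s (-1) * up_prod s.+1 n.+1 1)
      - (u s + u s.+1) by rewrite (step s sn); ring.
  ring.
have -> : up_prod n.+2 n.+2 1 = 1 by rewrite /up_prod big_geq.
have u1 : u 1%N = x ^+ n.+1 * up_prod 1 n.+1 1.
  by rewrite /u mul1n [up_prod 1 1 _]/up_prod big_geq // mulr1.
have un : u n.+1 = x ^+ (n.+1 * n.+1) * up_prod 1 n.+1 (-1).
  by rewrite /u [up_prod n.+1 _ _]/up_prod big_geq // mulr1.
rewrite u1 un -mulnn (mulnS n.+1 n.+1) !exprD.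
set S := \sum_(_ <= _ < _) _; set t := theta4 n in IH *.
set P := up_prod 1 n.+1 (-1) in IH *; set Q := up_prod 1 n.+1 1 in IH *.
set y := x ^+ n.+1; set z := x ^+ (n.+1 * n.+1).
rewrite -[(-1) ^+ n.+1]/((-1) ^+ n.+1) exprS; set e := (-1) ^+ n.
have -> : P * (1 - -1 * y) * (t + 2 * (-1 * e * z))
  = (1 + y) * (P * t) + 2 * (-1 * e * z) * P * (1 + y) by ring.
rewrite IH -/S; ring.
Qed.

End Gauss.

(** * Congruences of integer polynomials modulo a power of X *)

Section Truncated.
Variable N : nat.
Implicit Types a b c d p q : {poly int}.

Definition eqX a b := exists c, a = b + 'X^N * c.

Lemma eqX_refl a : eqX a a. Proof. by exists 0; ring. Qed.
Lemma eqX_sym a b : eqX a b -> eqX b a.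
Proof. by case=> c ->; exists (- c); ring. Qed.
Lemma eqX_trans b a c : eqX a b -> eqX b c -> eqX a c.
Proof. by case=> u -> [v ->]; exists (u + v); ring. Qed.
Lemma eqX_mul a b c d : eqX a b -> eqX c d -> eqX (a * c) (b * d).
Proof. by case=> u -> [v ->]; exists (u * d + b * v + 'X^N * u * v); ring. Qed.
Lemma eqX_mull a c d : eqX c d -> eqX (a * c) (a * d).
Proof. by apply: eqX_mul; apply: eqX_refl. Qed.
Lemma eqX_mulr a c d : eqX c d -> eqX (c * a) (d * a).
Proof. by move/eqX_mul; apply; apply: eqX_refl. Qed.

Lemma eqX_coef a b i : eqX a b -> (i < N)%N -> a`_i = b`_i.
Proof. by case=> c -> ltiN; rewrite coefD coefXnM ltiN addr0. Qed.

Lemma coef_eqX a b : (forall i, (i < N)%N -> a`_i = b`_i) -> eqX a b.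
Proof.
move=> H; exists (drop_poly N (a - b)).
rewrite -[a in LHS](subrK b) -[a - b in LHS](poly_take_drop N).
have -> : take_poly N (a - b) = 0.
  apply/polyP => i; rewrite coef_take_poly coefB coef0.
  by case: ifP => // /H ->; rewrite subrr.
ring.
Qed.

Definition unitX a := exists b, eqX (a * b) 1.

Lemma unitX_mul a b : unitX a -> unitX b -> unitX (a * b).
Proof.
move=> [c ac] [d bd]; exists (c * d).
have := eqX_mul ac bd; rewrite mulr1; congr eqX; ring.
Qed.

Lemma unitX_cancel a p q : unitX a -> eqX (a * p) (a * q) -> eqX p q.
Proof.
case=> b ab /(eqX_mull b) H.
have E r : eqX (b * (a * r)) r.
  by have := eqX_mulr r ab; rewrite mul1r; congr eqX; ring.
exact: eqX_trans (eqX_sym (E p)) (eqX_trans H (E q)).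
Qed.

Definition geo a : {poly int} := \sum_(1 <= j < N) a ^+ j.

Lemma geo_mul a : (0 < N)%N -> (1 - a) * geo a = a - a ^+ N.
Proof.
move=> N0; rewrite /geo big_distrr /=.
rewrite (eq_bigr (fun j => - a ^+ j.+1 - - a ^+ j)); last by move=> j _; rewrite exprS; ring.
by rewrite telescope_sumr // expr1 opprK addrC.
Qed.

Lemma expXN (s : int) k : (0 < k)%N -> eqX ((s%:P * 'X^k) ^+ N) 0.
Proof.
move=> k0; exists (s%:P ^+ N * 'X^(k.-1 * N)).
rewrite exprMn -exprM add0r mulrCA -exprD -mulSn prednK //.
Qed.

(** The Euler operator: unlike the plain derivative it preserves divisibility by ['X^N], hence the
    congruence [eqX]. *)
Definition theta p := 'X * p^`().

Lemma theta_mul p q : theta (p * q) = theta p * q + p * theta q.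
Proof. by rewrite /theta derivM; ring. Qed.

Lemma thetaXn n : theta 'X^n = n%:R * 'X^n.
Proof.
rewrite /theta derivXn mulr_natl; case: n => [|n]; first by rewrite !mulr0n mulr0.
by rewrite mulrnAr -exprS.
Qed.

Lemma eqX_theta a b : eqX a b -> eqX (theta a) (theta b).
Proof.
case=> c ->; exists (N%:R * c + theta c).
have -> : theta (b + 'X^N * c) = theta b + theta ('X^N * c).
  by rewrite /theta derivD mulrDr.
by rewrite theta_mul thetaXn; ring.
Qed.

Local Notation prodX M s := (up_prod ('X : {poly int}) 1 M.+1 s%:P).

Lemma unitX_prod M (s : int) : (0 < N)%N -> unitX (prodX M s).
Proof.
move=> N0; elim: M => [|M IH].
  by rewrite /up_prod big_geq //; exists 1; rewrite mulr1; apply: eqX_refl.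
rewrite up_prod_recr //; apply: unitX_mul => //.
exists (1 + geo (s%:P * 'X^(M.+1))).
rewrite mulrDr mulr1 geo_mul //.
have [c ->] := expXN s (ltn0Sn M).
by exists (- c); ring.
Qed.

(** Logarithmic derivative: the factor [1 - s X^k] contributes [- k s X^k / (1 - s X^k)], with [geo]
    standing for the quotient. *)
Lemma theta_prod M (s : int) : (0 < N)%N ->
  eqX (theta (prodX M s))
      (- (prodX M s * \sum_(1 <= k < M.+1) k%:R * geo (s%:P * 'X^k))).
Proof.
move=> N0; elim: M => [|M IH].
  rewrite /up_prod !big_geq // mulr0 oppr0 /theta derivC mulr0; exact: eqX_refl.
rewrite up_prod_recr // theta_mul big_nat_recr //=.
set y := s%:P * 'X^(M.+1).
have -> : theta (1 - y) = - (M.+1%:R * y).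
  rewrite /theta derivB derivC sub0r mulrN -/(theta y) /y theta_mul thetaXn.
  by rewrite /theta derivC mulr0 mul0r add0r mulrCA.
case: IH => c ->; have := geo_mul y N0; have [d ->] := expXN s (ltn0Sn M).
rewrite add0r => E.
set P := up_prod _ _ _ _; set S := \sum_(_ <= _ < _) _.
exists (c * (1 - y) - P * (M.+1%:R * d)).
have Ey : M.+1%:R * y = M.+1%:R * ((1 - y) * geo y) + M.+1%:R * ('X^N * d) by rewrite E; ring.
rewrite Ey; ring.
Qed.

Definition overpoly m : {poly int} := \poly_(n < N) (overcount m n)%:Z.

Lemma overpoly_rec m :
  eqX ((1 - 1%:P * 'X^(m.+1)) * overpoly m.+1) ((1 + (0 < m)%:R * 'X^m) * overpoly m).
Proof.
apply: coef_eqX => i ltiN.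
rewrite polyC1 mul1r mulrBl mul1r mulrDl mul1r coefB coefD coefXnM.
rewrite -mulrA mulr_natl coefMn coefXnM.
rewrite !coef_poly ltiN overcount_rec.
have -> : (i - m.+1 < N)%N by lia.
have -> : (i - m < N)%N by lia.
have -> : (m < i)%N = ~~ (i < m.+1)%N by rewrite -leqNgt.
have -> : (m <= i)%N = ~~ (i < m)%N by rewrite -leqNgt.
by case: (i < m.+1)%N; case: (i < m)%N; case: m => [|m] //=; rewrite ?mulr0n ?mulr1n ?PoszD; ring.
Qed.

(** The product on the right stops at [m.-1] because [overcount m] forbids an overlined part [m]. *)
Lemma overpoly_prod m : (0 < N)%N -> eqX (prodX m 1 * overpoly m) (prodX m.-1 (-1)).
Proof.
move=> N0; elim: m => [|m IH].
  rewrite /up_prod !big_geq // mul1r; apply: coef_eqX => i ltiN.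
  rewrite coef_poly ltiN coef1; case: i ltiN => [|i] _; first by rewrite overcount0.
  by rewrite overcount_sum // big_nat big1 // => -[|k].
rewrite up_prod_recr // -mulrA.
apply: eqX_trans (eqX_mull _ (overpoly_rec m)) _.
rewrite mulrCA; apply: eqX_trans (eqX_mull _ IH) _.
case: m {IH} => [|m] /=.
  by rewrite mul0r addr0 mul1r; apply: eqX_refl.
by rewrite [X in eqX _ X]up_prod_recr // mul1r mulrC polyCN polyC1 mulN1r opprK; apply: eqX_refl.
Qed.

Definition pbarpoly : {poly int} := \poly_(n < N) (pbar n)%:Z.

Lemma pbarpoly_prod : (0 < N)%N -> eqX (prodX N 1 * pbarpoly) (prodX N (-1)).
Proof.
move=> N0.
have -> : pbarpoly = overpoly N.
  apply/polyP => i; rewrite !coef_poly; case: ifP => // ltiN.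
  by rewrite (pbar_overcount ltiN).
apply: eqX_trans (overpoly_prod N N0) _; apply: eqX_sym.
(* The missing factor is [1 + 'X^N], congruent to 1. *)
rewrite /= -{1}(prednK N0) up_prod_recr // prednK //.
by exists (up_prod 'X 1 N (-1)%:P); rewrite polyCN polyC1; ring.
Qed.

Lemma pbarpoly_theta4 : (0 < N)%N -> eqX (pbarpoly * theta4 'X N) 1.
Proof.
move=> N0; apply: (unitX_cancel (unitX_prod N (-1) N0)); rewrite mulr1.
have G : eqX (prodX N (-1) * theta4 'X N) (prodX N 1).
  rewrite polyCN polyC1 gauss_finite.
  (* Every error term of [gauss_finite] carries ['X^(s * N.+1)] with [s >= 1], so it vanishes modulo
     ['X^N]. *)
  exists (2 * \sum_(1 <= s < N.+1) (-1) ^+ s *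
    ('X^(s.-1 * N.+1 + 1) * up_prod 'X 1 s (-1) * up_prod 'X s.+1 N.+1 1)).
  congr (_ + _); rewrite mulrCA; congr (_ * _); rewrite big_distrr /=.
  rewrite big_nat [RHS]big_nat; apply: eq_bigr => s /andP[s1 _].
  have -> : (s * N.+1 = N + (s.-1 * N.+1 + 1))%N by case: s s1 => // s _; lia.
  by rewrite [in LHS]exprD; ring.
have := eqX_mull pbarpoly G; have := pbarpoly_prod N0.
rewrite [prodX N 1 * _]mulrC => H1 H2.
have -> : prodX N (-1) * (pbarpoly * theta4 'X N) = pbarpoly * (prodX N (-1) * theta4 'X N).
  by ring.
exact: eqX_trans H2 H1.
Qed.

(** At ['X^i] the difference leaves [k (1 - (-1)^j)] for each [j k = i]: twice the sum of the
    divisors with odd cofactor. *)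
Definition odd_divisor_poly : {poly int} :=
  \sum_(1 <= k < N.+1) k%:R * (geo (1%:P * 'X^k) - geo ((-1)%:P * 'X^k)).

Lemma theta_pbarpoly : (0 < N)%N -> eqX (theta pbarpoly) (pbarpoly * odd_divisor_poly).
Proof.
move=> N0; apply: (unitX_cancel (unitX_prod N 1 N0)).
have H := pbarpoly_prod N0.
have := eqX_theta H; rewrite theta_mul => Ht.
have T1 := theta_prod N 1 N0; have T2 := theta_prod N (-1) N0.
rewrite /odd_divisor_poly (eq_bigr (fun k => k%:R * geo (1%:P * 'X^k)
   - k%:R * geo ((-1)%:P * 'X^k))); last by move=> k _; rewrite mulrBr.
rewrite sumrB; move: T1 T2.
set S1 := \sum_(_ <= _ < _) _; set S2 := \sum_(_ <= _ < _) _ => T1 T2.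
move: H Ht T1 T2; set P := up_prod _ _ _ _; set Q := up_prod _ _ _ _; set A := pbarpoly.
case=> [h H] [ht Ht] [t1 T1] [t2 T2].
exists (ht - t1 * A + t2 + h * S2).
have -> : P * theta A = theta Q + 'X^N * ht - theta P * A by rewrite -Ht; ring.
rewrite T1 T2.
have -> : Q = P * A - 'X^N * h by rewrite H; ring.
ring.
Qed.

End Truncated.

(** * Recurrences *)

Definition odd_pairs (D J i : nat) : nat :=
  (\sum_(1 <= d < D) \sum_(1 <= j < J | odd j) (if j * d == i then d else 0))%N.

Definition odd_sigma i := odd_pairs i.+1 i.+1 i.

Lemma sum_nat_trunc (F : nat -> nat) i D : (i < D)%N -> (forall d, (i < d)%N -> F d = 0%N) ->
  (\sum_(1 <= d < D) F d = \sum_(1 <= d < i.+1) F d)%N.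
Proof.
move=> iD F0; rewrite (big_cat_nat (n := i.+1)) //= [X in (_ + X)%N]big_nat.
by rewrite [X in (_ + X)%N]big1 ?addn0 // => d /andP[/F0].
Qed.

Lemma odd_pairsE D J i : (i < D)%N -> (i < J)%N -> odd_pairs D J i = odd_sigma i.
Proof.
move=> iD iJ; rewrite /odd_sigma /odd_pairs (sum_nat_trunc iD); last first.
  move=> d id; rewrite big_nat_cond big1 // => j /andP[/andP[j0 _] _].
  by case: eqP => // E; nia.
rewrite big_nat [RHS]big_nat; apply: eq_bigr => d /andP[d0 _].
rewrite big_mkcond [RHS]big_mkcond (sum_nat_trunc iJ) // => j ij.
by case: ifP => // _; case: eqP => // E; nia.
Qed.

Lemma coef_geo N (s : int) k i :
  (geo N (s%:P * 'X^k))`_i = \sum_(1 <= j < N) s ^+ j * (j * k == i)%N%:R.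
Proof.
rewrite /geo coef_sum; apply: eq_bigr => j _.
by rewrite exprMn -exprM -polyC_exp coefCM coefXn mulnC eq_sym.
Qed.

Lemma coef_odd_divisor_poly N i : (i < N)%N ->
  (odd_divisor_poly N)`_i = 2 * (odd_sigma i)%:R.
Proof.
move=> iN; rewrite /odd_divisor_poly coef_sum -(@odd_pairsE N.+1 N) //; last exact: ltnW.
rewrite /odd_pairs natr_sum big_distrr /=; apply: eq_bigr => k _.
rewrite -polyC_natr coefCM coefB !coef_geo -sumrB natr_sum !big_distrr /= [RHS]big_mkcond /=.
apply: eq_bigr => j _; rewrite expr1n -mulrBl -signr_odd.
case: (odd j) => /=; last by rewrite expr0 subrr mul0r mulr0.
by case: eqP => _; rewrite ?mulr0 //= expr1; ring.
Qed.

(** The [- 1] comes from [- 'X / (1 - 'X)], the logarithmic derivative of the factor [1 - 'X] that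
    turns [pbar] into its differences; that series has no constant term. *)
Definition e_int (k : nat) : int := if k is 0 then 0 else 2 * (odd_sigma k)%:R - 1.

Definition g_int (n : nat) : int := if n is n'.+1 then (pbar n)%:R - (pbar n')%:R else 1.

Lemma pbar0 : pbar 0 = 1%N.
Proof. by rewrite (@pbar_overcount 1). Qed.

Lemma coef_geoX N i : (i < N)%N -> (geo N 'X)`_i = (0 < i)%:R.
Proof.
move=> iN; rewrite /geo coef_sum.
rewrite (eq_bigr (fun j => (j == i)%:R)); last by move=> j _; rewrite coefXn eq_sym.
case: (posnP i) => [->|i0].
  by rewrite big_nat big1 // => -[|j].
rewrite (bigD1_seq i) ?mem_index_iota ?i0 ?iota_uniq //= eqxx big1 ?addr0 //.
by move=> j /negbTE ->.
Qed.

Lemma g_int_rec n : n%:R * g_int n = \sum_(k < n.+1) e_int k * g_int (n - k).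
Proof.
have N0 : (0 < n.+1)%N by [].
pose A := pbarpoly n.+1; pose G := (1 - 'X) * A.
have coefG i : (i < n.+1)%N -> G`_i = g_int i.
  move=> iN; rewrite /G mulrBl mul1r coefB coefXM !coef_poly iN.
  case: i iN => [|i] iN /=; first by rewrite subr0 pbar0.
  by rewrite (ltnW iN) !natz.
have : eqX n.+1 (theta G) (G * (odd_divisor_poly n.+1 - geo n.+1 'X)).
  have [c Hc] := theta_pbarpoly N0.
  have Hg := geo_mul 'X N0.
  rewrite /G theta_mul Hc -/A.
  have -> : theta (1 - 'X) = - 'X by rewrite /theta derivB derivC derivX; ring.
  exists ((1 - 'X) * c - A).
  have E : G * geo n.+1 'X = A * ('X - 'X^(n.+1)) by rewrite -Hg /G; ring.
  by rewrite mulrBr E /G; ring.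
move/eqX_coef => /(_ n (ltnSn n)).
have -> : (theta G)`_n = n%:R * g_int n.
  rewrite /theta coefXM; case: n {N0} @A @G coefG => [|n] A G coefG; first by rewrite mul0r.
  by rewrite coef_deriv coefG // mulr_natl.
move=> ->; rewrite coefM (reindex_inj rev_ord_inj) /=; apply: eq_bigr => k _.
have kn : (k <= n)%N by rewrite -ltnS.
rewrite subSS coefG; last by rewrite ltnS leq_subr.
rewrite mulrC subKn //; congr (_ * _).
rewrite coefB coef_odd_divisor_poly // coef_geoX //.
by case: (k : nat) => [|i] /=; rewrite ?subr0 // /odd_sigma /odd_pairs big_geq ?mulr0.
Qed.

(* Read off from [pbarpoly * theta4 = 1]. *)
Lemma pbar_square_rec n : (0 < n)%N ->
  (pbar n)%:R = 2 * \sum_(1 <= k < n.+1)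
    - ((-1) ^+ k * (if (k ^ 2 <= n)%N then (pbar (n - k ^ 2)%N)%:R else 0)) :> int.
Proof.
move=> n0; pose A := pbarpoly n.+1.
have := eqX_coef (pbarpoly_theta4 (ltn0Sn n)) (ltnSn n).
have coefA i : (i <= n)%N -> A`_i = (pbar i)%:R by move=> iN; rewrite coef_poly ltnS iN natz.
have E : A * theta4 'X n.+1 = A + 2%:R * (\sum_(1 <= k < n.+1) ((-1) ^+ k)%:P * ('X^(k ^ 2) * A)
    + ((-1) ^+ n.+1)%:P * ('X^(n.+1 ^ 2) * A)).
  rewrite /theta4 big_nat_recr //= mulrDr mulr1; congr (_ + _).
  have sgn k : (-1) ^+ k = ((-1) ^+ k)%:P :> {poly int} by rewrite polyC_exp polyCN polyC1.
  rewrite mulrCA; congr (_ * _); rewrite mulrDr big_distrr /=.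
  congr (_ + _); first apply: eq_bigr => k _.
    by rewrite sgn mulrCA [A * _]mulrC.
  by rewrite sgn mulrCA [A * _]mulrC.
rewrite E coefD coefA // mulr_natl coefMn coefD coef_sum coefCM coefXnM.
have -> : (n < n.+1 ^ 2)%N by rewrite -mulnn; nia.
rewrite mulr0 addr0 coef1 eqn0Ngt n0 -[X in _ + X]mulr_natl => /eqP; rewrite addr_eq0 => /eqP ->.
rewrite -mulrN sumrN; congr (_ * - _); apply: eq_bigr => k _.
rewrite coefCM coefXnM ltnNge; case: (k ^ 2 <= n)%N => //=.
by rewrite coefA // leq_subr.
Qed.

(** * Verification for small indices *)

Fixpoint alt_sum (f n k : nat) : int :=
  if f is f'.+1 then
    if (k ^ 2 <= n)%N then (pbar (n - k ^ 2)%N)%:R - alt_sum f' n k.+1 else 0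
  else 0.

Lemma alt_sumE f n k : (n < (k + f) ^ 2)%N -> (0 < k)%N ->
  alt_sum f n k = - (-1) ^+ k * \sum_(k <= j < n.+1)
    - ((-1) ^+ j * (if (j ^ 2 <= n)%N then (pbar (n - j ^ 2)%N)%:R else 0)).
Proof.
have far m : (n < m ^ 2)%N -> \sum_(m <= j < n.+1)
    - ((-1) ^+ j * (if (j ^ 2 <= n)%N then (pbar (n - j ^ 2)%N)%:R else 0)) = 0 :> int.
  move=> nm; rewrite big_nat big1 // => j /andP[mj _].
  have -> : (j ^ 2 <= n)%N = false.
    by apply/negbTE; rewrite -ltnNge (leq_trans nm) // leq_exp2r.
  by rewrite mulr0 oppr0.
elim: f k => [|f IH] k; first by rewrite addn0 => nk _; rewrite far // mulr0.
move=> nk k0 /=; case: ifP => [kn|/negbT]; last by rewrite -ltnNge => /far ->; rewrite mulr0.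
rewrite IH ?addSnnS // (@big_ltn _ _ _ k) ?kn; last first.
  by rewrite ltnS (leq_trans _ kn) // -mulnn leq_pmulr.
rewrite mulrDr exprS mulN1r opprK; set S := \sum_(_ <= _ < _) _.
by rewrite mulrNN mulrA -expr2 sqrr_sign mul1r mulNr.
Qed.

Lemma pbar_alt_sum f n : (0 < n)%N -> (n < f.+1 ^ 2)%N ->
  (pbar n)%:R = 2 * alt_sum f n 1.
Proof.
move=> n0 nf; rewrite pbar_square_rec // alt_sumE ?add1n // expr1 opprK mul1r //.
Qed.

Definition table := PositiveMap.t N.

(* The two accumulators are swapped at each step, so that their distance carries
   the alternating sum. *)
Fixpoint square_walk (t : table) (f : nat) (i step : positive) (a b : N) : N * N :=
  if f is f'.+1 then
    if PositiveMap.find i t is Some v then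
      if Pos.sub_mask i step is Pos.IsPos j
      then square_walk t f' j (step + 2)%positive b (a + v)%num
      else (b, (a + v)%num)
    else (a, b)
  else (a, b).

Arguments square_walk : simpl never.
Arguments alt_sum : simpl never.

(** The sign of the alternating sum is lost here without harm, since twice that sum is the
    nonnegative [pbar n]. *)
Definition Ndist (u : N * N) : N :=
  (if u.1 <? u.2 then u.2 - u.1 else u.1 - u.2)%num.

Definition table_ok (M : nat) (t : table) :=
  forall i, (i <= M)%N ->
    PositiveMap.find (Pos.of_succ_nat i) t = Some (N.of_nat (pbar i)).

Lemma NdistE u : (N.to_nat (Ndist u))%:Z = `|(N.to_nat u.1)%:Z - (N.to_nat u.2)%:Z|.
Proof. by case: u => a b; rewrite /Ndist /=; case: N.ltb_spec; lia. Qed.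

(** Keys are shifted by one, index [i] being stored at [i + 1]. [Pos.of_succ_nat k.*2] is [2 k + 1],
    the gap between consecutive squares, so the walk never computes a square. *)
Lemma square_walkE M t n f k a b : table_ok M t -> (n = M.+1)%N -> (0 < k)%N -> (k ^ 2 <= n)%N ->
  (N.to_nat (Ndist (square_walk t f (Pos.of_succ_nat (n - k ^ 2)) (Pos.of_succ_nat k.*2) a b)))%:Z
  = `|(N.to_nat a)%:Z - (N.to_nat b)%:Z + alt_sum f n k|.
Proof.
move=> tok nM; elim: f k a b => [|f IH] k a b k0 kn; first by rewrite NdistE addr0.
have sqS : (k.+1 ^ 2 = k ^ 2 + k.*2.+1)%N by rewrite -!mulnn; nia.
have sq1 : (0 < k ^ 2)%N by rewrite expn_gt0 k0.
rewrite /square_walk -/square_walk /alt_sum -/alt_sum kn tok; last first.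
  by move: sq1; move: (k ^ 2)%N => q; lia.
case E: (k.+1 ^ 2 <= n)%N.
  have -> : Pos.sub_mask (Pos.of_succ_nat (n - k ^ 2)) (Pos.of_succ_nat k.*2)
      = Pos.IsPos (Pos.of_succ_nat (n - k.+1 ^ 2)).
    have Ek : (n - k ^ 2 = k.*2.+1 + (n - k.+1 ^ 2))%N by move: E kn; rewrite sqS;
      move: (k ^ 2)%N => q; lia.
    apply/Pos.sub_mask_pos_iff; move: Ek; move: (n - k ^ 2)%N (n - k.+1 ^ 2)%N => q q'; lia.
  have -> : (Pos.of_succ_nat k.*2 + 2)%positive = Pos.of_succ_nat k.+1.*2 by lia.
  by rewrite IH // natz; lia.
have -> : alt_sum f n k.+1 = 0 by case: f {IH} => // f; rewrite /alt_sum E.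
rewrite subr0.
case F: (Pos.sub_mask _ _) => [|j|]; try by rewrite NdistE /= natz; lia.
move/Pos.sub_mask_pos_iff: F; move: E kn; rewrite sqS; move: (k ^ 2)%N => q; lia.
Qed.

(** Fuel 100 covers the squares up to [100^2], enough for indices below [101^2]; the initial step 3
    is the gap from 1 to 4. *)
Fixpoint build (c : nat) (t : table) (n : positive) (l : seq N) : seq N :=
  if c is c'.+1 then
    let v := N.double (Ndist (square_walk t 100 (Pos.pred n) 3 0 0)) in
    build c' (PositiveMap.add n v t) (Pos.succ n) (v :: l)
  else l.

Definition pbar_table (c : nat) : seq N :=
  build c (PositiveMap.add 1%positive 1%num (PositiveMap.empty N)) 2 [:: 1%num].

Lemma buildE c M t l : (M + c < 101 ^ 2)%N -> table_ok M t ->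
  l = [seq N.of_nat (pbar i) | i <- rev (iota 0 M.+1)] ->
  build c t (Pos.of_succ_nat M.+1) l
  = [seq N.of_nat (pbar i) | i <- rev (iota 0 (M + c).+1)].
Proof.
elim: c M t l => [|c IH] M t l Mc tok El; first by rewrite addn0.
rewrite [build _ _ _ _]/=.
have -> : N.double (Ndist (square_walk t 100 (Pos.pred (Pos.of_succ_nat M.+1)) 3 0 0))
  = N.of_nat (pbar M.+1).
  have := @square_walkE M t M.+1 100 1 0%num 0%num tok erefl erefl erefl.
  have -> : Pos.of_succ_nat (M.+1 - 1 ^ 2) = Pos.pred (Pos.of_succ_nat M.+1) by rewrite subn1;
    lia.
  have M_lt : (M.+1 < 101 ^ 2)%N by apply: leq_ltn_trans Mc; rewrite addnS ltnS leq_addr.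
  have := @pbar_alt_sum 100 M.+1 erefl M_lt.
  rewrite add0r natz; move: (square_walk _ _ _ _ _ _) => u; move: (alt_sum _ _ _) => z; lia.
have -> : Pos.succ (Pos.of_succ_nat M.+1) = Pos.of_succ_nat M.+2 by lia.
rewrite (IH M.+1) ?addSnnS //.
- move=> i; rewrite leq_eqVlt => /predU1P[->|]; first by rewrite PositiveMap.gss.
  by rewrite ltnS => iM; rewrite PositiveMap.gso ?tok //; lia.
- by rewrite El -[in RHS]addn1 iotaD rev_cat.
Qed.

Lemma pbar_tableE c : (c < 101 ^ 2)%N ->
  pbar_table c = [seq N.of_nat (pbar i) | i <- rev (iota 0 c.+1)].
Proof.
move=> c_lt; rewrite /pbar_table (@buildE c 0) ?add0n //.
  by move=> [|i] // _; rewrite /= pbar0.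
by rewrite /= pbar0.
Qed.

(** Nothing is rounded when [s = 0], so the check is exact for small values, where the subtraction
    of 55 is cut off at 0. *)
Definition trunc_up (s d : N) : N := (if s =? 0 then d else N.shiftr d s + 1)%num.

(* Only the leading bits of the differences are multiplied; [trunc_up] bounds
   the terms with a negative coefficient. *)
Definition laguerre_check (p0 p1 p2 p3 p4 p5 : N) : bool :=
  let d0 := (p1 - p0)%num in let d1 := (p2 - p1)%num in let d2 := (p3 - p2)%num in
  let d3 := (p4 - p3)%num in let d4 := (p5 - p4)%num in
  (* The expression is smaller than its terms by a factor of order [n^3], so 55 bits leave ample
     precision below 6000. *)
  let s := (N.size d0 - 55)%num in
  [&& N.leb p0 p1, N.leb p1 p2, N.leb p2 p3, N.leb p3 p4, N.leb p4 p5 &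
     N.ltb (4 * (trunc_up s d1 * trunc_up s d3))
       (3 * (N.shiftr d2 s * N.shiftr d2 s) + N.shiftr d0 s * N.shiftr d4 s)].

Definition laguerre_dpbar (n : nat) : Prop :=
  (0 : int) < 3 * dpbar (n + 2)%N ^+ 2 - 4 * dpbar (n + 1)%N * dpbar (n + 3)%N
    + dpbar n * dpbar (n + 4)%N.

Lemma shiftr_le d s : (N.shiftr d s * 2 ^ s <= d)%num.
Proof. rewrite N.shiftr_div_pow2 N.mul_comm; apply: N.Div0.mul_div_le. Qed.

Lemma trunc_up_ge d s : (d <= trunc_up s d * 2 ^ s)%num.
Proof.
rewrite /trunc_up; case: N.eqb_spec => [->|_]; first by rewrite N.pow_0_r; lia.
have := N.mul_succ_div_gt d (2 ^ s)%num; rewrite N.shiftr_div_pow2.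
have : (2 ^ s)%num <> 0%num by apply: N.pow_nonzero.
move: (2 ^ s)%num (d / _)%num => q e; nia.
Qed.

Lemma laguerre_checkP n :
  laguerre_check (N.of_nat (pbar n)) (N.of_nat (pbar n.+1)) (N.of_nat (pbar n.+2))
    (N.of_nat (pbar n.+3)) (N.of_nat (pbar n.+4)) (N.of_nat (pbar n.+4.+1)) ->
  laguerre_dpbar n.
Proof.
rewrite /laguerre_check /laguerre_dpbar !addnS !addn0.
set s := (_ - 55)%num.
set d0 := (N.of_nat (pbar n.+1) - _)%num; set d1 := (N.of_nat (pbar n.+2) - _)%num.
set d2 := (N.of_nat (pbar n.+3) - _)%num; set d3 := (N.of_nat (pbar n.+4) - _)%num.
set d4 := (N.of_nat (pbar n.+4.+1) - _)%num.
case/and5P => /N.leb_spec0 l0 /N.leb_spec0 l1 /N.leb_spec0 l2 /N.leb_spec0 l3.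
case/andP => /N.leb_spec0 l4 /N.ltb_spec0 H.
have E0 : dpbar n = (N.to_nat d0)%:Z by rewrite /dpbar /Delta /d0; lia.
have E1 : dpbar n.+1 = (N.to_nat d1)%:Z by rewrite /dpbar /Delta /d1; lia.
have E2 : dpbar n.+2 = (N.to_nat d2)%:Z by rewrite /dpbar /Delta /d2; lia.
have E3 : dpbar n.+3 = (N.to_nat d3)%:Z by rewrite /dpbar /Delta /d3; lia.
have E4 : dpbar n.+4 = (N.to_nat d4)%:Z by rewrite /dpbar /Delta /d4; lia.
rewrite E0 E1 E2 E3 E4.
have fin : (4 * (d1 * d3) < 3 * (d2 * d2) + d0 * d4)%num ->
    (0 : int) < 3 * (N.to_nat d2)%:Z ^+ 2 - 4 * (N.to_nat d1)%:Z * (N.to_nat d3)%:Z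
      + (N.to_nat d0)%:Z * (N.to_nat d4)%:Z.
  by rewrite expr2; move: d0 d1 d2 d3 d4 {E0 E1 E2 E3 E4 H s} => a b c d e; nia.
apply: fin.
have q_neq0 : (2 ^ s)%num <> 0%num by apply: N.pow_nonzero.
have q0 : (0 < 2 ^ s)%num by lia.
have := @shiftr_le d0 s; have := @shiftr_le d2 s; have := @shiftr_le d4 s.
have := @trunc_up_ge d1 s; have := @trunc_up_ge d3 s.
move: H q0; move: (trunc_up s d1) (trunc_up s d3) => b d.
move: (N.shiftr d0 s) (N.shiftr d2 s) (N.shiftr d4 s) => a c e.
move: (2 ^ s)%num {q_neq0} => q H q0 Hd Hb He Hc Ha.
have X1 := N.mul_le_mono _ _ _ _ Hb Hd.
have X2 := N.mul_le_mono _ _ _ _ Hc Hc.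
have X3 := N.mul_le_mono _ _ _ _ Ha He.
have q20 : (0 < q * q)%num by nia.
have X4 := proj1 (N.mul_lt_mono_pos_r _ _ _ q20) H.
nia.
Qed.

Fixpoint windows (c : nat) (l : seq N) : bool :=
  if c is c'.+1 then
    if l is p5 :: ((p4 :: p3 :: p2 :: p1 :: p0 :: _) as l')
    then laguerre_check p0 p1 p2 p3 p4 p5 && windows c' l' else false
  else true.

Lemma windowsP c M n : windows c [seq N.of_nat (pbar i) | i <- rev (iota 0 M.+1)] ->
  (n + 5 <= M)%N -> (M < n + 5 + c)%N -> laguerre_dpbar n.
Proof.
have revS m : rev (iota 0 m.+1) = m :: rev (iota 0 m) by rewrite -[in LHS]addn1 iotaD rev_cat.
elim: c M => [|c IH] M; first by rewrite addn0 => _; rewrite leqNgt => /negbTE ->.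
move=> H nM Mc.
have [m Em] : exists m, M = m.+4.+1 by exists (M - 5)%N; lia.
subst M; move: H; do 6 rewrite revS; rewrite /= => /andP[H1 H2].
have [En|nm] := eqVneq n m; first by subst n; apply: laguerre_checkP.
apply: (IH m.+4); [by do 5 rewrite revS|lia|lia].
Qed.

(** The window of [n] ends at [n + 5], so [n <= 5996] needs the table up to 6001; 5947 windows
    counted from the top reach down to [n = 50]. *)
Lemma windows_check : windows (N.to_nat 5947) (pbar_table (N.to_nat 6001)).
Proof. vm_cast_no_check (erefl true). Qed.

Lemma laguerre_small n : (50 <= n)%N -> (n < N.to_nat 5997)%N -> laguerre_dpbar n.
Proof.
move=> n50 n5997; have := windows_check; rewrite pbar_tableE; last by lia.
by move/windowsP; apply; lia.
Qed.

(** * Transfer to the real sequence *)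

Module Bridge.

Import Reals Lra.
Delimit Scope R_scope with Re.
Delimit Scope nat_scope with N.
Local Open Scope ring_scope.

Definition toR (z : int) : R := IZR (Z_of_int z).

Lemma toRD a b : toR (a + b) = (toR a + toR b)%Re.
Proof. by rewrite /toR -plus_IZR; congr IZR; lia. Qed.

Lemma toRM a b : toR (a * b) = (toR a * toR b)%Re.
Proof. by rewrite /toR -mult_IZR; congr IZR; lia. Qed.

Lemma toRN a : toR (- a) = (- toR a)%Re.
Proof. by rewrite /toR -opp_IZR; congr IZR; lia. Qed.

Lemma toR_nat n : toR n%:R = INR n.
Proof. by rewrite /toR natz INR_IZR_INZ; congr IZR; lia. Qed.

Lemma toR_sum (F : nat -> int) n :
  toR (\sum_(k < n.+1) F k) = sum_f_R0 (fun k => toR (F k)) n.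
Proof.
elim: n => [|n IH]; first by rewrite big_ord_recl big_ord0 addr0.
by rewrite big_ord_recr toRD IH.
Qed.

Lemma INR_sum (F : nat -> nat) n : F 0%N = 0%N ->
  INR (\sum_(1 <= k < n.+1) F k) = sum_f_R0 (fun k => INR (F k)) n.
Proof.
move=> F0; elim: n => [|n IH]; first by rewrite big_geq // /= F0.
by rewrite big_nat_recr // plus_INR IH.
Qed.

Lemma Nat_oddE j : Nat.odd j = odd j.
Proof. by elim: j => // j IH; rewrite Nat.odd_succ -Nat.negb_odd IH. Qed.

Lemma sum_f_R0_exchange (f : nat -> nat -> R) M N :
  sum_f_R0 (fun i => sum_f_R0 (fun j => f i j) M) N
  = sum_f_R0 (fun j => sum_f_R0 (fun i => f i j) N) M.
Proof. by elim: N => [|N IH] //=; rewrite IH -plus_sum. Qed.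

Lemma odd_sigma_INR K k : (0 < k <= K)%N -> INR (odd_sigma k)
  = sum_f_R0 (fun d => sum_f_R0 (fun j =>
      if odd j && (j * d == k)%N then INR d else 0%Re) K) K.
Proof.
case/andP=> k0 kK; rewrite -(@odd_pairsE K.+1 K.+1) // /odd_pairs INR_sum; last first.
  rewrite big_nat_cond big1 // => j _; rewrite muln0 eq_sym eqn0Ngt k0 //.
apply: PartSum.sum_eq => d _; rewrite big_mkcond INR_sum //.
by apply: PartSum.sum_eq => j _; case: (odd j); case: (_ == _).
Qed.

Lemma sum_f_R0_pick (c : nat -> R) v i K : (0 <= v)%Re -> (forall k, 0 <= c k)%Re ->
  (sum_f_R0 (fun k => (if i == k then v else 0) * c k) K <= v * c i)%Re.
Proof.
move=> v0 c0.
have H n : sum_f_R0 (fun k => (if i == k then v else 0) * c k)%Re n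
    = if (i <= n)%N then (v * c i)%Re else 0%Re.
  elim: n => [|n IH] /=; first by rewrite leqn0; case: eqP => [->|_] //; lra.
  rewrite IH [(i <= n.+1)%N]leq_eqVlt ltnS; case: eqP => [->|_] /=; last by lra.
  by rewrite ltnn; lra.
rewrite H; case: ifP => _; first by lra.
by apply: Rmult_le_pos.
Qed.

Definition eR k := toR (e_int k).
Definition gR n := toR (g_int n).

Lemma eR_ge k : (1 <= k)%coq_nat -> (2 * INR k - 1 <= eR k)%Re.
Proof.
move=> k1; have k0 : (0 < k)%N by lia.
rewrite /eR; case: k {k1} k0 => // k _.
have t1 : toR 1 = 1%Re by [].
rewrite /e_int toRD toRM toRN !toR_nat t1 (_ : INR 2 = 2%Re) //.
have : (INR k.+1 <= INR (odd_sigma k.+1))%Re.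
  apply: le_INR; apply/leP; rewrite /odd_sigma /odd_pairs big_nat_recr //=.
  by apply: leq_trans (leq_addl _ _); rewrite big_ltn_cond //= mul1n eqxx leq_addr.
rewrite S_INR; lra.
Qed.

(** Drop the [- 1] in [e k], write [k = j d] so that [k^p = j^p d^p], and let [j] and [d] range
    independently up to [K]; pairs with [j d > K] only add nonnegative terms. *)
Lemma moment_eR_le K x p : (Analysis.moment K eR x p <= 2 * sum_f_R0 (fun j => if Nat.odd j then
  INR j ^ p * sum_f_R0 (fun d => INR d ^ S p * (exp (- x) ^ j) ^ d) K else 0) K)%Re.
Proof.
set r := exp (- x).
have r0 k : (0 < r ^ k)%Re by apply: pow_lt; apply: exp_pos.
pose c k := (INR k ^ p * r ^ k)%Re.
have c0 k : (0 <= c k)%Re.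
  by apply: Rmult_le_pos; [apply: pow_le; apply: pos_INR|apply: Rlt_le].
pose T k j d := (if odd j && (j * d == k)%N then INR d else 0)%Re.
apply: Rle_trans (_ : (2 * sum_f_R0 (fun k => sum_f_R0 (fun d => sum_f_R0
  (fun j => T k j d * c k) K) K) K <= _)%Re).
  rewrite scal_sum; apply: PartSum.sum_Rle => k kK; rewrite -/r.
  have S0 : (0 <= sum_f_R0 (fun d => sum_f_R0 (fun j => T k j d) K) K)%Re.
    apply: cond_pos_sum => d; apply: cond_pos_sum => j; rewrite /T.
    by case: ifP => _; [apply: pos_INR|apply: Rle_refl].
  have -> : (sum_f_R0 (fun d => sum_f_R0 (fun j => T k j d * c k) K) K
     = c k * sum_f_R0 (fun d => sum_f_R0 (fun j => T k j d) K) K)%Re.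
    rewrite scal_sum; apply: PartSum.sum_eq => d _.
    by rewrite Rmult_comm scal_sum.
  have -> : (INR k ^ p * eR k * r ^ k = c k * eR k)%Re by rewrite /c; lra.
  rewrite Rmult_assoc; apply: Rmult_le_compat_l => //.
  case: (posnP k) => [k0|k0]; first by rewrite k0 /eR /toR /= in S0 *; lra.
  rewrite -(odd_sigma_INR (K := K)); last by rewrite k0; apply/leP.
  rewrite /eR; case: k k0 {kK S0 c0} => // k _.
  have t1 : toR 1 = 1%Re by [].
  by rewrite /e_int toRD toRM toRN !toR_nat t1 (_ : INR 2 = 2%Re) //; lra.
apply: Rmult_le_compat_l; first by lra.
rewrite sum_f_R0_exchange.
have -> : sum_f_R0 (fun d => sum_f_R0 (fun k => sum_f_R0 (fun j => T k j d * c k)%Re K) K) K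
  = sum_f_R0 (fun j => sum_f_R0 (fun d => sum_f_R0 (fun k => T k j d * c k)%Re K) K) K.
  rewrite [RHS]sum_f_R0_exchange; apply: PartSum.sum_eq => d _; exact: sum_f_R0_exchange.
apply: PartSum.sum_Rle => j _; rewrite Nat_oddE /T.
case: (odd j); last first.
  by rewrite sum_eq_R0; [apply: Rle_refl|move=> d _; rewrite sum_eq_R0 // => k _ /=; lra].
rewrite scal_sum; apply: PartSum.sum_Rle => d _.
apply: Rle_trans (sum_f_R0_pick (j * d) K (pos_INR d) c0) _.
rewrite /c mult_INR pow_mult Rpow_mult_distr /=; lra.
Qed.

Lemma eR0 : eR 0 = 0%Re. Proof. by []. Qed.
Lemma gR0 : gR 0 = 1%Re. Proof. by []. Qed.

Lemma gR_rec n : (INR n * gR n = sum_f_R0 (fun k => eR k * gR (n - k)%coq_nat) n)%Re.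
Proof.
rewrite /gR -toR_nat -toRM g_int_rec (toR_sum (fun k => e_int k * g_int (n - k))).
by apply: PartSum.sum_eq => k _; rewrite toRM.
Qed.

Lemma dpbar_g_int n : dpbar n = g_int n.+1.
Proof. by rewrite /dpbar /Delta /g_int !natz. Qed.

Lemma laguerre_dpbar_large n : (N.to_nat 5997 <= n)%N -> laguerre_dpbar n.
Proof.
(* The middle term [dpbar (n + 2)] is [g_int (n + 3)], hence [m = n + 3]. *)
move=> n_ge; have m_ge : (6000 <= INR (n + 3))%Re.
  by rewrite INR_IZR_INZ; apply: IZR_le; lia.
have := Analysis.laguerre_large eR gR eR0 eR_ge moment_eR_le gR0 gR_rec (n + 3) m_ge.
have -> : (n + 3 - 1)%coq_nat = n.+2 by lia.
have -> : (n + 3 - 2)%coq_nat = n.+1 by lia.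
have -> : (n + 3 + 1)%coq_nat = n.+4 by lia.
have -> : (n + 3 + 2)%coq_nat = n.+4.+1 by lia.
rewrite addn3 /laguerre_dpbar !addnS !addn0 !dpbar_g_int => H.
move: H; rewrite /gR expr2.
move: (g_int n.+1) (g_int n.+2) (g_int n.+3) (g_int n.+4) (g_int n.+4.+1) => a b c d e H.
set z := (X in 0 < X).
suff : (0 < toR z)%Re by rewrite /toR => /(lt_IZR 0); lia.
have t1 : toR 1 = 1%Re by [].
by rewrite /z !(toRD, toRN, toRM) t1; lra.
Qed.

End Bridge.

Theorem theorem3p2 (n : nat) (hn : (50 <= n)%N) :
  (0 : int) < 3 * dpbar (n + 2)%N ^+ 2
            - 4 * dpbar (n + 1)%N * dpbar (n + 3)%N
            + dpbar n * dpbar (n + 4)%N.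
Proof.
have [n_lt|n_ge] := ltnP n (N.to_nat 5997); first exact: laguerre_small.
exact: Bridge.laguerre_dpbar_large.
Qed.
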